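(* Let $\phi\colon \mathbb{D}\to\mathbb{D}$ be an analytic self-map of the open unit disk. Then there exists $w\in H^2$ with $w\not\equiv 0$ such that the weighted composition operator $M_wC_\phi\colon f\mapsto w\,(f\circ\phi)$ is a bounded and compact operator on $H^2$ if and only if $$m\big(\{\xi\in\mathbb{T} : |\phi^\ast(\xi)|=1\}\big)=0 .$$
   Context: $\mathbb{D}$ is the open unit disk, $\mathbb{T}=\partial\mathbb{D}$, and $m$ is the normalized Lebesgue (Haar) measure on $\mathbb{T}$. $H^2$ is the Hardy space of the disk. For an analytic self-map $\phi$ of $\mathbb{D}$, $\phi^\ast(\xi)=\lim_{r\to1^-}\phi(r\xi)$ denotes its radial limit function, defined $m$-almost everywhere. For $w\in H^2$, $M_wC_\phi$ is the operator $f\mapsto w\,(f\circ\phi)$. *)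

(* Defs.v *)
From HB Require Import structures.
From mathcomp Require Import all_boot all_order all_algebra.
From mathcomp Require Import all_classical all_reals all_analysis.
From mathcomp Require Import complex.
Import Order.TTheory GRing.Theory Num.Theory.
Import numFieldNormedType.Exports.

Set Implicit Arguments.
Unset Strict Implicit.
Unset Printing Implicit Defensive.

Local Open Scope classical_set_scope.
Local Open Scope ring_scope.

(* The complex numbers over a real type R, with the normed structure over itself. *)
Definition Cplx (R : realType) : numClosedFieldType := R[i].

Definition cmod (R : realType) (z : Cplx R) : R := ComplexField.Normc.normc (z : R[i]).

Definition udisk (R : realType) : set (Cplx R) := [set z | cmod z < 1].

Definition expi (R : realType) (t : R) : Cplx R :=
  ((cos (2 * pi * t)) +i* (sin (2 * pi * t)))%C.

Definition cR (R : realType) (r : R) : Cplx R := (r%:C)%C.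

Definition holo_disk (R : realType) (f : Cplx R -> Cplx R) : Prop :=
  forall z : Cplx R, udisk z -> derivable f z 1.

Definition self_map (R : realType) (phi : Cplx R -> Cplx R) : Prop :=
  holo_disk phi /\ forall z, udisk z -> udisk (phi z).

Definition intmean2 (R : realType) (f : Cplx R -> Cplx R) (r : R) : \bar R :=
  (\int[@lebesgue_measure R]_(t in `[0%R, 1%R[) ((cmod (f (cR r * expi t))) ^+ 2)%:E)%E.

Definition H2norm2 (R : realType) (f : Cplx R -> Cplx R) : \bar R :=
  ereal_sup [set intmean2 f r | r in `[0%R, 1%R[].

Definition inH2 (R : realType) (f : Cplx R -> Cplx R) : Prop :=
  holo_disk f /\ (H2norm2 f < +oo)%E.

Definition wcomp (R : realType) (w phi : Cplx R -> Cplx R)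
  (f : Cplx R -> Cplx R) : Cplx R -> Cplx R :=
  fun z => w z * f (phi z).

Definition bounded_on_H2 (R : realType)
  (T : (Cplx R -> Cplx R) -> (Cplx R -> Cplx R)) : Prop :=
  exists M : R, forall f, inH2 f ->
    inH2 (T f) /\ (H2norm2 (T f) <= M%:E * H2norm2 f)%E.

Definition compact_on_H2 (R : realType)
  (T : (Cplx R -> Cplx R) -> (Cplx R -> Cplx R)) : Prop :=
  forall f : nat -> (Cplx R -> Cplx R),
    (forall n, inH2 (f n)) -> (exists B : R, forall n, (H2norm2 (f n) <= B%:E)%E) ->
    exists (sigma : nat -> nat) (g : Cplx R -> Cplx R),
      {homo sigma : m n / (m < n)%N >-> (m < n)%N} /\ inH2 g /\
      ((fun n => H2norm2 (fun z => T (f (sigma n)) z - g z)) @ \oo --> 0%E).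

Definition unimod_set (R : realType) (phi : Cplx R -> Cplx R) : set R :=
  [set t | (t \in `[0%R, 1%R[) /\
     (exists l : Cplx R,
       (phi (cR r * expi t) @[r --> at_left (1%R : R)] --> l) /\ cmod l = 1)].

(* Main.v *)
Require Import Defs.
From HB Require Import structures.
From mathcomp Require Import all_boot all_order all_algebra.
From mathcomp Require Import all_classical all_reals all_analysis.
From mathcomp Require Import measurable_realfun complex.
From mathcomp Require Import ring lra.
Import Order.TTheory GRing.Theory Num.Theory.
Import numFieldNormedType.Exports.
Local Open Scope classical_set_scope.
Local Open Scope ring_scope.

(** Both conditions are equivalent to the decay of the powers: for every [e > 0]
    some [phi ^+ n] has squared H2 norm at most [e].

    Compactness gives decay: the monomials [z ^+ n] are bounded in H2 and tend to [0]
    pointwise, so a subsequence of [w * phi ^+ n] tends to [0] in H2.  After a zero of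
    [w] at the origin is divided out, Jensen's inequality
    [log |w 0|^2 <= int log |w|^2], used in an exponential form, prevents
    [w * phi ^+ n] from being small when [phi ^+ n] is not.

    Decay gives compactness: along a subsequence the squared norms of [phi ^+ n_k] are
    summable, and [w = exp (- H)], where [Re H] is a harmonic majorant of
    [sum_k |phi ^+ n_k|^2], makes [w * phi ^+ n] tend to [0] uniformly.  By Littlewood
    subordination the operator is then a uniform limit of finite rank operators.

    By Fatou's theorem [phi] has radial limits [psi] almost everywhere: [psi] is first
    obtained along a sequence of radii, [phi] is its Poisson integral, and the Poisson
    kernel is an approximate identity at the Lebesgue points of [psi].  The squared norm
    of [phi ^+ n] is the integral of [|psi|^(2n)], which decreases to the measure of
    [|psi| = 1]. *)

Set Implicit Arguments.
Unset Strict Implicit.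
Unset Printing Implicit Defensive.

(** * Complex numbers *)

Section complex_numbers.
Context {R : realType}.
Local Notation C := (Cplx R).
Implicit Types (z w : C) (r x y : R).

(** Decay is a statement inside the disk, so the operator side never meets boundary values and the
    measure side never meets operators. The measure side is asymmetric. [unimod_set] only collects
    points where the radial limit exists: from decay to a null set, Fatou's lemma along one sequence
    of radii suffices. The converse has to know that radial limits exist almost everywhere, since a
    null [unimod_set] says nothing about the remaining points; this is where Fatou's theorem enters,
    and a limit along a sequence of radii would not be enough. Jensen's inequality avoids logarithms
    because [log |w|] may be unbounded below on a circle. It is replaced by the bound of [|G 0|^2]
    by the mean of [|G|^2] for [G = w exp (x H)], with [x] taken large at the end. One explicit
    construction serves Littlewood subordination, the weight and the Jensen step: [hmaj], a
    polynomial in [z] built from Taylor coefficients, whose real part equals the squared modulus of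
    a Taylor polynomial on the unit circle. H2 norms are read off coefficients by Parseval, so all
    rests on the Taylor expansion of complex differentiable functions, hence on Goursat. *)

Definition cre z : R := complex.Re (z : R[i]).
Definition cim z : R := complex.Im (z : R[i]).
Definition cpair x y : C := (x +i* y)%C.
Definition cconj z : C := cpair (cre z) (- cim z).

Lemma cplxP z w : cre z = cre w -> cim z = cim w -> z = w.
Proof. by case: z => a b; case: w => c d; rewrite /cre /cim /= => -> ->. Qed.

Lemma creD z w : cre (z + w) = cre z + cre w.
Proof. by case: z; case: w. Qed.
Lemma cimD z w : cim (z + w) = cim z + cim w.
Proof. by case: z; case: w. Qed.
Lemma creN z : cre (- z) = - cre z.
Proof. by case: z. Qed.
Lemma cimN z : cim (- z) = - cim z.
Proof. by case: z. Qed.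
Lemma creM z w : cre (z * w) = cre z * cre w - cim z * cim w.
Proof. by case: z; case: w. Qed.
Lemma cimM z w : cim (z * w) = cre z * cim w + cim z * cre w.
Proof. by case: z => a b; case: w. Qed.
Lemma cre0 : cre 0 = 0. Proof. by []. Qed.
Lemma cim0 : cim 0 = 0. Proof. by []. Qed.
Lemma cre1 : cre 1 = 1. Proof. by []. Qed.
Lemma cim1 : cim 1 = 0. Proof. by []. Qed.
Lemma cre_pair x y : cre (cpair x y) = x. Proof. by []. Qed.
Lemma cim_pair x y : cim (cpair x y) = y. Proof. by []. Qed.
Lemma cre_cR x : cre (cR x) = x. Proof. by []. Qed.
Lemma cim_cR x : cim (cR x) = 0. Proof. by []. Qed.
Lemma cre_expi x : cre (expi x) = cos (2 * pi * x). Proof. by []. Qed.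
Lemma cim_expi x : cim (expi x) = sin (2 * pi * x). Proof. by []. Qed.
Lemma cre_conj z : cre (cconj z) = cre z. Proof. by []. Qed.
Lemma cim_conj z : cim (cconj z) = - cim z. Proof. by []. Qed.

Definition cE := (creD, cimD, creN, cimN, creM, cimM, cre0, cim0, cre1, cim1,
  cre_pair, cim_pair, cre_cR, cim_cR, cre_expi, cim_expi, cre_conj, cim_conj).

Lemma cmodE z : cmod z = Num.sqrt (cre z ^+ 2 + cim z ^+ 2).
Proof. by case: z. Qed.

Lemma sqr_cmod z : cmod z ^+ 2 = cre z ^+ 2 + cim z ^+ 2.
Proof. by rewrite cmodE sqr_sqrtr // addr_ge0 // sqr_ge0. Qed.

Lemma cmod_ge0 z : 0 <= cmod z.
Proof. by rewrite cmodE sqrtr_ge0. Qed.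
Hint Resolve cmod_ge0 : core.

Lemma cmodM z w : cmod (z * w) = cmod z * cmod w.
Proof. exact: ComplexField.Normc.normcM. Qed.
Lemma cmodD z w : cmod (z + w) <= cmod z + cmod w.
Proof. exact: le_normcD. Qed.
Lemma cmodN z : cmod (- z) = cmod z.
Proof. exact: normcN. Qed.
Lemma cmod0 : cmod (0 : C) = 0.
Proof. exact: ComplexField.Normc.normc0. Qed.
Lemma cmod1 : cmod (1 : C) = 1.
Proof. exact: ComplexField.Normc.normc1. Qed.
Lemma cmodV z : cmod z^-1 = (cmod z)^-1.
Proof. exact: ComplexField.Normc.normcV. Qed.
Lemma cmod_eq0 z : (cmod z == 0) = (z == 0).
Proof.
apply/eqP/eqP => [|->]; last exact: cmod0.
exact: ComplexField.Normc.eq0_normc.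
Qed.
Lemma cmod_gt0 z : (0 < cmod z) = (z != 0).
Proof. by rewrite lt_def cmod_eq0 cmod_ge0 andbT. Qed.
Lemma cmodX z n : cmod (z ^+ n) = cmod z ^+ n.
Proof. by elim: n => [|n IH]; rewrite ?expr0 ?cmod1 // !exprS cmodM IH. Qed.
Lemma cmodBC z w : cmod (z - w) = cmod (w - z).
Proof. by rewrite -cmodN opprB. Qed.
Lemma cmodB z w : cmod (z - w) <= cmod z + cmod w.
Proof. by rewrite (le_trans (cmodD _ _))// cmodN. Qed.
Lemma cmod_sub_ge z w : cmod z - cmod w <= cmod (z - w).
Proof. by rewrite lerBlDr -{1}(subrK w z) cmodD. Qed.
Lemma cmod_cR x : cmod (cR x) = `|x|.
Proof. by rewrite cmodE !cE expr0n addr0 sqrtr_sqr. Qed.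
Lemma cmod_conj z : cmod (cconj z) = cmod z.
Proof. by rewrite !cmodE !cE sqrrN. Qed.
Lemma cmod_sum (I : Type) (s : seq I) (P : pred I) (F : I -> C) :
  cmod (\sum_(i <- s | P i) F i) <= \sum_(i <- s | P i) cmod (F i).
Proof.
elim/big_rec2: _ => [|i x y _ h]; first by rewrite cmod0.
by rewrite (le_trans (cmodD _ _)) // lerD2l.
Qed.
Lemma norm_cre z : `|cre z| <= cmod z.
Proof.
by rewrite -(ler_sqr (x := `|_|)) ?nnegrE // real_normK ?num_real // sqr_cmod lerDl sqr_ge0.
Qed.
Lemma norm_cim z : `|cim z| <= cmod z.
Proof.
by rewrite -(ler_sqr (x := `|_|)) ?nnegrE // real_normK ?num_real // sqr_cmod lerDr sqr_ge0.
Qed.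
Lemma cmod_le_reim z : cmod z <= `|cre z| + `|cim z|.
Proof.
rewrite -(ler_sqr (x := cmod _)) ?nnegrE ?addr_ge0 // sqr_cmod sqrrD.
rewrite !real_normK ?num_real // -addrA lerD2l lerDr.
by rewrite mulrn_wge0 // mulr_ge0.
Qed.

Lemma cRD x y : cR (x + y) = cR x + cR y.
Proof. by apply: cplxP; rewrite !cE ?addr0. Qed.
Lemma cRN x : cR (- x) = - cR x.
Proof. by apply: cplxP; rewrite !cE ?oppr0. Qed.
Lemma cRB x y : cR (x - y) = cR x - cR y.
Proof. by rewrite cRD cRN. Qed.
Lemma cRM x y : cR (x * y) = cR x * cR y.
Proof. by apply: cplxP; rewrite !cE; ring. Qed.
Lemma cR0 : cR (0 : R) = 0. Proof. by []. Qed.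
Lemma cR1 : cR (1 : R) = 1. Proof. by []. Qed.
Lemma cRX x n : cR (x ^+ n) = cR x ^+ n.
Proof. by elim: n => [//|n IH]; rewrite !exprS cRM IH. Qed.
Lemma cRnat n : cR (n%:R : R) = n%:R.
Proof. by elim: n => [//|n IH]; rewrite -!natr1 cRD IH. Qed.
Lemma cRV x : cR x^-1 = (cR x)^-1.
Proof.
have [->|x0] := eqVneq x 0; first by rewrite invr0 cR0 invr0.
have cx0 : cR x != 0 by rewrite -cmod_eq0 cmod_cR normr_eq0.
by apply: (mulIf cx0); rewrite mulVf // -cRM mulVf.
Qed.
Lemma cre_sum (I : Type) (s : seq I) (P : pred I) (F : I -> C) :
  cre (\sum_(i <- s | P i) F i) = \sum_(i <- s | P i) cre (F i).
Proof. exact: (big_morph cre creD cre0). Qed.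
Lemma cR_sum (I : Type) (s : seq I) (P : pred I) (F : I -> R) :
  cR (\sum_(i <- s | P i) F i) = \sum_(i <- s | P i) cR (F i).
Proof. exact: (big_morph _ cRD cR0). Qed.

Lemma cconjD z w : cconj (z + w) = cconj z + cconj w.
Proof. by apply: cplxP; rewrite !cE // opprD. Qed.
Lemma cconjM z w : cconj (z * w) = cconj z * cconj w.
Proof. by apply: cplxP; rewrite !cE; ring. Qed.
Lemma mul_conj z : z * cconj z = cR (cmod z ^+ 2).
Proof. by apply: cplxP; rewrite !cE ?sqr_cmod; ring. Qed.

Lemma cmod_expi x : cmod (expi x) = 1.
Proof. by rewrite cmodE !cE cos2Dsin2 sqrtr1. Qed.
Lemma expiD x y : expi (x + y) = expi x * expi y.
Proof. by apply: cplxP; rewrite !cE mulrDr ?cosD ?sinD; ring. Qed.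
Lemma expi0 : expi (0 : R) = 1.
Proof. by apply: cplxP; rewrite !cE mulr0 ?cos0 ?sin0. Qed.
Lemma expi1 : expi (1 : R) = 1.
Proof. by apply: cplxP; rewrite !cE mulr1 mulr_natl ?cos2pi ?sin2pi. Qed.
Lemma expi_conj x : cconj (expi x) = expi (- x).
Proof. by apply: cplxP; rewrite !cE mulrN ?cosN ?sinN. Qed.
Lemma expiMn x n : expi (n%:R * x) = expi x ^+ n.
Proof.
elim: n => [|n IH]; first by rewrite mul0r expi0.
by rewrite -natr1 mulrDl mul1r expiD IH exprSr.
Qed.
Lemma expi_neq0 x : expi x != 0.
Proof. by rewrite -cmod_gt0 cmod_expi. Qed.
Lemma expiN x : expi (- x) = (expi x)^-1.
Proof.
by apply: (mulIf (expi_neq0 x)); rewrite mulVf ?expi_neq0 // -expiD addNr expi0.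
Qed.
Lemma cmod_circle r x : cmod (cR r * expi x) = `|r|.
Proof. by rewrite cmodM cmod_cR cmod_expi mulr1. Qed.

Lemma normC_cmod z : `|z| = cR (cmod z).
Proof. by case: z. Qed.

Lemma ltcR x y : (cR x < cR y) = (x < y).
Proof. exact: ltcR. Qed.
Lemma lecR x y : (cR x <= cR y) = (x <= y).
Proof. exact: lecR. Qed.
Lemma gt0_cR (e : C) : 0 < e -> exists2 x, 0 < x & e = cR x.
Proof.
case: e => a b; rewrite ltcE /= => /andP[/eqP h a0]; exists a => //.
by rewrite /cR; congr (_ +i* _)%C; rewrite -h.
Qed.

(** The norm of [Cplx R] takes complex values, so convergence quantifies over complex radii; by
    [gt0_cR] a positive one is real, and limits can be handled with the real modulus. *)
Lemma cvgC_cmod {T : Type} (F : set_system T) {FF : Filter F} (u : T -> C) (l : C) :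
  u x @[x --> F] --> l <-> cmod (u x - l) @[x --> F] --> 0.
Proof.
split=> [/cvgrPdist_lt h|/cvgrPdist_lt h]; apply/cvgrPdist_lt => e e0.
  have /h : 0 < cR e by rewrite (@ltcR 0).
  apply: filterS => x; rewrite normC_cmod ltcR sub0r normrN ger0_norm //.
  by rewrite cmodBC.
have [d d0 ->] := gt0_cR e0; apply: filterS (h _ d0) => x.
by rewrite sub0r normrN ger0_norm // cmodBC normC_cmod ltcR.
Qed.

Lemma cvgC_ltP {T : Type} (F : set_system T) {FF : Filter F} (u : T -> C) (l : C) :
  u x @[x --> F] --> l <->
  forall e : R, 0 < e -> \forall x \near F, cmod (u x - l) < e.
Proof.
rewrite cvgC_cmod; split=> [/cvgrPdist_lt h e /h|h]; last first.
  apply/cvgrPdist_lt => e /h; apply: filterS => x.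
  by rewrite sub0r normrN ger0_norm.
by apply: filterS => x; rewrite sub0r normrN ger0_norm.
Qed.

Lemma cvg_cre {T : Type} (F : set_system T) {FF : Filter F} (u : T -> C) (l : C) :
  u x @[x --> F] --> l -> cre (u x) @[x --> F] --> cre l.
Proof.
move=> /cvgC_ltP h; apply/cvgrPdist_lt => e /h; apply: filterS => x.
by apply: le_lt_trans; rewrite distrC -creN -creD norm_cre.
Qed.
Lemma cvg_cim {T : Type} (F : set_system T) {FF : Filter F} (u : T -> C) (l : C) :
  u x @[x --> F] --> l -> cim (u x) @[x --> F] --> cim l.
Proof.
move=> /cvgC_ltP h; apply/cvgrPdist_lt => e /h; apply: filterS => x.
by apply: le_lt_trans; rewrite distrC -cimN -cimD norm_cim.
Qed.
Lemma cvg_cpair {T : Type} (F : set_system T) {FF : Filter F} (u v : T -> R) (a b : R) :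
  u x @[x --> F] --> a -> v x @[x --> F] --> b ->
  cpair (u x) (v x) @[x --> F] --> cpair a b.
Proof.
move=> /cvgrPdist_lt hu /cvgrPdist_lt hv; apply/cvgC_ltP => e e0.
have e2 : 0 < e / 2 by rewrite divr_gt0.
apply: filterS2 (hu _ e2) (hv _ e2) => x h1 h2.
rewrite (le_lt_trans (cmod_le_reim _)) // !cE [e]splitr ltrD //; by rewrite distrC.
Qed.
Lemma cvgC_reim {T : Type} (F : set_system T) {FF : Filter F} (u : T -> C) (a b : R) :
  cre (u x) @[x --> F] --> a -> cim (u x) @[x --> F] --> b ->
  u x @[x --> F] --> cpair a b.
Proof.
move=> h1 h2; rewrite (_ : u = fun t => cpair (cre (u t)) (cim (u t))).
  exact: cvg_cpair.
by apply/funext => x; apply: cplxP.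
Qed.
Lemma cvg_cmod {T : Type} (F : set_system T) {FF : Filter F} (u : T -> C) (l : C) :
  u x @[x --> F] --> l -> cmod (u x) @[x --> F] --> cmod l.
Proof.
move=> /cvgC_ltP h; apply/cvgrPdist_lt => e /h; apply: filterS => x hx.
have h1 := cmod_sub_ge (u x) l; have h2 := cmod_sub_ge l (u x).
rewrite cmodBC in h2; rewrite ltr_norml; apply/andP; split; lra.
Qed.
Lemma cvg_cR {T : Type} (F : set_system T) {FF : Filter F} (u : T -> R) (l : R) :
  u x @[x --> F] --> l -> cR (u x) @[x --> F] --> cR l.
Proof. by move=> h; apply: cvg_cpair => //; apply: cvg_cst. Qed.
Lemma continuous_expi : continuous (@expi R).
Proof.
move=> x; apply: cvg_cpair.
  apply: (@continuous_comp _ _ _ (fun x => 2 * pi * x) cos); last exact: continuous_cos.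
  by apply: cvgMr; exact: cvg_id.
apply: (@continuous_comp _ _ _ (fun x => 2 * pi * x) sin); last exact: continuous_sin.
by apply: cvgMr; exact: cvg_id.
Qed.

End complex_numbers.
#[export] Hint Extern 0 (is_true (0 <= cmod _)) => exact: cmod_ge0 : core.

Arguments cmod : simpl never.
Arguments cre : simpl never.
Arguments cim : simpl never.
Arguments cpair : simpl never.
Arguments expi : simpl never.
Arguments cR : simpl never.

(** * Integrals of bounded measurable functions *)

Section real_integral.
Context {R : realType}.
Implicit Types (a b x t : R) (f g : R -> R).
Let mu := @lebesgue_measure R.

(** On a bounded interval this class consists of integrable functions and, unlike integrability, is
    stable under products. *)
Definition bmeas a b f := measurable_fun `[a, b] f /\
  exists M : R, forall t, a <= t <= b -> `|f t| <= M.

Definition rint a b f : R := (\int[mu]_(t in `[a, b]) f t)%R.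

Lemma bmeas_integrable a b f : bmeas a b f -> mu.-integrable `[a, b] (EFin \o f).
Proof.
move=> [mf [M hM]]; apply: measurable_bounded_integrable => //.
  change (lebesgue_measure `[a, b]%classic < +oo)%E; rewrite lebesgue_measure_itv; by rewrite /=; case: ifP => // _; rewrite -EFinD ltry.
exists M; split; first by rewrite num_real.
move=> y My t /=; rewrite in_itv /= => /hM h; exact: le_trans h (ltW My).
Qed.

Lemma bmeas_cst a b x : bmeas a b (fun=> x).
Proof. by split; [exact: measurable_cst | exists `|x|]. Qed.

Lemma bmeasD a b f g : bmeas a b f -> bmeas a b g -> bmeas a b (fun t => f t + g t).
Proof.
move=> [mf [M hM]] [mg [N hN]]; split; first exact: measurable_funD.
by exists (M + N) => t ht; rewrite (le_trans (ler_normD _ _)) // lerD ?hM ?hN.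
Qed.

Lemma bmeasN a b f : bmeas a b f -> bmeas a b (fun t => - f t).
Proof.
move=> [mf [M hM]]; split; first exact: measurableT_comp.
by exists M => t /hM; rewrite normrN.
Qed.

Lemma bmeasB a b f g : bmeas a b f -> bmeas a b g -> bmeas a b (fun t => f t - g t).
Proof. by move=> hf hg; apply: bmeasD => //; exact: bmeasN. Qed.

Lemma bmeasM a b f g : bmeas a b f -> bmeas a b g -> bmeas a b (fun t => f t * g t).
Proof.
move=> [mf [M hM]] [mg [N hN]]; split; first exact: measurable_funM.
exists (M * N) => t ht; rewrite normrM ler_pM // ?hM ?hN //.
Qed.

Lemma bmeas_cont a b f : (forall t, a <= t <= b -> {for t, continuous f}) -> bmeas a b f.
Proof.
move=> cf.
have cwf : {within `[a, b], continuous f}.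
  apply/continuous_in_subspaceT => t; rewrite inE /= in_itv /=; exact: cf.
split; first by apply: subspace_continuous_measurable_fun.
have /compact_bounded[M [_ hM]] : compact (f @` `[a, b]).
  by apply: continuous_compact => //; exact: segment_compact.
exists (M + 1) => t ht; apply: (hM (M + 1)); first by rewrite ltrDl.
by exists t => //=; rewrite in_itv.
Qed.

Lemma eq_rint a b f g : (forall t, a <= t <= b -> f t = g t) -> rint a b f = rint a b g.
Proof. by move=> h; apply: eq_Rintegral => t; rewrite inE /= in_itv /= => /h. Qed.

Lemma rintD a b f g : bmeas a b f -> bmeas a b g ->
  rint a b (fun t => f t + g t) = rint a b f + rint a b g.
Proof. by move=> /bmeas_integrable hf /bmeas_integrable hg; rewrite /rint RintegralD. Qed.

Lemma rintZ a b f x : bmeas a b f -> rint a b (fun t => x * f t) = x * rint a b f.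
Proof. by move=> /bmeas_integrable hf; rewrite /rint RintegralZl. Qed.

Lemma rintN a b f : bmeas a b f -> rint a b (fun t => - f t) = - rint a b f.
Proof.
move=> hf; rewrite -mulN1r -rintZ //; apply: eq_rint => t _; by rewrite mulN1r.
Qed.

Lemma rintB a b f g : bmeas a b f -> bmeas a b g ->
  rint a b (fun t => f t - g t) = rint a b f - rint a b g.
Proof. by move=> hf hg; rewrite rintD ?rintN //; exact: bmeasN. Qed.

Lemma rint_cst a b x : a <= b -> rint a b (fun=> x) = x * (b - a).
Proof.
move=> ab; rewrite /rint Rintegral_cst //= /mu lebesgue_measure_itv /= lte_fin.
move: ab; rewrite le_eqVlt => /predU1P[->|ab]; first by rewrite ltxx subrr.
by rewrite ab.
Qed.

Lemma le_rint a b f g : bmeas a b f -> bmeas a b g ->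
  (forall t, a <= t <= b -> f t <= g t) -> rint a b f <= rint a b g.
Proof.
move=> /bmeas_integrable hf /bmeas_integrable hg h; by apply: le_Rintegral => // t; rewrite /= in_itv /= => /h.
Qed.

Lemma rint_ge0 a b f : (forall t, a <= t <= b -> 0 <= f t) -> 0 <= rint a b f.
Proof. by move=> h; apply: Rintegral_ge0 => t; rewrite /= in_itv /= => /h. Qed.

Lemma rint_split a b c f : a <= b -> b <= c -> bmeas a c f ->
  rint a c f = rint a b f + rint b c f.
Proof.
move=> ab bc /bmeas_integrable hf; apply/eqP; rewrite addrC -subr_eq; apply/eqP.
rewrite /rint (Rintegral_itvB hf) ?bnd_simp //.
rewrite Rintegral_itv_obnd_cbnd //.
have : mu.-integrable `[b, c] (EFin \o f).
  apply: integrableS hf => //; apply: subset_itvr; by rewrite bnd_simp.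
by apply: integrableS => //; apply: subset_itvr; rewrite bnd_simp.
Qed.

Lemma bmeasS a b c d f : a <= c -> d <= b -> bmeas a b f -> bmeas c d f.
Proof.
move=> ac db [mf [M hM]]; split.
  apply: measurable_funS mf => //; apply: subset_itv; by rewrite bnd_simp.
by exists M => t /andP[h1 h2]; apply: hM; rewrite (le_trans ac) // (le_trans h2).
Qed.

Lemma EFin_rint a b f : bmeas a b f ->
  (rint a b f)%:E = (\int[mu]_(t in `[a, b]) (f t)%:E)%E.
Proof.
by move=> /bmeas_integrable h; rewrite /rint /Rintegral fineK // integrable_fin_num.
Qed.

Lemma bmeas_lim a b (u : nat -> R -> R) f (M : R) :
  (forall n, measurable_fun `[a, b] (u n)) ->
  (forall n t, a <= t <= b -> `|u n t| <= M) ->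
  (forall t, a <= t <= b -> u n t @[n --> \oo] --> f t) -> bmeas a b f.
Proof.
move=> mu_ hM hl; split.
  apply: (measurable_fun_cvg mu_).
  by move=> t; rewrite /= in_itv /= => /hl.
exists M => t ht; have := hl _ ht => /cvg_norm h.
apply: (cvgr_to_le h); apply: nearW => n; exact: hM.
Qed.

Lemma rint_cvg a b (u : nat -> R -> R) f (M : R) :
  (forall n, measurable_fun `[a, b] (u n)) ->
  (forall n t, a <= t <= b -> `|u n t| <= M) ->
  (forall t, a <= t <= b -> u n t @[n --> \oo] --> f t) ->
  rint a b (u n) @[n --> \oo] --> rint a b f.
Proof.
move=> mu_ hM hl; have bf := bmeas_lim mu_ hM hl.
apply: (@fine_cvg _ _ _ _ (fun n => (rint a b (u n))%:E)).
rewrite (_ : (fun n => _) = (fun n => \int[mu]_(t in `[a, b]) (u n t)%:E)%E).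
  rewrite (EFin_rint bf).
  apply: (@dominated_cvg _ _ _ mu `[a, b] _ _ _ (fun=> M%:E)).
  - by []. 
  - by move=> n; apply/measurable_EFinP; exact: mu_.
  - move=> t; rewrite /= in_itv /= => ht; apply: cvg_EFin; last exact: hl.
    exact: nearW.
  - by [].
  - by apply: (@bmeas_integrable a b (fun=> M)); exact: bmeas_cst.
  - by move=> n t; rewrite /= in_itv /= => ht; rewrite lee_fin hM.
by apply/funext => n /=; rewrite EFin_rint //; split => //; exists M; exact: hM.
Qed.

End real_integral.

Section complex_integral.
Context {R : realType}.
Local Notation C := (Cplx R).
Implicit Types (a b x t : R) (f g : R -> C).

Definition cbmeas a b f := bmeas a b (fun t => cre (f t)) /\ bmeas a b (fun t => cim (f t)).

Definition cint a b f : C := cpair (rint a b (fun t => cre (f t))) (rint a b (fun t => cim (f t))).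

Lemma cre_cint a b f : cre (cint a b f) = rint a b (fun t => cre (f t)).
Proof. by []. Qed.

Lemma cbmeas_cst a b (c : C) : cbmeas a b (fun=> c).
Proof. by split; apply: bmeas_cst. Qed.

Lemma cbmeasD a b f g : cbmeas a b f -> cbmeas a b g -> cbmeas a b (fun t => f t + g t).
Proof.
move=> [h1 h2] [h3 h4]; split; under eq_fun do rewrite cE; exact: bmeasD.
Qed.

Lemma cbmeasN a b f : cbmeas a b f -> cbmeas a b (fun t => - f t).
Proof. by move=> [h1 h2]; split; under eq_fun do rewrite cE; exact: bmeasN. Qed.

Lemma cbmeasB a b f g : cbmeas a b f -> cbmeas a b g -> cbmeas a b (fun t => f t - g t).
Proof. by move=> hf hg; apply: cbmeasD => //; exact: cbmeasN. Qed.

Lemma cbmeasM a b f g : cbmeas a b f -> cbmeas a b g -> cbmeas a b (fun t => f t * g t).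
Proof.
move=> [h1 h2] [h3 h4]; split; under eq_fun do rewrite cE.
  by apply: bmeasB; exact: bmeasM.
by apply: bmeasD; exact: bmeasM.
Qed.

Lemma cbmeas_conj a b f : cbmeas a b f -> cbmeas a b (fun t => cconj (f t)).
Proof. by move=> [h1 h2]; split => //; under eq_fun do rewrite cE; exact: bmeasN. Qed.

Lemma cbmeas_cR a b (f : R -> R) : bmeas a b f -> cbmeas a b (fun t => cR (f t)).
Proof. by move=> h; split => //; exact: bmeas_cst. Qed.

Lemma cbmeas_sum a b (I : Type) (s : seq I) (F : I -> R -> C) :
  (forall i, cbmeas a b (F i)) -> cbmeas a b (fun t => \sum_(i <- s) F i t).
Proof.
move=> h; elim: s => [|i s IH].
  under eq_fun do rewrite big_nil; exact: cbmeas_cst.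
by under eq_fun do rewrite big_cons; apply: cbmeasD.
Qed.

Lemma cbmeas_cont a b f : (forall t, a <= t <= b -> {for t, continuous f}) -> cbmeas a b f.
Proof.
move=> h; split; apply: bmeas_cont => t /h; [exact: cvg_cre | exact: cvg_cim].
Qed.

Lemma bmeas_sqrcmod a b f : cbmeas a b f -> bmeas a b (fun t => cmod (f t) ^+ 2).
Proof.
move=> [h1 h2]; under eq_fun do rewrite sqr_cmod !expr2.
by apply: bmeasD; exact: bmeasM.
Qed.

Lemma bmeas_cmod a b f : cbmeas a b f -> bmeas a b (fun t => cmod (f t)).
Proof.
move=> h; have [h1 [M hM]] := bmeas_sqrcmod h; split.
  rewrite (_ : (fun t => _) = Num.sqrt \o (fun t => cmod (f t) ^+ 2)).
    by apply: measurableT_comp => //; apply: continuous_measurable_fun; exact: sqrt_continuous.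
  by apply/funext => t /=; rewrite sqrtr_sqr ger0_norm.
exists (M + 1) => t /hM; rewrite !ger0_norm ?exprn_ge0 // => h2.
have := sqr_ge0 (cmod (f t) - 1); nra.
Qed.

Lemma eq_cint a b f g : (forall t, a <= t <= b -> f t = g t) -> cint a b f = cint a b g.
Proof. by move=> h; congr cpair; apply: eq_rint => t /h ->. Qed.

Lemma cintD a b f g : cbmeas a b f -> cbmeas a b g ->
  cint a b (fun t => f t + g t) = cint a b f + cint a b g.
Proof.
move=> [h1 h2] [h3 h4]; apply: cplxP; rewrite !cE -rintD //; apply: eq_rint => t _; by rewrite cE.
Qed.

Lemma cintM a b f (c : C) : cbmeas a b f -> cint a b (fun t => c * f t) = c * cint a b f.
Proof.
move=> [h1 h2]; apply: cplxP; rewrite !cE -!rintZ //.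
  rewrite -rintB; try by apply: bmeasM => //; exact: bmeas_cst.
  by apply: eq_rint => t _; rewrite cE.
rewrite -rintD; try by apply: bmeasM => //; exact: bmeas_cst.
by apply: eq_rint => t _; rewrite cE.
Qed.

Lemma cintN a b f : cbmeas a b f -> cint a b (fun t => - f t) = - cint a b f.
Proof.
move=> hf; rewrite -mulN1r -cintM //; apply: eq_cint => t _; by rewrite mulN1r.
Qed.

Lemma cintB a b f g : cbmeas a b f -> cbmeas a b g ->
  cint a b (fun t => f t - g t) = cint a b f - cint a b g.
Proof. by move=> hf hg; rewrite cintD ?cintN //; exact: cbmeasN. Qed.

Lemma cint_cst a b (c : C) : a <= b -> cint a b (fun=> c) = c * cR (b - a).
Proof. by move=> ab; apply: cplxP; rewrite !cE !rint_cst //; ring. Qed.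

Lemma cint0 a b : cint a b (fun=> 0) = 0 :> C.
Proof.
rewrite -[RHS](mul0r (cint a b (fun=> 0))) -cintM; last exact: cbmeas_cst.
by under [in RHS]eq_fun do rewrite mul0r.
Qed.

Lemma cint_sum a b (I : Type) (s : seq I) (F : I -> R -> C) :
  (forall i, cbmeas a b (F i)) ->
  cint a b (fun t => \sum_(i <- s) F i t) = \sum_(i <- s) cint a b (F i).
Proof.
move=> h; elim: s => [|i s IH].
  by under eq_fun do rewrite big_nil; rewrite big_nil cint0.
under eq_fun do rewrite big_cons; rewrite cintD //; last exact: cbmeas_sum.
by rewrite big_cons IH.
Qed.

Lemma cint_cR a b (f : R -> R) : cint a b (fun t => cR (f t)) = cR (rint a b f).
Proof.
by have := @cint0 a b => /(congr1 cim); rewrite !cE => h; apply: cplxP; rewrite !cE.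
Qed.

Lemma cint_split a b c f : a <= b -> b <= c -> cbmeas a c f ->
  cint a c f = cint a b f + cint b c f.
Proof.
by move=> ab bc [h1 h2]; apply: cplxP; rewrite !cE -rint_split.
Qed.

(* The integrand is rotated by the conjugate of its own integral. *)
Lemma cmod_cint_le a b f : cbmeas a b f ->
  cmod (cint a b f) <= rint a b (fun t => cmod (f t)).
Proof.
move=> hf; have [/eqP -> |i0] := boolP (cint a b f == 0).
  by rewrite cmod0; apply: rint_ge0.
have ip : 0 < cmod (cint a b f) by rewrite cmod_gt0.
rewrite -(ler_pM2l ip) -expr2 -[leLHS]cre_cR -mul_conj mulrC -cintM //.
rewrite /cint cre_pair -rintZ; last exact: bmeas_cmod.
apply: le_rint.
- by have [] := cbmeasM (cbmeas_cst a b (cconj (cint a b f))) hf.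
- by apply: bmeasM; [exact: bmeas_cst | exact: bmeas_cmod].
move=> t _; rewrite (le_trans (ler_norm _)) // (le_trans (norm_cre _)) //.
by rewrite cmodM cmod_conj.
Qed.

Lemma cmod_cint_bound a b f (M : R) : a <= b -> cbmeas a b f ->
  (forall t, a <= t <= b -> cmod (f t) <= M) -> cmod (cint a b f) <= M * (b - a).
Proof.
move=> ab hf hM; rewrite (le_trans (cmod_cint_le hf)) // -rint_cst //.
by apply: le_rint => //; [exact: bmeas_cmod | exact: bmeas_cst].
Qed.

Lemma cint_cvg a b (u : nat -> R -> C) f (M : R) :
  (forall n, cbmeas a b (u n)) ->
  (forall n t, a <= t <= b -> cmod (u n t) <= M) ->
  (forall t, a <= t <= b -> u n t @[n --> \oo] --> f t) ->
  cint a b (u n) @[n --> \oo] --> cint a b f.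
Proof.
move=> hu hM hl; apply: cvg_cpair; apply: (rint_cvg (M := M)).
- by move=> n; have [[]] := hu n.
- by move=> n t ht; rewrite (le_trans (norm_cre _)) // hM.
- by move=> t ht; apply: cvg_cre; exact: hl.
- by move=> n; have [_ []] := hu n.
- by move=> n t ht; rewrite (le_trans (norm_cim _)) // hM.
- by move=> t ht; apply: cvg_cim; exact: hl.
Qed.

End complex_integral.

(** * Complex differentiability and the Cauchy-Goursat theorem *)

Section differentiability.
Context {R : realType}.
Local Notation C := (Cplx R).
Implicit Types (f g : C -> C) (z w A : C).

Lemma near_cmod z (P : C -> Prop) : (\forall w \near z, P w) <->
  exists2 d : R, 0 < d & forall w, cmod (w - z) < d -> P w.
Proof.
split=> [/nbhs_ballP[e /= e0 h]|[d d0 h]].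
  have [d d0 de] := gt0_cR e0; exists d => // w wz; apply: h.
  by rewrite de -ball_normE /= normC_cmod ltcR cmodBC.
apply/nbhs_ballP; exists (cR d) => [|w]; first by rewrite /= (@ltcR _ 0).
by rewrite -ball_normE /= normC_cmod ltcR cmodBC => /h.
Qed.

(** Differentiability with an explicit derivative and real tolerances, the form in which the chain
    rule and Goursat's argument consume it. *)
Definition cder f z A := forall e : R, 0 < e -> exists2 d : R, 0 < d &
  forall w, cmod (w - z) < d -> cmod (f w - f z - A * (w - z)) <= e * cmod (w - z).

Lemma derivable_cder f z : derivable f z 1 -> exists A, cder f z A.
Proof.
move=> /derivable_nbhsP/eqaddoP h; exists ('D_1 f z) => e e0.
have /h/near_cmod[d d0 hd] : 0 < cR e by rewrite (@ltcR _ 0).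
exists d => // w wz; have := hd (w - z); rewrite subr0 => /(_ wz).
rewrite /= !fctE /= !normC_cmod -cRM lecR; congr (cmod _ <= _).
rewrite -![_ *: _]/(_ * _) mulr1 subrK opprD addrA; congr (_ - _).
by rewrite mulrC.
Qed.

Lemma cder_derivable f z A : cder f z A -> derivable f z 1.
Proof.
move=> h; apply/cvg_ex; exists A; apply/cvgC_ltP => e e0.
have e2 : 0 < e / 2 by rewrite divr_gt0.
have [d d0 hd] := h _ e2; rewrite near_withinE; apply/near_cmod; exists d => // w.
rewrite subr0 => wd w0.
have := hd (z + w); rewrite addrAC subrr add0r => /(_ wd) hw.
have wp : 0 < cmod w by rewrite cmod_gt0.
rewrite -(ltr_pM2l wp) -cmodM -![_ *: _]/(_ * _) mulr1 mulrBr mulrA divff // mul1r.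
rewrite /= (addrC w z) (mulrC w A) (le_lt_trans hw) // mulrC ltr_pM2l //; lra.
Qed.

Lemma cder_cvg f z A : cder f z A -> f w @[w --> z] --> f z.
Proof.
move=> h; have : derivable f z 1 by exact: cder_derivable h.
by move=> /derivable1_diffP/differentiable_continuous.
Qed.

Lemma cder_comp f g z A B : cder f z A -> cder g (f z) B -> cder (g \o f) z (B * A).
Proof.
move=> hf hg e e0.
have A1 : 0 < cmod A + 1 by rewrite ltr_wpDl.
have B1 : 0 < cmod B + 1 by rewrite ltr_wpDl.
(* Half of [e] goes to the error of [g], on an increment of size at most [(cmod A + 1) x], and half
   to [cmod B] times the error of [f]. The [+ 1] keeps the denominators positive, and the minimum
   with 1 gives the bound on the increment. *)
have e1 : 0 < e / (2 * (cmod A + 1)) by rewrite divr_gt0 // mulr_gt0.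
have e2 : 0 < Num.min 1 (e / (2 * (cmod B + 1))).
  by rewrite lt_min ltr01 divr_gt0 // mulr_gt0.
have half (x : R) : 0 < x -> e / (2 * x) * x = e / 2 by move=> x0; field; rewrite gt_eqF.
have [d1 d10 hd1] := hg _ e1; have [d2 d20 hd2] := hf _ e2.
exists (Num.min d2 (d1 / (cmod A + 1))) => [|w].
  by rewrite lt_min d20 divr_gt0.
rewrite lt_min ltr_pdivlMr // => /andP[wd2 wd1].
have := hd2 w wd2; set x := cmod (w - z) in wd2 wd1 *; move=> h2.
have x0 : 0 <= x by exact: cmod_ge0.
have m1 : Num.min 1 (e / (2 * (cmod B + 1))) * x <= x.
  by rewrite ler_piMl // ge_min lexx.
have m2 : Num.min 1 (e / (2 * (cmod B + 1))) * x <= e / (2 * (cmod B + 1)) * x.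
  by rewrite ler_wpM2r // ge_min lexx orbT.
have fx : cmod (f w - f z) <= (cmod A + 1) * x.
  rewrite -(subrK (A * (w - z)) (f w - f z)) (le_trans (cmodD _ _)) //.
  rewrite cmodM -/x mulrDl mul1r addrC lerD2l (le_trans h2) //.
have h1 : cmod (f w - f z) < d1 by rewrite (le_lt_trans fx) // mulrC.
have := hd1 _ h1 => h3.
rewrite /= (_ : _ - _ = (g (f w) - g (f z) - B * (f w - f z)) + B * (f w - f z - A * (w - z))).
  rewrite (le_trans (cmodD _ _)) // cmodM.
  have k1 : e / (2 * (cmod A + 1)) * cmod (f w - f z) <= e / 2 * x.
    rewrite (le_trans (ler_wpM2l (ltW e1) fx)) // mulrA.
    by rewrite half.
  have k2 : cmod B * cmod (f w - f z - A * (w - z)) <= e / 2 * x.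
    apply: (@le_trans _ _ ((cmod B + 1) * (e / (2 * (cmod B + 1)) * x))).
      by apply: ler_pM => //; [rewrite lerDl | rewrite (le_trans h2)].
    by rewrite mulrA [_ * (e / _)]mulrC half.
  by rewrite (le_trans (lerD (le_trans h3 k1) k2)) // -mulrDl -splitr.
by ring.
Qed.

Lemma derivable_comp f g z : derivable f z 1 -> derivable g (f z) 1 ->
  derivable (g \o f) z 1.
Proof.
move=> /derivable_cder[A hA] /derivable_cder[B hB].
exact: cder_derivable (cder_comp hA hB).
Qed.

Lemma real_der_bound (f : R -> R) (x d : R) : is_derive x 1 f d ->
  forall e, 0 < e -> \forall h \near 0, `|f (h + x) - f x - d * h| <= e * `|h|.
Proof.
move=> fd e e0; have hd : derivable f x 1 by case: fd.
have hv : 'D_1 f x = d by case: fd.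
move/derivable_nbhsP: hd => /eqaddoP /(_ _ e0); rewrite hv.
apply: filterS => h; rewrite /= !fctE /= -![_ *: _]/(_ * _) mulr1 opprD addrA.
by rewrite (mulrC h).
Qed.

Definition cexp (z : C) : C := cR (expR (cre z)) * cpair (cos (cim z)) (sin (cim z)).

Lemma cexpD z w : cexp (z + w) = cexp z * cexp w.
Proof.
by apply: cplxP; rewrite /cexp !cE expRD cosD sinD; ring.
Qed.
Lemma cexp0 : cexp 0 = 1.
Proof. by apply: cplxP; rewrite /cexp !cE expR0 cos0 sin0; ring. Qed.
Lemma cmod_cexp z : cmod (cexp z) = expR (cre z).
Proof.
rewrite /cexp cmodM cmod_cR ger0_norm ?expR_ge0 //.
by rewrite cmodE !cE cos2Dsin2 sqrtr1 mulr1.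
Qed.
Lemma cexp_polar (s t : R) : cexp (cR (2 * pi) * cpair s t) = cR (expR (2 * pi * s)) * expi t.
Proof. by apply: cplxP; rewrite /cexp !cE !mul0r ?addr0 ?subr0. Qed.

Lemma cder_cexp0 : cder cexp 0 1.
Proof.
(* The real and the imaginary part each cost at most [3 k cmod w], whence [e / 6]; [k <= 1] serves
   to bound the real exponential by 2. *)
move=> e e0; pose k := Num.min (e / 6) 1.
have k0 : 0 < k by rewrite lt_min ltr01 andbT divr_gt0.
have h1 : \forall h \near (0 : R), `|expR h - 1 - h| <= k * `|h|.
  have := real_der_bound (is_derive_expR (0 : R)) k0; rewrite expR0.
  by apply: filterS => h; rewrite addr0 mul1r.
have h2 : \forall h \near (0 : R), `|cos h - 1| <= k * `|h|.
  have := real_der_bound (is_derive_cos (0 : R)) k0; rewrite sin0 cos0.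
  by apply: filterS => h; rewrite addr0 oppr0 mul0r subr0.
have h3 : \forall h \near (0 : R), `|sin h - h| <= k * `|h|.
  have := real_der_bound (is_derive_sin (0 : R)) k0; rewrite sin0 cos0.
  by apply: filterS => h; rewrite addr0 subr0 mul1r.
have h4 : \forall h \near (0 : R), `|expR h - 1| < k.
  have /cvgrPdist_lt/(_ _ k0) := @continuous_expR R 0; rewrite expR0.
  by apply: filterS => h; rewrite distrC.
have [d /= d0 hd] : exists2 d : R, 0 < d & forall h : R, `|h| < d ->
    [/\ `|expR h - 1 - h| <= k * `|h|, `|cos h - 1| <= k * `|h|,
      `|sin h - h| <= k * `|h| & `|expR h - 1| < k].
  have /nbhs_ballP[d /= d0 hd] : \forall h \near (0 : R),
    [/\ `|expR h - 1 - h| <= k * `|h|, `|cos h - 1| <= k * `|h|,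
      `|sin h - h| <= k * `|h| & `|expR h - 1| < k].
    by near=> h; split; near: h.
  by exists d => // h hh; apply: hd; rewrite /ball /= sub0r normrN.
exists d => // w; rewrite !subr0 cexp0 mul1r => wd.
have [a1 _ _ a4] := hd (cre w) (le_lt_trans (norm_cre _) wd).
have [_ b2 b3 _] := hd (cim w) (le_lt_trans (norm_cim _) wd).
have rw := norm_cre w; have iw := norm_cim w.
have ke : k <= e / 6 by rewrite ge_min lexx.
have k1 : k <= 1 by rewrite ge_min lexx orbT.
have ex2 : `|expR (cre w)| <= 2.
  rewrite -(subrK 1 (expR _)) (le_trans (ler_normD _ _)) // normr1.
  by rewrite -[2]/(1 + 1) lerD2r (le_trans (ltW a4)).
have kw : k * `|cim w| <= k * cmod w by rewrite ler_pM2l.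
have kw' : k * `|cre w| <= k * cmod w by rewrite ler_pM2l.
have kmw : k * cmod w <= e / 6 * cmod w by rewrite ler_wpM2r.
rewrite (le_trans (cmod_le_reim _)) // /cexp !cE !mul0r ?subr0 ?addr0 ?add0r.
have r1 : `|expR (cre w) * cos (cim w) - 1 - cre w| <= 3 * (k * cmod w).
  rewrite (_ : _ - cre w = (expR (cre w) - 1 - cre w) + expR (cre w) * (cos (cim w) - 1)).
    rewrite (le_trans (ler_normD _ _)) // normrM.
    have : `|expR (cre w)| * `|cos (cim w) - 1| <= 2 * (k * cmod w).
      by rewrite ler_pM // (le_trans b2).
    have := le_trans a1 kw'; lra.
  by ring.
have r2 : `|expR (cre w) * sin (cim w) - cim w| <= 3 * (k * cmod w).
  rewrite (_ : _ - cim w = expR (cre w) * (sin (cim w) - cim w) + (expR (cre w) - 1) * cim w).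
    rewrite (le_trans (ler_normD _ _)) // !normrM.
    have : `|expR (cre w)| * `|sin (cim w) - cim w| <= 2 * (k * cmod w).
      by rewrite ler_pM // (le_trans b3).
    have : `|expR (cre w) - 1| * `|cim w| <= k * cmod w by rewrite ler_pM // ltW.
    lra.
  by ring.
move: r1 r2 kmw; lra.
Unshelve. all: by end_near.
Qed.

Lemma cder_cexp z : cder cexp z (cexp z).
Proof.
move=> e e0; have ez : 0 < e / cmod (cexp z).
  by rewrite divr_gt0 // cmod_cexp expR_gt0.
have [d d0 hd] := cder_cexp0 ez; exists d => // w wz.
have := hd (w - z); rewrite !subr0 cexp0 mul1r => /(_ wz) h.
have -> : cexp w = cexp z * cexp (w - z) by rewrite -cexpD addrC subrK.
rewrite -[X in _ - X - _]mulr1 -!mulrBr cmodM mulrC -ler_pdivlMr; last first.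
  by rewrite cmod_cexp expR_gt0.
by rewrite mulrAC.
Qed.

End differentiability.

(** * Goursat's theorem on rectangles *)

Section goursat.
Context {R : realType}.
Local Notation C := (Cplx R).
Variable H : R -> R -> C.

(* The Cauchy-Riemann equations at (s, t), in the coordinate s + i t. *)
Definition cr_der (s t : R) (A : C) := forall e : R, 0 < e -> exists2 d : R, 0 < d &
  forall u v, `|u - s| < d -> `|v - t| < d ->
  cmod (H u v - H s t - A * cpair (u - s) (v - t)) <= e * (`|u - s| + `|v - t|).

Lemma cr_der_cvg s t A : cr_der s t A -> forall e : R, 0 < e ->
  exists2 d : R, 0 < d & forall u v, `|u - s| < d -> `|v - t| < d -> cmod (H u v - H s t) < e.
Proof.
move=> h e e0; have [d d0 hd] := h 1 ltr01.
have A1 : 0 < cmod A + 1 by rewrite ltr_wpDl.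
pose d' := Num.min d (e / (2 * (cmod A + 1))).
exists d' => [|u v]; first by rewrite lt_min d0 divr_gt0 // mulr_gt0.
rewrite !lt_min => /andP[ud ue] /andP[vd ve].
have := hd u v ud vd; rewrite mul1r => h1.
move: ue ve; rewrite !ltr_pdivlMr ?mulr_gt0 // => ue ve.
rewrite -(subrK (A * cpair (u - s) (v - t)) (H u v - H s t)).
rewrite (le_lt_trans (cmodD _ _)) // cmodM.
have h2 := cmod_le_reim (cpair (u - s) (v - t)); rewrite !cE in h2.
have h3 : cmod A * cmod (cpair (u - s) (v - t)) <= cmod A * (`|u - s| + `|v - t|).
  by rewrite ler_wpM2l.
nra.
Qed.

(** The counterclockwise boundary integral of [H] over the rectangle, with opposite sides paired. *)
Definition rectint (a b c d : R) : C :=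
  cpair 0 1 * cint c d (fun t => H b t - H a t) - cint a b (fun s => H s d - H s c).

Lemma cr_cont1 s t A : cr_der s t A -> {for s, continuous (H^~ t)}.
Proof.
move=> h; apply/cvgC_ltP => e /(cr_der_cvg h)[d d0 hd].
apply/nbhs_ballP; exists d => //= u; rewrite /ball /= distrC => ud.
by apply: hd; rewrite // subrr normr0.
Qed.

Lemma cr_cont2 s t A : cr_der s t A -> {for t, continuous (H s)}.
Proof.
move=> h; apply/cvgC_ltP => e /(cr_der_cvg h)[d d0 hd].
apply/nbhs_ballP; exists d => //= u; rewrite /ball /= distrC => ud.
by apply: hd; rewrite // subrr normr0.
Qed.

Variables (a b c d : R).
Hypothesis hH : forall s t, a <= s <= b -> c <= t <= d -> exists A, cr_der s t A.

Let cm1 a' b' t : a <= a' -> b' <= b -> c <= t <= d -> cbmeas a' b' (H^~ t).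
Proof.
move=> aa bb td; apply: cbmeas_cont => s /andP[h1 h2].
have /hH/(_ td)[A] : a <= s <= b by rewrite (le_trans aa) // (le_trans h2).
exact: cr_cont1.
Qed.

Let cm2 c' d' s : c <= c' -> d' <= d -> a <= s <= b -> cbmeas c' d' (H s).
Proof.
move=> cc dd sb; apply: cbmeas_cont => t /andP[h1 h2].
have [|A] := hH (s := s) (t := t) sb; first by rewrite (le_trans cc) // (le_trans h2).
exact: cr_cont2.
Qed.

Let split1 a1 a2 a3 c1 c2 : a <= a1 -> a1 <= a2 -> a2 <= a3 -> a3 <= b ->
  c <= c1 -> c1 <= c2 -> c2 <= d ->
  rectint a1 a3 c1 c2 = rectint a1 a2 c1 c2 + rectint a2 a3 c1 c2.
Proof.
move=> h1 h2 h3 h4 h5 h6 h7; rewrite /rectint.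
have i1 : a <= a1 <= b by apply/andP; split; lra.
have i2 : a <= a2 <= b by apply/andP; split; lra.
have i3 : a <= a3 <= b by apply/andP; split; lra.
have j1 : c <= c1 <= d by apply/andP; split; lra.
have j2 : c <= c2 <= d by apply/andP; split; lra.
rewrite (@cint_split _ a1 a2 a3) //; last by apply: cbmeasB; apply: cm1.
by rewrite !cintB; try (by apply: cm2 => //; lra); try (by apply: cm1 => //; lra); ring.
Qed.

Let split2 a1 a2 c1 c2 c3 : a <= a1 -> a1 <= a2 -> a2 <= b ->
  c <= c1 -> c1 <= c2 -> c2 <= c3 -> c3 <= d ->
  rectint a1 a2 c1 c3 = rectint a1 a2 c1 c2 + rectint a1 a2 c2 c3.
Proof.
move=> h1 h2 h3 h4 h5 h6 h7; rewrite /rectint.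
have i1 : a <= a1 <= b by apply/andP; split; lra.
have i2 : a <= a2 <= b by apply/andP; split; lra.
have j1 : c <= c1 <= d by apply/andP; split; lra.
have j2 : c <= c2 <= d by apply/andP; split; lra.
have j3 : c <= c3 <= d by apply/andP; split; lra.
rewrite (@cint_split _ c1 c2 c3) //; last by apply: cbmeasB; apply: cm2.
by rewrite !cintB; try (by apply: cm2 => //; lra); try (by apply: cm1 => //; lra); ring.
Qed.

(** The affine part of [H] at [(s, t)] has zero boundary integral, its two contributions [i A x y]
    cancelling. Only the remainder is left, of size [e (x + y)] at every boundary point. *)
Let local_bound s t A : cr_der s t A -> forall e : R, 0 < e ->
  exists2 de : R, 0 < de & forall u v x y, a <= u -> u + x <= b -> c <= v -> v + y <= d ->
    u <= s <= u + x -> v <= t <= v + y -> x < de -> y < de ->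
    cmod (rectint u (u + x) v (v + y)) <= 2 * e * (x + y) ^+ 2.
Proof.
move=> hA e e0; have [de de0 hde] := hA e e0; exists de => // u v x y.
move=> au xb cv yd /andP[us sx] /andP[vt ty] xde yde.
have x0 : 0 <= x by lra.
have y0 : 0 <= y by lra.
have err u' v' : u <= u' <= u + x -> v <= v' <= v + y ->
    cmod (H u' v' - H s t - A * cpair (u' - s) (v' - t)) <= e * (x + y).
  move=> /andP[p1 p2] /andP[q1 q2].
  have k1 : `|u' - s| <= x by rewrite ler_norml; apply/andP; split; lra.
  have k2 : `|v' - t| <= y by rewrite ler_norml; apply/andP; split; lra.
  rewrite (le_trans (hde _ _ _ _)) ?(le_lt_trans k1) ?(le_lt_trans k2) //.
  by rewrite ler_pM2l // lerD.
have i1 : a <= u <= b by apply/andP; split; lra.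
have i2 : a <= u + x <= b by apply/andP; split; lra.
have j1 : c <= v <= d by apply/andP; split; lra.
have j2 : c <= v + y <= d by apply/andP; split; lra.
have B1 : cbmeas v (v + y) (fun t => H (u + x) t - H u t) by apply: cbmeasB; exact: cm2.
have B2 : cbmeas u (u + x) (fun s => H s (v + y) - H s v) by apply: cbmeasB; exact: cm1.
have -> : rectint u (u + x) v (v + y) =
  cpair 0 1 * cint v (v + y) (fun t => H (u + x) t - H u t - A * cR x)
  - cint u (u + x) (fun s => H s (v + y) - H s v - A * cpair 0 y).
  rewrite /rectint (cintB B1) ?(cintB B2); try exact: cbmeas_cst.
  rewrite !cint_cst ?lerDl // [v + y - v]addrAC subrr add0r [u + x - u]addrAC subrr add0r.
  have -> : cpair 0 y = cpair 0 1 * cR y by apply: cplxP; rewrite !cE; ring.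
  by ring.
have b1 : cmod (cint v (v + y) (fun t => H (u + x) t - H u t - A * cR x)) <= 2 * e * (x + y) * y.
  have Ey : v + y - v = y by ring.
  rewrite -[X in _ <= _ * X]Ey.
  apply: cmod_cint_bound => [||t' ht]; first by rewrite lerDl.
    by apply: cbmeasB => //; exact: cbmeas_cst.
  rewrite (_ : _ - _ = (H (u + x) t' - H s t - A * cpair (u + x - s) (t' - t))
    - (H u t' - H s t - A * cpair (u - s) (t' - t))).
    rewrite (le_trans (cmodB _ _)) // -mulrA mulr_natl mulr2n lerD //; apply: err => //.
      by apply/andP; split; lra.
    by apply/andP; split; lra.
  rewrite (_ : cpair (u + x - s) (t' - t) = cpair (u - s) (t' - t) + cR x); first by ring.
  by apply: cplxP; rewrite !cE; ring.
have b2 : cmod (cint u (u + x) (fun s => H s (v + y) - H s v - A * cpair 0 y)) <= 2 * e * (x + y) * x.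
  have Ex : u + x - u = x by ring.
  rewrite -[X in _ <= _ * X]Ex.
  apply: cmod_cint_bound => [||s' hs]; first by rewrite lerDl.
    by apply: cbmeasB => //; exact: cbmeas_cst.
  rewrite (_ : _ - _ = (H s' (v + y) - H s t - A * cpair (s' - s) (v + y - t))
    - (H s' v - H s t - A * cpair (s' - s) (v - t))).
    rewrite (le_trans (cmodB _ _)) // -mulrA mulr_natl mulr2n lerD //; apply: err => //.
      by apply/andP; split; lra.
    by apply/andP; split; lra.
  rewrite (_ : cpair (s' - s) (v + y - t) = cpair (s' - s) (v - t) + cpair 0 y); first by ring.
  by apply: cplxP; rewrite !cE; ring.
rewrite (le_trans (cmodB _ _)) // cmodM.
have -> : cmod (cpair 0 1 : C) = 1 by rewrite cmodE !cE expr0n add0r expr1n sqrtr1.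
by rewrite mul1r (le_trans (lerD b1 b2)) // -mulrDr addrC expr2 mulrA.
Qed.

(** Bisection: some quarter carries at least a quarter of the integral. The nested quarters shrink
    to a point, where [local_bound] makes the integral too small compared with the area. *)
Lemma goursat_rect : a <= b -> c <= d -> rectint a b c d = 0.
Proof.
move=> ab cd; apply/eqP; rewrite -cmod_eq0; apply/eqP/le_anti.
rewrite cmod_ge0 andbT leNgt; apply/negP => I0.
pose X n : R := (b - a) / 2 ^+ n; pose Y n : R := (d - c) / 2 ^+ n.
have X0 n : 0 <= X n by rewrite divr_ge0 ?subr_ge0 // exprn_ge0.
have Y0 n : 0 <= Y n by rewrite divr_ge0 ?subr_ge0 // exprn_ge0.
have XS n : X n = X n.+1 + X n.+1.
  by rewrite /X exprS; field; rewrite expf_neq0.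
have YS n : Y n = Y n.+1 + Y n.+1.
  by rewrite /Y exprS; field; rewrite expf_neq0.
pose J n (p : R * R) := cmod (rectint p.1 (p.1 + X n) p.2 (p.2 + Y n)).
pose ok n (p : R * R) := [/\ a <= p.1, p.1 + X n <= b, c <= p.2 & p.2 + Y n <= d].
pose sub n (p q : R * R) := [/\ p.1 <= q.1, q.1 + X n.+1 <= p.1 + X n,
   p.2 <= q.2 & q.2 + Y n.+1 <= p.2 + Y n].
(* [choice] needs a total step, so the claim is conditional on [ok] and a dummy corner is given to
   rectangles leaving the domain. *)
have step (np : nat * (R * R)) : exists q, ok np.1 np.2 ->
    sub np.1 np.2 q /\ J np.1 np.2 <= 4 * J np.1.+1 q.
  case: np => n [u v] /=.
  have [hok|] := pselect (ok n (u, v)); last by exists (0, 0).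
  case: (hok) => /= h1 h2 h3 h4; rewrite (XS n) in h2; rewrite (YS n) in h4.
  have [xp yp] := (X0 n.+1, Y0 n.+1).
  have E : rectint u (u + X n) v (v + Y n) =
    rectint u (u + X n.+1) v (v + Y n.+1) +
    rectint u (u + X n.+1) (v + Y n.+1) (v + Y n.+1 + Y n.+1) +
    (rectint (u + X n.+1) (u + X n.+1 + X n.+1) v (v + Y n.+1) +
    rectint (u + X n.+1) (u + X n.+1 + X n.+1) (v + Y n.+1) (v + Y n.+1 + Y n.+1)).
    rewrite (XS n) (YS n) !addrA.
    rewrite (@split1 u (u + X n.+1) (u + X n.+1 + X n.+1)); [|lra..].
    rewrite (@split2 u (u + X n.+1) v (v + Y n.+1) (v + Y n.+1 + Y n.+1)); [|lra..].
    rewrite (@split2 (u + X n.+1) (u + X n.+1 + X n.+1) v (v + Y n.+1) (v + Y n.+1 + Y n.+1)); [|lra..].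
    by rewrite !addrA.
  have : J n (u, v) <= J n.+1 (u, v) + J n.+1 (u, v + Y n.+1) +
      (J n.+1 (u + X n.+1, v) + J n.+1 (u + X n.+1, v + Y n.+1)).
    rewrite -[J n (u, v)]/(cmod (rectint u (u + X n) v (v + Y n))) E.
    by rewrite (le_trans (cmodD _ _)) // lerD // (le_trans (cmodD _ _)).
  have S q : q = (u, v) \/ q = (u, v + Y n.+1) \/ q = (u + X n.+1, v) \/
      q = (u + X n.+1, v + Y n.+1) -> sub n (u, v) q.
    rewrite /sub (XS n) (YS n); move: (X n.+1) (Y n.+1) xp yp => x y xp yp.
    by move=> -[->|[->|[->|->]]] /=; split; lra.
  move=> hJ; have [g1|g1] := lerP (J n (u, v)) (4 * J n.+1 (u, v)).
    by exists (u, v) => _; split => //; apply: S; left.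
  have [g2|g2] := lerP (J n (u, v)) (4 * J n.+1 (u, v + Y n.+1)).
    by exists (u, v + Y n.+1) => _; split => //; apply: S; right; left.
  have [g3|g3] := lerP (J n (u, v)) (4 * J n.+1 (u + X n.+1, v)).
    by exists (u + X n.+1, v) => _; split => //; apply: S; right; right; left.
  exists (u + X n.+1, v + Y n.+1) => _; split; first by apply: S; right; right; right.
  by move: g1 g2 g3 hJ; lra.
have [F hF] := choice step.
pose q := fix q n := if n is m.+1 then F (m, q m) else (a, c).
have okq n : ok n (q n).
  elim: n => [|n IH].
    by rewrite /ok /= /X /Y expr0 !divr1; split; lra.
  have [[s1 s2 s3 s4] _] := hF (n, q n) IH; case: IH => p1 p2 p3 p4.
  by rewrite /ok /=; move: s1 s2 s3 s4 => /= s1 s2 s3 s4; split; lra.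
have subq n : sub n (q n) (q n.+1) by have [] := hF (n, q n) (okq n).
have Jq n : J 0 (q 0) <= 4 ^+ n * J n (q n).
  elim: n => [|n IH]; first by rewrite mul1r.
  rewrite (le_trans IH) // exprSr -mulrA ler_pM2l ?exprn_gt0 //.
  by have [] := hF (n, q n) (okq n).
have nd1 : nondecreasing_seq (fun n => (q n).1).
  by apply/nondecreasing_seqP => n; have [] := subq n.
have nd2 : nondecreasing_seq (fun n => (q n).2).
  by apply/nondecreasing_seqP => n; have [] := subq n.
have nx1 : nonincreasing_seq (fun n => (q n).1 + X n).
  by apply/nonincreasing_seqP => n; have [] := subq n.
have nx2 : nonincreasing_seq (fun n => (q n).2 + Y n).
  by apply/nonincreasing_seqP => n; have [] := subq n.
have le1 n m : (q n).1 <= (q m).1 + X m.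
  have h1 := nd1 n (maxn n m) (leq_maxl _ _); have h2 := nx1 m (maxn n m) (leq_maxr _ _).
  have := X0 (maxn n m); move: h1 h2 => /=; lra.
have le2 n m : (q n).2 <= (q m).2 + Y m.
  have h1 := nd2 n (maxn n m) (leq_maxl _ _); have h2 := nx2 m (maxn n m) (leq_maxr _ _).
  have := Y0 (maxn n m); move: h1 h2 => /=; lra.
pose s := sup (range (fun n => (q n).1)); pose t := sup (range (fun n => (q n).2)).
have hs n : (q n).1 <= s <= (q n).1 + X n.
  apply/andP; split.
    by apply: ub_le_sup; [exists ((q 0).1 + X 0) => _ [m _ <-] | exists n].
  by apply: ge_sup; [exists (q 0).1; exists 0%N | move=> _ [m _ <-]].
have ht n : (q n).2 <= t <= (q n).2 + Y n.
  apply/andP; split.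
    by apply: ub_le_sup; [exists ((q 0).2 + Y 0) => _ [m _ <-] | exists n].
  by apply: ge_sup; [exists (q 0).2; exists 0%N | move=> _ [m _ <-]].
have sab : a <= s <= b.
  have /andP[k1 k2] := hs 0%N; have [k3 k4 _ _] := okq 0%N; apply/andP; split; lra.
have tcd : c <= t <= d.
  have /andP[k1 k2] := ht 0%N; have [_ _ k3 k4] := okq 0%N; apply/andP; split; lra.
have [A hA] := hH sab tcd.
have Jp : 0 < J 0 (q 0).
  by rewrite /J /= /X /Y expr0 !divr1 !(addrC _ (_ - _)) !subrK.
(* With this [e], [4^n] times the local bound is at most half of the initial integral; the [+ 1]
   covers degenerate rectangles. *)
pose e := J 0 (q 0) / (4 * ((b - a) + (d - c) + 1) ^+ 2).
have Dp : 0 < ((b - a) + (d - c) + 1) ^+ 2 by rewrite exprn_gt0 //; lra.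
have e0 : 0 < e by rewrite divr_gt0 // mulr_gt0.
have [de de0 hde] := local_bound hA e0.
have tend (x : R) : exists N, forall n, (N <= n)%N -> x / 2 ^+ n < de.
  have : x * (2^-1) ^+ n @[n --> \oo] --> x * 0.
    by apply: cvgMr; apply: cvg_expr; rewrite ger0_norm ?invr_ge0 // invf_lt1 // ltr1n.
  rewrite mulr0 => /cvgrPdist_lt/(_ _ de0)[N _ hN]; exists N => n /hN.
  by rewrite /= sub0r normrN exprVn; apply: le_lt_trans; rewrite ler_norm.
have [N1 hN1] := tend (b - a); have [N2 hN2] := tend (d - c).
pose n := maxn N1 N2.
have [p1 p2 p3 p4] := okq n.
have := hde _ _ _ _ p1 p2 p3 p4 (hs n) (ht n) (hN1 n (leq_maxl _ _)) (hN2 n (leq_maxr _ _)).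
rewrite -/(J n (q n)) => hJn.
have := Jq n; apply/negP; rewrite -ltNge.
have p0 : 0 < (2 : R) ^+ n by rewrite exprn_gt0.
have E4 : (4 : R) ^+ n = 2 ^+ n * 2 ^+ n by rewrite -exprMn; congr (_ ^+ n); ring.
apply: (@le_lt_trans _ _ (4 ^+ n * (2 * e * (X n + Y n) ^+ 2))).
  by rewrite ler_pM2l // E4 mulr_gt0.
pose K := (b - a) + (d - c).
have -> : 4 ^+ n * (2 * e * (X n + Y n) ^+ 2) = 2 * (e * K ^+ 2).
  by rewrite E4 /X /Y /K; field; rewrite gt_eqF.
have q1 : K ^+ 2 <= (K + 1) ^+ 2 by rewrite ler_sqr ?nnegrE /K; lra.
have : e * K ^+ 2 <= e * (K + 1) ^+ 2 by rewrite ler_pM2l.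
have -> : e * (K + 1) ^+ 2 = J 0 (q 0) / 4.
  by rewrite /e -/K; move: Dp; rewrite -/K => Dp; field; rewrite gt_eqF //; rewrite /K; lra.
by move: Jp; move: (J 0 (q 0)) (e * K ^+ 2) => x y; lra.
Qed.

End goursat.

(** * Means over circles *)

Section mean_value.
Context {R : realType}.
Local Notation C := (Cplx R).
Implicit Types (f g k : C -> C) (z w A : C).

Lemma cvgCD {T : Type} (F : set_system T) {FF : Filter F} (u v : T -> C) (a b : C) :
  u x @[x --> F] --> a -> v x @[x --> F] --> b -> (u x + v x) @[x --> F] --> a + b.
Proof.
move=> /cvgC_ltP hu /cvgC_ltP hv; apply/cvgC_ltP => e e0.
have e2 : 0 < e / 2 by rewrite divr_gt0.
apply: filterS2 (hu _ e2) (hv _ e2) => x h1 h2.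
rewrite (_ : _ - _ = (u x - a) + (v x - b)); last by ring.
by rewrite (le_lt_trans (cmodD _ _)) // [e]splitr ltrD.
Qed.

Lemma cvgCN {T : Type} (F : set_system T) {FF : Filter F} (u : T -> C) (a : C) :
  u x @[x --> F] --> a -> (- u x) @[x --> F] --> - a.
Proof.
move=> /cvgC_cmod hu; apply/cvgC_cmod.
by under eq_fun do rewrite -opprD cmodN.
Qed.

Lemma cvgCB {T : Type} (F : set_system T) {FF : Filter F} (u v : T -> C) (a b : C) :
  u x @[x --> F] --> a -> v x @[x --> F] --> b -> (u x - v x) @[x --> F] --> a - b.
Proof. by move=> hu hv; exact: (cvgCD hu (cvgCN hv)). Qed.

Lemma cvg_succ (T : topologicalType) (u : nat -> T) (l : T) :
  u n @[n --> \oo] --> l -> u n.+1 @[n --> \oo] --> l.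
Proof.
move=> h; apply: (@cvg_comp _ _ _ succn u _ \oo _ _ h).
by move=> A [N _ hN]; exists N => // n /= Nn; apply: hN => /=; exact: leqW.
Qed.

Lemma cvg_pred (T : topologicalType) (u : nat -> T) (l : T) :
  u n.+1 @[n --> \oo] --> l -> u n @[n --> \oo] --> l.
Proof.
move=> h A /h[N _ hN]; exists N.+1 => // -[//|n] /= Nn; exact: hN.
Qed.

Lemma cder_cr f (s t : R) A : cder f (cpair s t) A -> cr_der (fun s t => f (cpair s t)) s t A.
Proof.
move=> h e e0; have [d d0 hd] := h e e0; exists (d / 2); first by rewrite divr_gt0.
move=> u v us vt; have E : cpair u v - cpair s t = cpair (u - s) (v - t) by [].
have hm := cmod_le_reim (cpair (u - s) (v - t)); rewrite !cE in hm.
have := hd (cpair u v); rewrite E => hh.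
apply: le_trans (hh _) _; last by rewrite ler_pM2l.
by move: us vt hm; lra.
Qed.

Lemma derivableC_cst (c z : C) : derivable (fun _ : C => c) z 1.
Proof.
apply: (@cder_derivable _ _ _ 0) => e e0; exists 1 => // w _.
by rewrite subrr sub0r mul0r oppr0 cmod0 mulr_ge0 // ltW.
Qed.

Lemma derivableC_id z : derivable (fun w : C => w) z 1.
Proof.
apply: (@cder_derivable _ _ _ 1) => e e0; exists 1 => // w _.
by rewrite mul1r subrr cmod0 mulr_ge0 // ltW.
Qed.

Lemma derivableXn f z n : derivable f z 1 -> derivable (fun w => f w ^+ n) z 1.
Proof.
move=> h; elim: n => [|n IH].
  apply: (@cder_derivable _ _ _ 0) => e e0; exists 1 => // w _.
  by rewrite !expr0 subrr sub0r mul0r oppr0 cmod0 mulr_ge0 // ltW.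
by under eq_fun do rewrite exprS; exact: (derivableM h IH).
Qed.

Lemma derivable_cder_lin (c : C) z : cder (fun w => c * w) z c.
Proof.
move=> e e0; exists 1 => // w _; rewrite -mulrBr subrr cmod0.
by rewrite mulr_ge0 // ltW.
Qed.

(* In the coordinate z = exp (2 pi (s + i t)) a circle is a vertical segment, and the
   two horizontal sides of a rectangle of height 1 cancel by periodicity. *)
Lemma circle_mean_const k (r1 r2 : R) : 0 < r1 -> r1 <= r2 -> r2 < 1 ->
  (forall z, z != 0 -> cmod z < 1 -> derivable k z 1) ->
  cint 0 1 (fun t => k (cR r1 * expi t)) = cint 0 1 (fun t => k (cR r2 * expi t)).
Proof.
move=> r10 r12 r21 hk.
have r20 : 0 < r2 by exact: lt_le_trans r12.
have pi0 : 0 < 2 * (pi : R) by rewrite mulr_gt0 // pi_gt0.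
pose G := k \o (cexp \o (fun w : C => cR (2 * pi) * w)).
pose H (s t : R) := G (cpair s t).
have HE s t : H s t = k (cR (expR (2 * pi * s)) * expi t) by rewrite /H /G /= cexp_polar.
pose s1 := ln r1 / (2 * pi); pose s2 := ln r2 / (2 * pi).
have es1 : expR (2 * pi * s1) = r1 by rewrite /s1 mulrC divfK ?gt_eqF // lnK.
have es2 : expR (2 * pi * s2) = r2 by rewrite /s2 mulrC divfK ?gt_eqF // lnK.
have s12 : s1 <= s2 by rewrite /s1 /s2 ler_pM2r ?invr_gt0 // ler_ln.
have hH s t : s1 <= s <= s2 -> 0 <= t <= 1 -> exists A, cr_der H s t A.
  move=> /andP[_ ss2] _.
  have d1 := derivable_cder_lin (cR (2 * pi)) (cpair s t).
  have d2 := cder_cexp (cR (2 * pi) * cpair s t).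
  have [|B hB] := @derivable_cder _ k (cexp (cR (2 * pi) * cpair s t)).
    apply: hk; first by rewrite -cmod_gt0 cmod_cexp expR_gt0.
    rewrite cmod_cexp !cE mul0r subr0 (le_lt_trans _ r21) // -es2 ler_expR.
    by rewrite ler_pM2l.
  have := cder_comp (cder_comp d1 d2) hB => /cder_cr h; eexists; exact: h.
have := goursat_rect hH s12 ler01; rewrite /rectint.
have -> : cint s1 s2 (fun s => H s 1 - H s 0) = 0.
  rewrite -[RHS](@cint0 _ s1 s2); apply: eq_cint => s _.
  by rewrite !HE expi1 expi0 subrr.
have cm s : s1 <= s <= s2 -> cbmeas 0 1 (H s).
  move=> hs; apply: cbmeas_cont => t ht; have [A hA] := hH _ _ hs ht.
  exact: cr_cont2 hA.
rewrite subr0 cintB; [|by apply: cm; rewrite s12 lexx|by apply: cm; rewrite s12 lexx].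
move=> /eqP; rewrite mulf_eq0 => /orP[/eqP/(congr1 cim)|].
  by rewrite !cE => /eqP; rewrite oner_eq0.
rewrite subr_eq0 => /eqP h.
transitivity (cint 0 1 (H s1)); first by apply: eq_cint => t _; rewrite HE es1.
by rewrite -h; apply: eq_cint => t _; rewrite HE es2.
Qed.

Lemma holo_cont f z : holo_disk f -> cmod z < 1 -> f w @[w --> z] --> f z.
Proof. by move=> hf /hf /derivable_cder[A]; exact: cder_cvg. Qed.

Lemma circle_cont f (r : R) : holo_disk f -> 0 <= r < 1 ->
  continuous (fun t : R => f (cR r * expi t)).
Proof.
move=> hf /andP[r0 r1] t.
apply: (@continuous_comp _ _ _ (fun t : R => cR r * expi t) f).
  by apply: cvgMr; exact: continuous_expi.
by apply: holo_cont => //; rewrite cmod_circle ger0_norm.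
Qed.

Lemma circle_cbmeas f (r : R) a b : holo_disk f -> 0 <= r < 1 ->
  cbmeas a b (fun t : R => f (cR r * expi t)).
Proof. by move=> hf hr; apply: cbmeas_cont => t _; exact: circle_cont. Qed.

Lemma expiM_cont (x : R) : continuous (fun t => expi (x * t)).
Proof.
move=> t; have h : x * u @[u --> t] --> x * t by apply: cvgMr; exact: cvg_id.
exact: (cvg_comp _ _ h (@continuous_expi _ (x * t))).
Qed.

Lemma cbmeas_expiM a b (x : R) : cbmeas a b (fun t => expi (x * t)).
Proof. by apply: cbmeas_cont => t _; exact: expiM_cont. Qed.

(** The mean of [z ^+ n.+1] over a circle is independent of the radius [r], yet proportional to
    [r ^+ n.+1]; comparing the radii 1/4 and 1/2 forces it to vanish. *)
Lemma cint_expi (n : nat) : cint 0 1 (fun t => expi (n.+1%:R * t)) = 0 :> C.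
Proof.
have h1 : 0 < 4^-1 :> R by lra.
have h2 : 4^-1 <= 2^-1 :> R by lra.
have h3 : 2^-1 < 1 :> R by lra.
have hk z : z != 0 -> cmod z < 1 -> derivable (fun z : C => z ^+ n.+1) z 1.
  by move=> _ _; apply: derivableXn; exact: derivableC_id.
have := circle_mean_const h1 h2 h3 hk.
have E (r : R) : cint 0 1 (fun t => (cR r * expi t) ^+ n.+1) =
    cR (r ^+ n.+1) * cint 0 1 (fun t => expi (n.+1%:R * t)).
  rewrite -cintM; last exact: cbmeas_expiM.
  by apply: eq_cint => t _; rewrite exprMn cRX expiMn.
rewrite !E => /eqP; rewrite -subr_eq0 -mulrBl mulf_eq0 => /orP[|/eqP //].
rewrite -cRB -cmod_eq0 cmod_cR normr_eq0 subr_eq0 => /eqP h.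
have : (4^-1 : R) ^+ n.+1 < 2^-1 ^+ n.+1 by rewrite ltr_pXn2r ?nnegrE //; lra.
by rewrite h ltxx.
Qed.

Lemma cint_conj a b (f : R -> C) : cbmeas a b f ->
  cint a b (fun t => cconj (f t)) = cconj (cint a b f).
Proof. by move=> [_ h]; apply: cplxP; rewrite !cE -?rintN. Qed.

Lemma cint_expi_orth (n k : nat) :
  cint 0 1 (fun t => expi (n%:R * t) * expi (- (k%:R * t))) = (n == k)%:R :> C.
Proof.
have E (a b : nat) t : (b <= a)%N ->
    expi (a%:R * t) * expi (- (b%:R * t)) = expi ((a - b)%:R * t) :> C.
  by move=> ba; rewrite natrB // mulrBl expiD.
case: (ltngtP n k) => nk.
- transitivity (cconj (cint 0 1 (fun t => expi ((k - n)%:R * t)) : C)).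
    rewrite -cint_conj; last exact: cbmeas_expiM.
    apply: eq_cint => t _; rewrite -E; last exact: ltnW.
    by rewrite cconjM !expi_conj opprK mulrC.
  have : (0 < k - n)%N by rewrite subn_gt0.
  by case: (k - n)%N => // m _; rewrite cint_expi; apply: cplxP; rewrite !cE ?oppr0.
- rewrite -[RHS]/0; transitivity (cint 0 1 (fun t => expi ((n - k)%:R * t)) : C).
    by apply: eq_cint => t _; rewrite E // ltnW.
  have : (0 < n - k)%N by rewrite subn_gt0.
  by case: (n - k)%N => // m _; rewrite cint_expi.
- rewrite nk -[RHS](mulr1 1) -[X in _ * X]cR1 -[X in cR X](subr0 1) -cint_cst //.
  by apply: eq_cint => t _; rewrite -expiD subrr expi0.
Qed.

End mean_value.

(** * Fourier and Taylor coefficients *)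

Section bessel.
Context {R : realType}.
Local Notation C := (Cplx R).
Variable u : nat -> R -> C.
Hypothesis bu : forall n, cbmeas 0 1 (u n).
Hypothesis ou : forall n k, cint 0 1 (fun t => u n t * cconj (u k t)) = (n == k)%:R.

Let bconj (f : R -> C) := @cbmeas_conj R 0 1 f.

Lemma sqrcmodB (z w : C) : cmod (z - w) ^+ 2 =
  cmod z ^+ 2 - 2 * cre (z * cconj w) + cmod w ^+ 2.
Proof. by rewrite !sqr_cmod !cE; ring. Qed.

Lemma cbmeas_poly (c : nat -> C) N : cbmeas 0 1 (fun t => \sum_(n < N) c n * u n t).
Proof. by apply: cbmeas_sum => i; apply: cbmeasM => //; exact: cbmeas_cst. Qed.

Lemma cint_polyr (c : nat -> C) N (f : R -> C) : cbmeas 0 1 f ->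
  cint 0 1 (fun t => f t * cconj (\sum_(n < N) c n * u n t)) =
  \sum_(n < N) cconj (c n) * cint 0 1 (fun t => f t * cconj (u n t)).
Proof.
move=> bf.
have -> : (fun t => f t * cconj (\sum_(n < N) c n * u n t)) =
    (fun t => \sum_(n < N) cconj (c n) * (f t * cconj (u n t))).
  apply/funext => t; rewrite (big_morph _ cconjD (_ : cconj 0 = 0)); last first.
    by apply: cplxP; rewrite !cE ?oppr0.
  by rewrite mulr_sumr; apply: eq_bigr => i _; rewrite cconjM; ring.
have bb i : cbmeas 0 1 (fun t => f t * cconj (u i t)).
  by apply: cbmeasM => //; exact: bconj.
rewrite cint_sum; last by move=> i; apply: cbmeasM => //; exact: cbmeas_cst.
by apply: eq_bigr => i _; rewrite cintM.
Qed.

Lemma cint_poly_coef (c : nat -> C) N k : (k < N)%N ->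
  cint 0 1 (fun t => (\sum_(n < N) c n * u n t) * cconj (u k t)) = c k.
Proof.
move=> kN.
have -> : (fun t => (\sum_(n < N) c n * u n t) * cconj (u k t)) =
    (fun t => \sum_(n < N) c n * (u n t * cconj (u k t))).
  by apply/funext => t; rewrite mulr_suml; apply: eq_bigr => i _; rewrite mulrA.
have bb i : cbmeas 0 1 (fun t => u i t * cconj (u k t)).
  by apply: cbmeasM => //; exact: bconj.
rewrite cint_sum; last by move=> i; apply: cbmeasM => //; exact: cbmeas_cst.
rewrite (bigD1 (Ordinal kN)) //= cintM // ou eqxx mulr1 big1 ?addr0 // => i ik.
rewrite cintM // ou; case: eqP => [ik'|]; last by rewrite mulr0.
by case/eqP: ik; apply: val_inj.
Qed.

Lemma parseval_poly (c : nat -> C) N :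
  rint 0 1 (fun t => cmod (\sum_(n < N) c n * u n t) ^+ 2) = \sum_(n < N) cmod (c n) ^+ 2.
Proof.
apply: (can_inj (g := @cre R) (f := @cR R)) => //.
rewrite -cint_cR cR_sum.
transitivity (cint 0 1 (fun t => (\sum_(n < N) c n * u n t) * cconj (\sum_(n < N) c n * u n t))).
  by apply: eq_cint => t _; rewrite mul_conj.
rewrite cint_polyr; last exact: cbmeas_poly.
by apply: eq_bigr => i _; rewrite cint_poly_coef // mulrC mul_conj.
Qed.

Lemma bessel (g : R -> C) N : cbmeas 0 1 g ->
  \sum_(n < N) cmod (cint 0 1 (fun t => g t * cconj (u n t))) ^+ 2 <=
  rint 0 1 (fun t => cmod (g t) ^+ 2).
Proof.
move=> bg; pose c n := cint 0 1 (fun t => g t * cconj (u n t)).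
have : 0 <= rint 0 1 (fun t => cmod (g t - \sum_(n < N) c n * u n t) ^+ 2).
  by apply: rint_ge0 => t _; rewrite exprn_ge0.
have bp := cbmeas_poly c N; have bpc := bconj bp.
rewrite (eq_rint (fun t _ => sqrcmodB (g t) (\sum_(n < N) c n * u n t))).
have b1 : bmeas 0 1 (fun t => cre (g t * cconj (\sum_(n < N) c n * u n t))).
  by have [] := cbmeasM bg bpc.
have b2 : bmeas 0 1 (fun t => 2 * cre (g t * cconj (\sum_(n < N) c n * u n t))).
  by apply: bmeasM => //; exact: bmeas_cst.
rewrite rintD; [|by apply: bmeasB => //; exact: bmeas_sqrcmod|exact: bmeas_sqrcmod].
rewrite rintB //; last exact: bmeas_sqrcmod.
rewrite rintZ // parseval_poly.
have -> : rint 0 1 (fun t => cre (g t * cconj (\sum_(n < N) c n * u n t))) =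
    \sum_(n < N) cmod (c n) ^+ 2.
  transitivity (cre (cint 0 1 (fun t => g t * cconj (\sum_(n < N) c n * u n t)))) => //.
  rewrite cint_polyr // cre_sum; apply: eq_bigr => i _.
  by rewrite -/(c i) mulrC mul_conj cre_cR.
by rewrite -/c; lra.
Qed.

(** The Riemann-Lebesgue lemma: squared coefficients are summable by Bessel's inequality. *)
Lemma bessel_cvg0 (g : R -> C) : cbmeas 0 1 g ->
  cint 0 1 (fun t => g t * cconj (u n t)) @[n --> \oo] --> (0 : C).
Proof.
move=> bg; pose c n := cint 0 1 (fun t => g t * cconj (u n t)).
have cs : cvgn (series (fun n => cmod (c n) ^+ 2)).
  apply: nondecreasing_is_cvgn.
    by apply/nondecreasing_seqP => n; rewrite seriesEnat /= big_nat_recr //= lerDl exprn_ge0.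
  exists (rint 0 1 (fun t => cmod (g t) ^+ 2)) => _ [n _ <-].
  by rewrite seriesEord /=; exact: bessel.
have := cvg_series_cvg_0 cs => h.
apply/cvgC_ltP => e e0; have e2 : 0 < e ^+ 2 by rewrite exprn_gt0.
move/cvgrPdist_lt: h => /(_ _ e2); apply: filterS => n /=.
rewrite sub0r normrN ger0_norm ?exprn_ge0 // subr0 -/(c n) => h.
by rewrite -(ltr_pXn2r (n := 2)) ?nnegrE ?(ltW e0).
Qed.

End bessel.

(** * Taylor expansion *)

Section taylor.
Context {R : realType}.
Local Notation C := (Cplx R).
Implicit Types (f g k : C -> C) (z w A : C).

Lemma cbmeas_lim a b (u : nat -> R -> C) (f : R -> C) (M : R) :
  (forall n, cbmeas a b (u n)) ->
  (forall n t, a <= t <= b -> cmod (u n t) <= M) ->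
  (forall t, a <= t <= b -> u n t @[n --> \oo] --> f t) -> cbmeas a b f.
Proof.
move=> hu hM hl; split.
  apply: (@bmeas_lim _ _ _ (fun n t => cre (u n t)) _ M).
  - by move=> n; have [[]] := hu n.
  - by move=> n t ht; rewrite (le_trans (norm_cre _)) // hM.
  - by move=> t ht; apply: cvg_cre; exact: hl.
apply: (@bmeas_lim _ _ _ (fun n t => cim (u n t)) _ M).
- by move=> n; have [_ []] := hu n.
- by move=> n t ht; rewrite (le_trans (norm_cim _)) // hM.
- by move=> t ht; apply: cvg_cim; exact: hl.
Qed.

Lemma cbmeas_bound a b (f : R -> C) : cbmeas a b f ->
  exists2 M : R, 0 <= M & forall t, a <= t <= b -> cmod (f t) <= M.
Proof.
move=> /bmeas_cmod[_ [M hM]]; exists `|M| => // t /hM; rewrite ger0_norm // => h.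
exact: le_trans h (ler_norm _).
Qed.

(** Cauchy's formula on the circle of radius 1/2; for [f] holomorphic in the disk, [circle_mean_eq]
    gives the same value at every radius in (0, 1). *)
Definition tcoef f n : C :=
  cint 0 1 (fun t => f (cR 2^-1 * expi t) * ((cR 2^-1 * expi t) ^+ n)^-1).

Lemma circle_mean_eq k (r1 r2 : R) : 0 < r1 < 1 -> 0 < r2 < 1 ->
  (forall z, z != 0 -> cmod z < 1 -> derivable k z 1) ->
  cint 0 1 (fun t => k (cR r1 * expi t)) = cint 0 1 (fun t => k (cR r2 * expi t)).
Proof.
move=> /andP[r10 r11] /andP[r20 r21] hk; have [h|h] := lerP r1 r2.
  exact: circle_mean_const.
by apply/esym/circle_mean_const => //; exact: ltW.
Qed.

Lemma fourier_pos f n (r : R) : holo_disk f -> 0 < r < 1 ->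
  cint 0 1 (fun t => f (cR r * expi t) * expi (- (n%:R * t))) = tcoef f n * cR r ^+ n.
Proof.
move=> hf hr; have /andP[r0 r1] := hr.
have hk z : z != 0 -> cmod z < 1 -> derivable (fun z => f z * (z ^+ n)^-1) z 1.
  move=> z0 z1; apply: (derivableM (hf _ z1)).
  apply: (@derivableV _ _ (fun z : C => z ^+ n)); first by rewrite expf_neq0.
  by apply: derivableXn; exact: derivableC_id.
have h2 : 0 < (2^-1 : R) < 1 by apply/andP; split; lra.
rewrite /tcoef (circle_mean_eq h2 hr hk) mulrC -cintM.
  apply: eq_cint => t _; rewrite expiN expiMn exprMn invfM.
  have : cR r ^+ n != 0 by rewrite expf_neq0 // -cmod_gt0 cmod_cR gtr0_norm.
  by move: (cR r ^+ n) => x x0; rewrite mulrCA mulVKf.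
apply: cbmeas_cont => t _; have z0 : cR r * expi t != 0.
  by rewrite -cmod_gt0 cmod_circle gtr0_norm.
have hz : cmod (cR r * expi t) < 1 by rewrite cmod_circle gtr0_norm.
have [A /cder_cvg hA] := derivable_cder (hk _ z0 hz).
have h : cR r * expi u @[u --> t] --> cR r * expi t.
  by apply: cvgMr; exact: continuous_expi.
exact: (cvg_comp _ _ h hA).
Qed.

(** The mean of [f z * z ^+ n.+1] is the same on all circles, and on a small circle of radius [x] it
    is at most [x (cmod (f 0) + 1)]. *)
Lemma fourier_neg f n (r : R) : holo_disk f -> 0 < r < 1 ->
  cint 0 1 (fun t => f (cR r * expi t) * expi (n.+1%:R * t)) = 0.
Proof.
move=> hf hr; have /andP[r0 r1] := hr.
pose k z := f z * z ^+ n.+1.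
have hk z : z != 0 -> cmod z < 1 -> derivable k z 1.
  move=> z0 z1; apply: (derivableM (hf _ z1)).
  by apply: derivableXn; exact: derivableC_id.
have kb (x : R) : 0 < x < 1 -> cbmeas 0 1 (fun t => k (cR x * expi t)).
  move=> /andP[x0 x1]; apply: cbmeas_cont => t _; have z0 : cR x * expi t != 0.
    by rewrite -cmod_gt0 cmod_circle gtr0_norm.
  have hz : cmod (cR x * expi t) < 1 by rewrite cmod_circle gtr0_norm.
  have [A /cder_cvg hA] := derivable_cder (hk _ z0 hz).
  have h : cR x * expi u @[u --> t] --> cR x * expi t.
    by apply: cvgMr; exact: continuous_expi.
  exact: (cvg_comp _ _ h hA).
have [d d0 hd] : exists2 d : R, 0 < d & forall w, cmod (w - 0) < d -> cmod (f w - f 0) < 1.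
  apply/near_cmod; have : cmod (0 : C) < 1 by rewrite cmod0.
  by move=> /(holo_cont hf)/cvgC_ltP; exact.
pose K := cint 0 1 (fun t => k (cR r * expi t)).
have KE : K = cR r ^+ n.+1 * cint 0 1 (fun t => f (cR r * expi t) * expi (n.+1%:R * t)).
  rewrite -cintM; first by apply: eq_cint => t _; rewrite /k exprMn expiMn; ring.
  apply: cbmeasM; last exact: cbmeas_expiM.
  by apply: circle_cbmeas => //; rewrite ltW.
suff K0 : K = 0.
  move: KE; rewrite K0 => /esym/eqP; rewrite mulf_eq0 => /orP[|/eqP //].
  by rewrite expf_eq0 /= -cmod_eq0 cmod_cR normr_eq0 gt_eqF.
apply/eqP; rewrite -cmod_eq0; apply/eqP/le_anti; rewrite cmod_ge0 andbT.
apply/ler_addgt0Pr => e e0; rewrite add0r.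
pose x := Num.min (Num.min (d / 2) (1 / 2)) (e / (cmod (f 0) + 1)).
have M0 : 0 < cmod (f 0) + 1 by rewrite ltr_wpDl.
have x0 : 0 < x by rewrite !lt_min !divr_gt0.
have xd : x < d by rewrite !gt_min; apply/orP; left; apply/orP; left; lra.
have x1 : x < 1 by rewrite !gt_min; apply/orP; left; apply/orP; right; lra.
have xe : x * (cmod (f 0) + 1) <= e by rewrite -ler_pdivlMr // ge_min lexx orbT.
have hx : 0 < x < 1 by rewrite x0.
rewrite /K (circle_mean_eq hr hx hk).
have := @cmod_cint_bound _ 0 1 _ e ler01 (kb _ hx); rewrite subr0 mulr1; apply.
move=> t _; rewrite /k cmodM cmodX cmod_circle gtr0_norm //.
apply: le_trans xe; rewrite mulrC; apply: ler_pM => //; first by rewrite exprn_ge0 // ltW.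
  by rewrite exprS ler_piMr ?(ltW x0) // exprn_ile1 // ltW.
have := hd (cR x * expi t); rewrite subr0 cmod_circle gtr0_norm // => /(_ xd) h.
by have := cmod_sub_ge (f (cR x * expi t)) (f 0); move: h; lra.
Qed.

(* Chernoff's argument: the difference quotient [g] below is bounded, so its Fourier
   coefficients tend to [0] by Bessel's inequality, and the partial sums at [z0] telescope. *)
Lemma taylor_circle f (r t0 : R) : holo_disk f -> 0 < r < 1 ->
  (\sum_(n < N) tcoef f n * (cR r * expi t0) ^+ n) @[N --> \oo] --> f (cR r * expi t0).
Proof.
move=> hf hr; have /andP[r0 r1] := hr.
set z0 := cR r * expi t0; pose F t := f (cR r * expi t); pose d t := expi t - expi t0 : C.
have hz0 : cmod z0 < 1 by rewrite cmod_circle gtr0_norm.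
have bF : cbmeas 0 1 F by apply: circle_cbmeas; rewrite // ltW.
have dc t : (expi u - expi t0) @[u --> t] --> (expi t - expi t0 : C).
  by apply: cvgCB; [exact: continuous_expi | exact: cvg_cst].
have bd : cbmeas 0 1 d by apply: cbmeas_cont => t _; exact: dc.
have zd t : cmod (cR r * expi t - z0) <= cmod (d t).
  by rewrite /z0 -mulrBr cmodM cmod_cR gtr0_norm // ler_piMl // ltW.
have [M M0 hM] : exists2 M : R, 0 <= M &
    forall t, 0 <= t <= 1 -> cmod (F t - f z0) <= M * cmod (d t).
  have [A hA] := derivable_cder (hf _ hz0); have [de de0 hde] := hA 1 ltr01.
  have [B B0 hB] := cbmeas_bound bF.
  exists ((cmod A + 1) + (B + cmod (f z0)) / de).
    by rewrite addr_ge0 ?addr_ge0 // divr_ge0 ?addr_ge0 // ltW.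
  move=> t ht; have [zt|zt] := ltrP (cmod (cR r * expi t - z0)) de.
    have := hde _ zt; rewrite mul1r => h.
    rewrite -(subrK (A * (cR r * expi t - z0)) (F t - f z0)) (le_trans (cmodD _ _)) //.
    rewrite cmodM mulrDl ler_wpDr ?mulr_ge0 ?addr_ge0 ?invr_ge0 ?(ltW de0) //.
    rewrite mulrDl mul1r addrC lerD //; first by rewrite ler_wpM2l.
    by rewrite (le_trans h).
  rewrite (le_trans (cmodB _ _)) // mulrDl ler_wpDl ?mulr_ge0 ?addr_ge0 //.
  apply: (@le_trans _ _ (B + cmod (f z0))); first by rewrite lerD2r hB.
  rewrite mulrAC ler_pdivlMr // ler_wpM2l ?addr_ge0 //.
  exact: le_trans zt (zd t).
(* The quotient of [F t - f z0] by [d t], written with [cconj (d t) / |d t|^2]; it is 0 where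
   [d t = 0]. *)
pose g t := (F t - f z0) * (cconj (d t) * cR ((cmod (d t) ^+ 2)^-1)).
have d0F t : d t = 0 -> F t - f z0 = 0.
  by move=> /eqP; rewrite subr_eq0 => /eqP h; rewrite /F /z0 h subrr.
have gd t : g t * d t = F t - f z0.
  have [/d0F h|/eqP dt] := pselect (d t = 0); first by rewrite /g h !mul0r.
  rewrite /g -mulrA (_ : _ * d t = 1) ?mulr1 // mulrAC (mulrC _ (d t)) mul_conj -cRM.
  by rewrite mulfV // expf_neq0 // cmod_eq0.
have bg : cbmeas 0 1 g.
  (* Adding [1 / (j + 1)] to the denominator makes the quotients continuous while keeping the bound
     [M]; their pointwise limit [g] is therefore measurable. *)
  pose gj j t := (F t - f z0) * (cconj (d t) * cR ((cmod (d t) ^+ 2 + j.+1%:R^-1)^-1)).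
  have pj j t : 0 < cmod (d t) ^+ 2 + j.+1%:R^-1 by rewrite ltr_wpDl ?exprn_ge0 // invr_gt0.
  apply: (@cbmeas_lim _ _ gj _ M).
  - move=> j; apply: cbmeasM; first by apply: cbmeasB => //; exact: cbmeas_cst.
    apply: cbmeasM; first exact: cbmeas_conj.
    apply: cbmeas_cR; apply: bmeas_cont => t _; apply: cvgV; first by rewrite gt_eqF.
    apply: cvgD; last exact: cvg_cst.
    rewrite expr2; under eq_fun do rewrite expr2.
    have cd : cmod (d u) @[u --> t] --> cmod (d t).
      exact: cvg_cmod (dc t).
    exact: (cvgM cd cd).
  - move=> j t ht; rewrite !cmodM cmod_conj cmod_cR gtr0_norm ?invr_gt0 //.
    rewrite mulrA ler_pdivrMr // (@le_trans _ _ (M * cmod (d t) * cmod (d t))) //.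
      by rewrite ler_wpM2r // hM.
    by rewrite -mulrA ler_wpM2l // expr2 lerDl invr_ge0.
  - move=> t _; have [/d0F h|/eqP dt] := pselect (d t = 0).
      by rewrite /g /gj h !mul0r; under eq_fun do rewrite mul0r; exact: cvg_cst.
    apply: cvgMr; apply: cvgMr; apply: cvg_cR; apply: cvgV.
      by rewrite expf_neq0 // cmod_eq0.
    rewrite -[X in _ --> X]addr0; apply: cvgD; first exact: cvg_cst.
    exact: (@cvg_harmonic R).
pose gh x := cint 0 1 (fun t => g t * expi (- (x * t))).
have bge x : cbmeas 0 1 (fun t => g t * expi (- (x * t))).
  by apply: cbmeasM => //; under eq_fun do rewrite -mulNr; exact: cbmeas_expiM.
have bFe x : cbmeas 0 1 (fun t => F t * expi (- (x * t))).
  by apply: cbmeasM => //; under eq_fun do rewrite -mulNr; exact: cbmeas_expiM.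
(* The identity [g * d = F - f z0] in terms of Fourier coefficients: multiplication by [expi t]
   shifts the index. *)
have rel x : gh (x - 1) - expi t0 * gh x =
    cint 0 1 (fun t => F t * expi (- (x * t))) - f z0 * cint 0 1 (fun t => expi (- (x * t))).
  have be : cbmeas 0 1 (fun t => expi (- (x * t)) : C).
    by under eq_fun do rewrite -mulNr; exact: cbmeas_expiM.
  have b2 : cbmeas 0 1 (fun t => expi t0 * (g t * expi (- (x * t)))).
    by apply: cbmeasM => //; exact: cbmeas_cst.
  have b3 : cbmeas 0 1 (fun t => f z0 * expi (- (x * t))).
    by apply: cbmeasM => //; exact: cbmeas_cst.
  rewrite /gh -!cintM // -!cintB //; apply: eq_cint => t _.
  rewrite -mulrBl -gd /d (_ : - ((x - 1) * t) = - (x * t) + t); last by ring.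
  by rewrite expiD; ring.
have orth1 (n k : nat) : cint 0 1 (fun t : R => expi (n%:R * t) * cconj (expi (k%:R * t))) = (n == k)%:R :> C.
  by rewrite -cint_expi_orth; apply: eq_cint => t _; rewrite expi_conj.
have orth2 (n k : nat) : cint 0 1 (fun t : R => expi (- (n%:R * t)) * cconj (expi (- (k%:R * t)))) = (n == k)%:R :> C.
  rewrite eq_sym -cint_expi_orth; apply: eq_cint => t _.
  by rewrite expi_conj opprK mulrC.
have c1 : gh n%:R @[n --> \oo] --> (0 : C).
  have := @bessel_cvg0 _ (fun n t => expi (n%:R * t)) (fun n => cbmeas_expiM _ _ _) orth1 _ bg.
  have -> // : (fun n => cint 0 1 (fun t => g t * cconj (expi (n%:R * t)))) = fun n => gh n%:R.
  by apply/funext => n; apply: eq_cint => t _; rewrite expi_conj.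
have c2 : gh (- n%:R) @[n --> \oo] --> (0 : C).
  have bb n : cbmeas 0 1 (fun t => expi (- (n%:R * t)) : C).
    by under eq_fun do rewrite -mulNr; exact: cbmeas_expiM.
  have := @bessel_cvg0 _ (fun n t => expi (- (n%:R * t))) bb orth2 _ bg.
  have -> // : (fun n => cint 0 1 (fun t => g t * cconj (expi (- (n%:R * t))))) = fun n => gh (- n%:R).
  by apply/funext => n; apply: eq_cint => t _; rewrite expi_conj mulNr.
(* At negative indices the right side of [rel] vanishes, so these coefficients of [g] have constant
   modulus; since they tend to 0, they are 0. *)
have gneg m : cmod (gh (- m.+1%:R)) = cmod (gh (- 1)).
  elim: m => [//|m <-]; have := rel (- m.+1%:R).
  have -> : cint 0 1 (fun t => F t * expi (- (- m.+1%:R * t))) = 0.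
    by rewrite -[RHS](fourier_neg m hf hr); apply: eq_cint => t _; rewrite mulNr opprK.
  have -> : cint 0 1 (fun t => expi (- (- m.+1%:R * t))) = 0 :> C.
    by rewrite -(cint_expi m); apply: eq_cint => t _; rewrite mulNr opprK.
  rewrite mulr0 subrr => /eqP; rewrite subr_eq0 => /eqP.
  rewrite -opprD natr1 => ->.
  by rewrite cmodM cmod_expi mul1r.
have g1 : gh (- 1) = 0.
  apply/eqP; rewrite -cmod_eq0; apply/eqP.
  have h : cmod (gh (- n.+1%:R)) @[n --> \oo] --> 0.
    have h : cmod (gh (- n%:R)) @[n --> \oo] --> cmod (0 : C) by exact: cvg_cmod c2.
    by rewrite cmod0 in h; exact: (cvg_succ h).
  have h' : cmod (gh (- n.+1%:R)) @[n --> \oo] --> cmod (gh (- 1)).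
    by under eq_fun do rewrite gneg; exact: cvg_cst.
  exact: (cvg_unique _ h' h).
(* Summing [rel] telescopes: only the two extreme coefficients of [g] survive, the last with a
   unimodular factor. *)
have S N : (\sum_(n < N.+1) tcoef f n * z0 ^+ n) - f z0 = gh (- 1) - gh N%:R * expi t0 ^+ N.+1.
  have relN n : tcoef f n * cR r ^+ n = gh (n%:R - 1) - expi t0 * gh n%:R + f z0 * (n == 0)%:R.
    rewrite rel /F fourier_pos //.
    have -> : cint 0 1 (fun t => expi (- (n%:R * t))) = (n == 0)%:R :> C.
      rewrite eq_sym -cint_expi_orth; apply: eq_cint => t _.
      by rewrite mul0r expi0 mul1r.
    by rewrite subrK.
  elim: N => [|N IH].
    have := relN 0%N; rewrite expr0 mulr1 sub0r eqxx mulr1 => h.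
    by rewrite big_ord1 expr0 mulr1 h expr1; ring.
  have h : tcoef f N.+1 * cR r ^+ N.+1 = gh N%:R - expi t0 * gh N.+1%:R.
    by rewrite relN mulr0 addr0 (_ : N.+1%:R - 1 = N%:R) // -natr1 addrK.
  rewrite big_ord_recr /= addrAC IH /z0 exprMn mulrA h [expi t0 ^+ N.+2]exprS.
  by ring.
apply: cvg_pred.
apply/cvgC_cmod; under eq_fun do rewrite S g1 sub0r cmodN cmodM cmodX cmod_expi expr1n mulr1.
have h : cmod (gh N%:R) @[N --> \oo] --> cmod (0 : C) by exact: cvg_cmod c1.
by rewrite cmod0 in h.
Qed.

Lemma polar z : exists t : R, z = cR (cmod z) * expi t.
Proof.
have [->|z0] := eqVneq z 0; first by exists 0; rewrite cmod0 cR0 mul0r.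
have m0 : 0 < cmod z by rewrite cmod_gt0.
pose x := cre z / cmod z; pose y := cim z / cmod z.
have xy : x ^+ 2 + y ^+ 2 = 1.
  by rewrite /x /y !exprMn -mulrDl -sqr_cmod exprVn mulfV // expf_neq0 // gt_eqF.
have x1 : -1 <= x <= 1.
  have : x ^+ 2 <= 1 by rewrite -xy lerDl sqr_ge0.
  by rewrite -ler_norml -[X in _ -> _ <= X]normr1 => h; rewrite -ler_sqr ?nnegrE // !real_normK ?num_real // expr1n.
have pi0 : 2 * (pi : R) != 0 by rewrite mulf_neq0 // gt_eqF // pi_gt0.
have zE th : cos th = x -> sin th = y -> z = cR (cmod z) * expi (th / (2 * pi)).
  move=> hc hs; have E : 2 * pi * (th / (2 * pi)) = th by rewrite mulrC divfK.
  apply: cplxP; rewrite !cE E mul0r ?subr0 ?addr0 ?hc ?hs.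
    by rewrite /x mulrC divfK // gt_eqF.
  by rewrite /y mulrC divfK // gt_eqF.
have sE : sin (acos x) = `|y|.
  by rewrite sin_acos // -sqrtr_sqr; congr Num.sqrt; rewrite -xy addrAC subrr add0r.
have [y0|y0] := lerP 0 y.
  by exists (acos x / (2 * pi)); apply: zE; rewrite ?acosK // sE ger0_norm.
exists (- acos x / (2 * pi)); apply: zE; rewrite ?cosN ?sinN ?acosK //.
by rewrite sE ltr0_norm // opprK.
Qed.

Definition pser f (b : nat -> C) := forall z, cmod z < 1 ->
  (\sum_(n < N) b n * z ^+ n) @[N --> \oo] --> f z.

Theorem taylor f : holo_disk f -> pser f (tcoef f).
Proof.
move=> hf z z1; have [->|z0] := eqVneq z 0; last first.
  have [t ->] := polar z; apply: taylor_circle => //.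
  by rewrite cmod_gt0 z0.
(* The origin lies on no circle of positive radius; there the value is reached by means over circles
   shrinking to it. *)
have -> : f 0 = tcoef f 0.
  apply/eqP; rewrite -subr_eq0 -cmod_eq0; apply/eqP/le_anti; rewrite cmod_ge0 andbT.
  apply/ler_addgt0Pr => e e0; rewrite add0r.
  have [d d0 hd] : exists2 d : R, 0 < d & forall w, cmod (w - 0) < d -> cmod (f w - f 0) < e.
    apply/near_cmod; have : cmod (0 : C) < 1 by rewrite cmod0.
    by move=> /(holo_cont hf)/cvgC_ltP; exact.
  pose x := Num.min (d / 2) (1 / 2).
  have x0 : 0 < x by rewrite !lt_min !divr_gt0.
  have xd : x < d by rewrite !gt_min; apply/orP; left; lra.
  have x1 : x < 1 by rewrite !gt_min; apply/orP; right; lra.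
  have hx : 0 < x < 1 by rewrite x0.
  have := fourier_pos 0 hf hx; rewrite expr0 mulr1 => <-; rewrite cmodBC.
  have bx : cbmeas 0 1 (fun t => f (cR x * expi t)) by apply: circle_cbmeas; rewrite // ltW.
  have -> : f 0 = cint 0 1 (fun=> f 0) by rewrite cint_cst // subr0 cR1 mulr1.
  have b2 : cbmeas 0 1 (fun t => f (cR x * expi t) * expi (- (0 * t))).
    by apply: cbmeasM => //; under eq_fun do rewrite -mulNr; exact: cbmeas_expiM.
  rewrite -cintB //; last exact: cbmeas_cst.
  have := @cmod_cint_bound _ 0 1 (fun t => f (cR x * expi t) * expi (- (0 * t)) - f 0) e ler01.
  rewrite subr0 mulr1; apply; first by apply: cbmeasB => //; exact: cbmeas_cst.
  move=> t _; rewrite mul0r oppr0 expi0 mulr1; apply/ltW/hd.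
  by rewrite subr0 cmod_circle gtr0_norm.
apply: cvg_pred.
have -> : (fun N => \sum_(n < N.+1) tcoef f n * 0 ^+ n) = fun=> tcoef f 0.
  apply/funext => N; rewrite big_ord_recl /= expr0 mulr1 big1 ?addr0 // => i _.
  by rewrite exprS mul0r mulr0.
exact: cvg_cst.
Qed.

End taylor.

(** * Compactness of sequences *)

Section sequences.
Context {R : realType}.
Local Notation C := (Cplx R).

Definition subseq_idx (s : nat -> nat) := {homo s : m n / (m < n)%N >-> (m < n)%N}.

Lemma subseq_idx_ge s : subseq_idx s -> forall n, (n <= s n)%N.
Proof.
by move=> hs; elim=> [//|n IH]; exact: leq_ltn_trans IH (hs _ _ (ltnSn n)).
Qed.

Lemma subseq_idx_comp s t : subseq_idx s -> subseq_idx t -> subseq_idx (s \o t).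
Proof. by move=> hs ht m n /ht /hs. Qed.

(** Made for index maps such as the tail of a diagonal sequence or a shift, for which the lower
    bound is what is at hand. *)
Lemma cvg_ge_idx (T : topologicalType) (u : nat -> T) (l : T) (s : nat -> nat) :
  (\forall n \near \oo, (n <= s n)%N) -> u n @[n --> \oo] --> l -> u (s n) @[n --> \oo] --> l.
Proof.
move=> [K _ hK] h A /h[N _ hN]; exists (maxn K N) => // n /= Nn; apply: hN => /=.
rewrite geq_max in Nn; case/andP: Nn => Kn Nn.
exact: leq_trans Nn (hK _ Kn).
Qed.

Lemma cvg_subseq (T : topologicalType) (u : nat -> T) (l : T) s :
  subseq_idx s -> u n @[n --> \oo] --> l -> u (s n) @[n --> \oo] --> l.
Proof. by move=> hs; apply: cvg_ge_idx; apply: nearW => n; exact: subseq_idx_ge. Qed.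

Lemma bw_real (u : nat -> R) (M : R) : (forall n, `|u n| <= M) ->
  exists s, subseq_idx s /\ exists l : R, u (s n) @[n --> \oo] --> l.
Proof.
move=> hM; have [|s ms /cvg_ex[l hl]] := @bolzano_weierstrass R u.
  exists M; split; first exact: num_real.
  by move=> x Mx n _ /=; rewrite (le_trans (hM n)) // ltW.
exists s; split; last by exists l.
by move=> m n mn; rewrite ltnNge -[(_ <= _)%N]/(s n <= s m)%O ms -ltnNge.
Qed.

Lemma bw_cplx (u : nat -> C) (M : R) : (forall n, cmod (u n) <= M) ->
  exists s, subseq_idx s /\ exists l : C, u (s n) @[n --> \oo] --> l.
Proof.
move=> hM.
have [s [hs [a ha]]] := @bw_real (fun n => cre (u n)) M (fun n => le_trans (norm_cre _) (hM n)).
have [t [ht [b hb]]] := @bw_real (fun n => cim (u (s n))) M (fun n => le_trans (norm_cim _) (hM _)).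
exists (s \o t); split; first exact: subseq_idx_comp.
exists (cpair a b); apply: cvgC_reim => //.
exact: (@cvg_subseq _ (fun n => cre (u (s n))) _ _ ht ha).
Qed.

Lemma cauchy_cplx (u : nat -> C) :
  (forall e : R, 0 < e -> exists N, forall m n, (N <= m)%N -> (N <= n)%N -> cmod (u m - u n) < e) ->
  exists l : C, u n @[n --> \oo] --> l.
Proof.
move=> h; have [N1 hN1] := h 1 ltr01.
have [M hM] : exists M : R, forall n, cmod (u (n + N1)%N) <= M.
  exists (cmod (u N1) + 1) => n; have := hN1 (n + N1)%N N1 (leq_addl _ _) (leqnn _).
  by have := cmod_sub_ge (u (n + N1)%N) (u N1); lra.
have [s [hs [l hl]]] := bw_cplx hM; exists l.
apply/cvgC_ltP => e e0; have e2 : 0 < e / 2 by rewrite divr_gt0.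
have [N hN] := h _ e2; move/cvgC_ltP: hl => /(_ _ e2)[K _ hK].
exists N => // n /= Nn.
have := hK (maxn K N) (leq_maxl _ _); set m := (s _ + N1)%N => hm.
have Nm : (N <= m)%N.
  rewrite (leq_trans (leq_maxr K N)) // (leq_trans (subseq_idx_ge hs _)) //.
  exact: leq_addr.
have := hN n m Nn Nm => hnm.
rewrite (_ : u n - l = (u n - u m) + (u m - l)); last by ring.
by rewrite (le_lt_trans (cmodD _ _)) // [e]splitr ltrD.
Qed.

(** [S k] is the extraction after [k] refinements. For [n > k], [S n] factors through [S k.+1], so
    the diagonal eventually runs inside the extraction along which the [k]-th coordinate
    converges. *)
Lemma diagonal_subseq (a : nat -> nat -> C) :
  (forall k, exists M : R, forall n, cmod (a n k) <= M) ->
  exists s, subseq_idx s /\ forall k, exists l : C, a (s n) k @[n --> \oo] --> l.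
Proof.
move=> ha.
have step (p : (nat -> nat) * nat) : exists t, subseq_idx t /\
    exists l : C, a (p.1 (t n)) p.2 @[n --> \oo] --> l.
  case: p => s k /=; have [M hM] := ha k.
  exact: (@bw_cplx (fun n => a (s n) k) M).
have [F hF] := choice step.
pose S := fix S k := if k is j.+1 then S j \o F (S j, j) else id.
have SS k : S k.+1 = S k \o F (S k, k) by [].
have hS k : subseq_idx (S k).
  elim: k => [//|k IH]; rewrite SS; apply: subseq_idx_comp => //.
  by have [] := hF (S k, k).
exists (fun n => S n n); split.
  apply: homo_ltn => [x y z /[swap]|n]; first by move=> h1 h2; exact: ltn_trans h2 h1.
  rewrite SS /=; apply: leq_trans (hS n _ _ (ltnSn n)) _.
  have [h _] := hF (S n, n).
  have := subseq_idx_ge h n.+1; rewrite leq_eqVlt => /orP[/eqP <- //|/(hS n)].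
  exact: ltnW.
move=> k; have [_ [l hl]] := hF (S k, k); exists l.
have tail j : exists t, subseq_idx t /\ S (k.+1 + j)%N = S k.+1 \o t.
  elim: j => [|j [t [ht tE]]]; first by exists id; split => //; rewrite addn0.
  exists (t \o F (S (k.+1 + j)%N, (k.+1 + j)%N)); split.
    by apply: subseq_idx_comp => //; have [] := hF (S (k.+1 + j)%N, (k.+1 + j)%N).
  by rewrite addnS SS tE.
have [t ht] := choice tail.
have E n : (k.+1 <= n)%N -> S n n = S k.+1 (t (n - k.+1)%N n).
  move=> kn; have [_ h] := ht (n - k.+1)%N; rewrite subnKC // in h.
  by rewrite [in LHS]h.
have h := @cvg_ge_idx _ (fun n => a (S k.+1 n) k) l (fun n => t (n - k.+1)%N n) _ hl.
have {h} h : a (S k.+1 (t (n - k.+1)%N n)) k @[n --> \oo] --> l.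
  by apply: h; apply: nearW => n; have [h _] := ht (n - k.+1)%N; exact: subseq_idx_ge.
apply: cvg_trans h; apply: near_eq_cvg; exists k.+1 => // n /= kn.
by rewrite E.
Qed.

End sequences.

(** * The Hardy space *)

Section parseval.
Context {R : realType}.
Local Notation C := (Cplx R).
Implicit Types (f g : C -> C) (b : nat -> C) (r x : R).

Lemma geo_le x N : 0 <= x < 1 -> \sum_(n < N) x ^+ n <= (1 - x)^-1.
Proof.
move=> /andP[x0 x1]; have x1' : 0 < 1 - x by rewrite subr_gt0.
rewrite -[leRHS]mul1r ler_pdivlMr // mulrC.
have -> : (1 - x) * (\sum_(n < N) x ^+ n) = 1 - x ^+ N.
  by apply: oppr_inj; rewrite opprB -mulNr opprB subrX1.
by rewrite gerBl exprn_ge0.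
Qed.

Definition mean2 f r : R := rint 0 1 (fun t => cmod (f (cR r * expi t)) ^+ 2).

Lemma intmean2E f r : cbmeas 0 1 (fun t => f (cR r * expi t)) ->
  intmean2 f r = (mean2 f r)%:E.
Proof.
move=> bf; have bs := bmeas_sqrcmod bf.
rewrite /mean2 EFin_rint // /intmean2 integral_itv_bndo_bndc //.
apply/measurable_EFinP; case: bs => mf _.
by apply: measurable_funS mf => //; apply: subset_itvl; rewrite bnd_simp.
Qed.

Lemma pser_bound f b x : pser f b -> 0 <= x < 1 ->
  exists2 M : R, 0 <= M & forall n, cmod (b n) * x ^+ n <= M.
Proof.
move=> hf /andP[x0 x1].
have : cmod (cR x) < 1 by rewrite cmod_cR ger0_norm.
move=> /hf h.
have [M [_ hM]] : bounded_fun (fun N => cmod (\sum_(n < N) b n * cR x ^+ n)).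
  apply: cvg_seq_bounded; apply/cvg_ex; eexists; exact: (@cvg_cmod R nat \oo _ _ _ h).
have hM' N : cmod (\sum_(n < N) b n * cR x ^+ n) <= `|M| + 1.
  have M1 : M < `|M| + 1 by rewrite (le_lt_trans (ler_norm _)) // ltrDl.
  by have := hM _ M1 N I; rewrite /= ger0_norm.
exists (2 * (`|M| + 1)) => [|n]; first by rewrite mulr_ge0 // addr_ge0.
have -> : cmod (b n) * x ^+ n = cmod (b n * cR x ^+ n).
  by rewrite cmodM cmodX cmod_cR ger0_norm.
have := hM' n.+1; rewrite big_ord_recr /= => h1; have h2 := hM' n.
move: (\sum_(i < n) _) h1 h2 => S h1 h2.
have := cmodB (S + b n * cR x ^+ n) S; rewrite addrAC subrr add0r; lra.
Qed.

Lemma pser_partial_bound f b r : pser f b -> 0 <= r < 1 ->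
  exists2 M : R, 0 <= M & forall N, \sum_(n < N) cmod (b n) * r ^+ n <= M.
Proof.
move=> hf /andP[r0 r1]; pose x := (1 + r) / 2.
have x1 : 0 <= x < 1 by rewrite /x; apply/andP; split; lra.
have [M M0 hM] := pser_bound hf x1; have x0 : 0 < x by rewrite /x; lra.
have rx : 0 <= r / x < 1.
  by rewrite divr_ge0 ?(ltW x0) //= ltr_pdivrMr // mul1r /x; lra.
exists (M * (1 - r / x)^-1) => [|N].
  by rewrite mulr_ge0 // invr_ge0 subr_ge0 ltW //; case/andP: rx.
apply: (@le_trans _ _ (M * \sum_(n < N) (r / x) ^+ n)); last first.
  by rewrite ler_wpM2l // geo_le.
rewrite mulr_sumr; apply: ler_sum => i _.
rewrite exprMn exprVn mulrA -[leLHS]mulr1 -(@mulfV _ (x ^+ i)) ?expf_neq0 ?gt_eqF //.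
rewrite mulrA ler_wpM2r ?invr_ge0 ?exprn_ge0 ?(ltW x0) // mulrAC ler_wpM2r ?exprn_ge0 //.
Qed.

Lemma circle_poly b r N t : \sum_(n < N) b n * (cR r * expi t) ^+ n =
  \sum_(n < N) (b n * cR r ^+ n) * expi (n%:R * t) :> C.
Proof. by apply: eq_bigr => i _; rewrite exprMn expiMn mulrA. Qed.

Lemma cmod_poly_le b r N t : 0 <= r ->
  cmod (\sum_(n < N) b n * (cR r * expi t) ^+ n) <= \sum_(n < N) cmod (b n) * r ^+ n.
Proof.
move=> r0; rewrite (le_trans (cmod_sum _ _ _)) //; apply: ler_sum => i _.
by rewrite cmodM cmodX cmod_circle ger0_norm.
Qed.

Lemma cbmeas_circle_poly b r N :
  cbmeas 0 1 (fun t => \sum_(n < N) b n * (cR r * expi t) ^+ n).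
Proof.
under eq_fun do rewrite circle_poly.
apply: cbmeas_sum => i; apply: cbmeasM; [exact: cbmeas_cst | exact: cbmeas_expiM].
Qed.

Lemma mean2_poly b r N : 0 <= r -> rint 0 1 (fun t =>
  cmod (\sum_(n < N) b n * (cR r * expi t) ^+ n) ^+ 2) =
  \sum_(n < N) (cmod (b n) * r ^+ n) ^+ 2.
Proof.
move=> r0; under eq_rint do rewrite circle_poly.
have orth (n k : nat) : cint 0 1 (fun t : R => expi (n%:R * t) * cconj (expi (k%:R * t))) = (n == k)%:R :> C.
  by rewrite -cint_expi_orth; apply: eq_cint => t _; rewrite expi_conj.
rewrite (@parseval_poly _ (fun n t => expi (n%:R * t)) (fun n => cbmeas_expiM _ _ _) orth
  (fun n => b n * cR r ^+ n)).
by apply: eq_bigr => i _; rewrite cmodM cmodX cmod_cR ger0_norm.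
Qed.

Lemma cvg_sqr {T : Type} (F : set_system T) {FF : Filter F} (u : T -> R) (l : R) :
  u x @[x --> F] --> l -> u x ^+ 2 @[x --> F] --> l ^+ 2.
Proof. by move=> h; rewrite expr2; under eq_fun do rewrite expr2; exact: (cvgM h h). Qed.

Lemma parseval f b r : pser f b -> 0 <= r < 1 ->
  \sum_(n < N) (cmod (b n) * r ^+ n) ^+ 2 @[N --> \oo] --> mean2 f r.
Proof.
move=> hf hr; have [M M0 hM] := pser_partial_bound hf hr; have /andP[r0 r1] := hr.
under eq_fun do rewrite -mean2_poly //.
apply: (@rint_cvg _ _ _ _ _ (M ^+ 2)).
- by move=> N; have [] := bmeas_sqrcmod (cbmeas_circle_poly b r N).
- move=> N t _; rewrite ger0_norm ?exprn_ge0 // ler_sqr ?nnegrE //.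
  by rewrite (le_trans (cmod_poly_le _ _ _ r0)).
- move=> t _; apply: cvg_sqr; apply: cvg_cmod; apply: hf.
  by rewrite cmod_circle ger0_norm.
Qed.

Lemma sum_sqr_nd (u : nat -> R) : nondecreasing_seq (fun N => \sum_(n < N) u n ^+ 2).
Proof.
by apply/nondecreasing_seqP => n; rewrite big_ord_recr /= lerDl sqr_ge0.
Qed.

Lemma parseval_ge f b r N : pser f b -> 0 <= r < 1 ->
  \sum_(n < N) (cmod (b n) * r ^+ n) ^+ 2 <= mean2 f r.
Proof.
move=> hf hr; have h := parseval hf hr.
rewrite -(cvg_lim _ h) //; apply: nondecreasing_cvgn_le.
  exact: (@sum_sqr_nd (fun n => cmod (b n) * r ^+ n)).
by apply/cvg_ex; eexists; exact: h.
Qed.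

(** The real-valued form of [H2norm2 f <= B], so that estimates stay outside the extended reals;
    [H2norm2_le] translates for holomorphic [f]. *)
Definition h2le f (B : R) := forall r, 0 <= r < 1 -> mean2 f r <= B.

Lemma h2le_ge0 f (B : R) : h2le f B -> 0 <= B.
Proof.
move=> h; have /h : 0 <= (0 : R) < 1 by rewrite lexx ltr01.
by apply: le_trans; apply: rint_ge0 => t _; rewrite exprn_ge0.
Qed.

Lemma coef_h2le f b (B : R) : pser f b -> (forall N, \sum_(n < N) cmod (b n) ^+ 2 <= B) ->
  h2le f B.
Proof.
move=> hf hB r hr; have /andP[r0 r1] := hr; apply: (cvgr_to_le (parseval hf hr)).
apply: nearW => N; apply: le_trans (hB N); apply: ler_sum => i _.
rewrite exprMn ler_piMr ?exprn_ge0 // exprn_ile1 ?exprn_ge0 //.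
by rewrite exprn_ile1 // ltW.
Qed.

(** The fixed sequence of radii tending to 1; the shift by 2 makes it start at 1/2. *)
Lemma cvg_one_minus : (1 - n.+2%:R^-1 : R) @[n --> \oo] --> (1 : R).
Proof.
rewrite -[X in _ --> X]subr0; apply: cvgB; first exact: cvg_cst.
exact: (@cvg_succ _ (fun n => n.+1%:R^-1 : R) 0 (@cvg_harmonic R)).
Qed.

Lemma one_minus_itv n : 0 <= (1 - n.+2%:R^-1 : R) < 1.
Proof.
rewrite subr_ge0 invf_le1 ?ltr0n // ler1n /= gtrBl invr_gt0 ltr0n //.
Qed.

Lemma h2le_coef f b (B : R) : pser f b -> h2le f B ->
  forall N, \sum_(n < N) cmod (b n) ^+ 2 <= B.
Proof.
move=> hf hB N.
have h : \sum_(n < N) (cmod (b n) * (1 - k.+2%:R^-1) ^+ n) ^+ 2 @[k --> \oo] -->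
    \sum_(n < N) (cmod (b n) * 1 ^+ n) ^+ 2.
  apply: cvg_big => [|i _]; first exact: add_continuous.
  apply: cvg_sqr; apply: cvgMr; elim: (nat_of_ord i) => [|j IH].
    by under eq_fun do rewrite expr0; rewrite expr0; exact: cvg_cst.
  under eq_fun do rewrite exprS; rewrite exprS; apply: cvgM => //.
  exact: cvg_one_minus.
have -> : \sum_(n < N) cmod (b n) ^+ 2 = \sum_(n < N) (cmod (b n) * 1 ^+ n) ^+ 2.
  by apply: eq_bigr => i _; rewrite expr1n mulr1.
apply: (cvgr_to_le h); apply: nearW => k.
have hk := one_minus_itv k.
exact: le_trans (parseval_ge N hf hk) (hB _ hk).
Qed.

(** Every coefficient is at most [sqrt B], and a geometric series is summed. This is the link from
    norm bounds to local bounds and from norm convergence to pointwise convergence. *)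
Lemma h2le_pt f b (B : R) : pser f b -> h2le f B -> forall z, cmod z < 1 ->
  cmod (f z) <= Num.sqrt B / (1 - cmod z).
Proof.
move=> hf hB z z1; apply: (cvgr_to_le (@cvg_cmod R nat \oo _ _ _ (hf z z1))).
apply: nearW => N; rewrite (le_trans (cmod_sum _ _ _)) //.
apply: (@le_trans _ _ (Num.sqrt B * \sum_(n < N) cmod z ^+ n)); last first.
  by rewrite ler_wpM2l ?sqrtr_ge0 // geo_le // cmod_ge0.
rewrite mulr_sumr; apply: ler_sum => i _; rewrite cmodM cmodX ler_wpM2r ?exprn_ge0 //.
rewrite -[leLHS]ger0_norm // -sqrtr_sqr ler_sqrt ?(h2le_ge0 hB) //.
have := h2le_coef hf hB i.+1; rewrite big_ord_recr /=; apply: le_trans.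
by rewrite lerDr; apply: sumr_ge0 => j _; rewrite exprn_ge0.
Qed.

Lemma H2norm2_le f (B : R) : holo_disk f -> (H2norm2 f <= B%:E)%E <-> h2le f B.
Proof.
move=> hf; split=> [h r hr|h].
  have bf := circle_cbmeas 0 1 hf hr.
  rewrite -lee_fin -intmean2E //; apply: le_trans h.
  by apply: ereal_sup_ubound; exists r => //=; rewrite in_itv.
apply: ge_ereal_sup => _ [r /= hr <-]; rewrite in_itv /= in hr.
by rewrite intmean2E ?lee_fin ?h //; exact: circle_cbmeas.
Qed.

Lemma inH2P f : inH2 f <-> holo_disk f /\ exists B, h2le f B.
Proof.
split=> [[hf h]|[hf [B hB]]]; split => //; last first.
  by apply: (@le_lt_trans _ _ B%:E); [exact/H2norm2_le | rewrite ltry].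
have h0 : (0 <= H2norm2 f)%E.
  apply: (@le_trans _ _ (intmean2 f 0)).
    by apply: integral_ge0 => t _; rewrite lee_fin exprn_ge0.
  by apply: ereal_sup_ubound; exists 0 => //=; rewrite in_itv /= lexx ltr01.
exists (fine (H2norm2 f)); apply/H2norm2_le => //; rewrite fineK //.
by rewrite ge0_fin_numE.
Qed.

Lemma pser0 f b : pser f b -> b 0%N = f 0.
Proof.
move=> hf; have h0 : cmod (0 : C) < 1 by rewrite cmod0.
have h' : \sum_(n < N) b n * 0 ^+ n @[N --> \oo] --> b 0%N.
  apply: cvg_pred.
  have -> : (fun N => \sum_(n < N.+1) b n * 0 ^+ n) = fun=> b 0%N.
    apply/funext => N; rewrite big_ord_recl /= expr0 mulr1 big1 ?addr0 // => i _.
    by rewrite exprS mul0r mulr0.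
  exact: cvg_cst.
by apply: (cvg_unique _ h' (hf 0 h0)).
Qed.

Lemma holo_mean f r : holo_disk f -> 0 <= r < 1 ->
  cint 0 1 (fun t => f (cR r * expi t)) = f 0.
Proof.
move=> hf /andP[r0 r1]; move: r0; rewrite le_eqVlt => /predU1P[<-|r0].
  under eq_cint do rewrite cR0 mul0r.
  by rewrite cint_cst // subr0 cR1 mulr1.
have hr : 0 < r < 1 by rewrite r0.
rewrite -(pser0 (taylor hf)) -[RHS]mulr1 -(expr0 (cR r)) -fourier_pos //.
by apply: eq_cint => t _; rewrite mul0r oppr0 expi0 mulr1.
Qed.

End parseval.

#[local] Opaque cmod expi cR cre cim cpair cint rint cconj.

(** * Normal families *)

Section local_estimates.
Context {R : realType}.
Local Notation C := (Cplx R).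
Implicit Types (f g : C -> C) (b : nat -> C) (r M d : R) (z w : C).

Lemma cvgCM {T : Type} (F : set_system T) {FF : Filter F} (u v : T -> C) (a b : C) :
  u x @[x --> F] --> a -> v x @[x --> F] --> b -> (u x * v x) @[x --> F] --> a * b.
Proof. by move=> hu hv; exact: (cvgM hu hv). Qed.

Lemma cvgCZl {T : Type} (F : set_system T) {FF : Filter F} (u : T -> C) (a c : C) :
  u x @[x --> F] --> a -> (c * u x) @[x --> F] --> c * a.
Proof. by move=> hu; exact: (cvgCM (cvg_cst c) hu). Qed.

Lemma cvgCZr {T : Type} (F : set_system T) {FF : Filter F} (u : T -> C) (a c : C) :
  u x @[x --> F] --> a -> (u x * c) @[x --> F] --> a * c.
Proof. by move=> hu; exact: (cvgCM hu (cvg_cst c)). Qed.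

Lemma taylor_rem f b M k z : pser f b -> (forall n, cmod (b n) <= M) -> cmod z < 1 ->
  cmod (f z - \sum_(n < k) b n * z ^+ n) <= M * cmod z ^+ k / (1 - cmod z).
Proof.
move=> hf hM z1; have M0 : 0 <= M by exact: le_trans (hM 0%N).
have h : cmod (\sum_(n < k + N) b n * z ^+ n - \sum_(n < k) b n * z ^+ n) @[N --> \oo]
    --> cmod (f z - \sum_(n < k) b n * z ^+ n).
  apply: cvg_cmod; apply: cvgCB; last exact: cvg_cst.
  apply: (@cvg_ge_idx _ (fun N => \sum_(n < N) b n * z ^+ n)); last exact: hf.
  by apply: nearW => n; exact: leq_addl.
apply: (cvgr_to_le h); apply: nearW => N.
rewrite big_split_ord /= addrAC subrr add0r (le_trans (cmod_sum _ _ _)) //.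
apply: (@le_trans _ _ (M * cmod z ^+ k * \sum_(n < N) cmod z ^+ n)); last first.
  by rewrite ler_wpM2l ?mulr_ge0 ?exprn_ge0 // geo_le // cmod_ge0.
rewrite mulr_sumr; apply: ler_sum => i _; rewrite cmodM cmodX exprD mulrA.
by rewrite ler_wpM2r ?exprn_ge0 // ler_wpM2r ?exprn_ge0.
Qed.

(** Cauchy's estimate from Parseval: one squared coefficient is at most the whole sum, hence at most
    [M ^+ 2]. *)
Lemma holo_bounded_coef f M : holo_disk f -> (forall z, cmod z < 1 -> cmod (f z) <= M) ->
  forall n, cmod (tcoef f n) <= M.
Proof.
move=> hf hM n.
have M0 : 0 <= M by apply: le_trans (hM 0 _); rewrite ?cmod0.
have h : h2le f (M ^+ 2).
  move=> r hr; have bf := circle_cbmeas 0 1 hf hr; have /andP[r0 r1] := hr.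
  rewrite -[leRHS]mulr1 -[X in _ * X](subr0 1) -rint_cst //; apply: le_rint.
  - exact: bmeas_sqrcmod.
  - exact: bmeas_cst.
  - by move=> t _; rewrite ler_sqr ?nnegrE // hM // cmod_circle ger0_norm.
have := h2le_coef (taylor hf) h n.+1; rewrite big_ord_recr /= => h'.
rewrite -ler_sqr ?nnegrE //; apply: le_trans h'.
by rewrite lerDr; apply: sumr_ge0 => j _; rewrite exprn_ge0.
Qed.

Lemma cder_affine (a c z : C) : cder (fun w => a + c * w) z c.
Proof.
move=> e e0; exists 1 => // w _; rewrite opprD addrACA subrr add0r -mulrBr subrr cmod0.
by rewrite mulr_ge0 // ltW.
Qed.

Lemma holo_recenter f z d : holo_disk f -> 0 < d -> cmod z + d <= 1 ->
  holo_disk (fun w => f (z + cR d * w)).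
Proof.
move=> hf d0 zd w w1; have h : cmod (z + cR d * w) < 1.
  rewrite (le_lt_trans (cmodD _ _)) // cmodM cmod_cR gtr0_norm //.
  apply: lt_le_trans zd; rewrite ltrD2l -[ltRHS]mulr1 ltr_pM2l //.
have [A hA] := derivable_cder (hf _ h).
exact: cder_derivable (cder_comp (cder_affine z (cR d) w) hA).
Qed.

Lemma recenterK z d w : 0 < d -> z + cR d * ((w - z) / cR d) = w.
Proof.
move=> d0; have c0 : cR d != 0 by rewrite -cmod_gt0 cmod_cR gtr0_norm.
by rewrite mulrC divfK // addrC subrK.
Qed.

Lemma cmod_recenter z d w : 0 < d -> cmod ((w - z) / cR d) = cmod (w - z) / d.
Proof. by move=> d0; rewrite cmodM cmodV cmod_cR gtr0_norm. Qed.

(** The disk around [z] is rescaled to the unit disk and the Taylor series cut after the linear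
    term; the 2 bounds [1 / (1 - |v|)] for [|v| <= 1/2]. The constants depend only on [M] and [d],
    hence are uniform over bounded families. *)
Lemma local_second f z d M : holo_disk f -> 0 < d -> cmod z + d <= 1 ->
  (forall w, cmod (w - z) < d -> cmod (f w) <= M) ->
  exists A, cmod A <= M / d /\ forall w, cmod (w - z) <= d / 2 ->
    cmod (f w - f z - A * (w - z)) <= 2 * M / d ^+ 2 * cmod (w - z) ^+ 2.
Proof.
move=> hf d0 zd hM; pose g v := f (z + cR d * v).
have hg : holo_disk g by exact: holo_recenter.
have gM v : cmod v < 1 -> cmod (g v) <= M.
  move=> v1; apply: hM; rewrite addrAC subrr add0r cmodM cmod_cR gtr0_norm //.
  by rewrite -[ltRHS]mulr1 ltr_pM2l.
have M0 : 0 <= M by apply: le_trans (gM 0 _); rewrite ?cmod0.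
exists (tcoef g 1 / cR d); split.
  rewrite cmodM cmodV cmod_cR gtr0_norm // ler_wpM2r ?invr_ge0 ?(ltW d0) //.
  exact: holo_bounded_coef.
move=> w wd; have hv : cmod ((w - z) / cR d) <= 1 / 2.
  by rewrite cmod_recenter // ler_pdivrMr // mulrC mul1r.
have v1 : cmod ((w - z) / cR d) < 1 by lra.
have := taylor_rem 2 (taylor hg) (holo_bounded_coef hg gM) v1.
rewrite big_ord_recl big_ord1 /= expr0 mulr1 (pser0 (taylor hg)) expr1.
rewrite /g recenterK // mulr0 addr0 opprD addrA mulrA mulrAC.
move=> h; apply: (le_trans h).
have -> : 2 * M / d ^+ 2 * cmod (w - z) ^+ 2 = M * cmod ((w - z) / cR d) ^+ 2 * 2.
  by rewrite cmod_recenter // exprMn exprVn; ring.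
rewrite ler_wpM2l ?mulr_ge0 ?exprn_ge0 // -[leRHS]invrK lef_pV2 ?posrE ?invr_gt0 //; lra.
Qed.

Definition loc_bounded (u : nat -> C -> C) := forall r, 0 <= r < 1 ->
  exists M, forall n z, cmod z <= r -> cmod (u n z) <= M.

(** The derivatives at [z] are bounded, so a subsequence of them converges to some [L]. The
    second-order estimate of [local_second], uniform in [n], passes to the limit and shows that [L]
    is the derivative of [f]. *)
Lemma holo_lim (u : nat -> C -> C) f : (forall n, holo_disk (u n)) -> loc_bounded u ->
  (forall z, cmod z < 1 -> u n z @[n --> \oo] --> f z) -> holo_disk f.
Proof.
move=> hu bu hl z z1; rewrite /udisk /= in z1; pose d := (1 - cmod z) / 2.
have d0 : 0 < d by rewrite /d; lra.
have zd : cmod z + d <= 1 by rewrite /d; lra.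
have hr : 0 <= (1 + cmod z) / 2 < 1.
  by apply/andP; split; [have := cmod_ge0 z|]; lra.
have [M hM] := bu _ hr.
have hM' n w : cmod (w - z) < d -> cmod (u n w) <= M.
  by move=> wz; apply: hM; have := cmod_sub_ge w z; rewrite /d in wz; lra.
have [A hA] := choice (fun n => local_second (hu n) d0 zd (hM' n)).
have [s [hs [L hL]]] := bw_cplx (fun n => (hA n).1).
pose K := 2 * M / d ^+ 2.
have bnd w : cmod (w - z) <= d / 2 -> cmod (f w - f z - L * (w - z)) <= K * cmod (w - z) ^+ 2.
  move=> wd; have w1 : cmod w < 1 by have := cmod_sub_ge w z; rewrite /d in wd; lra.
  have h : cmod (u (s n) w - u (s n) z - A (s n) * (w - z)) @[n --> \oo] -->
      cmod (f w - f z - L * (w - z)).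
    apply: cvg_cmod; apply: cvgCB.
      apply: cvgCB.
        exact: (@cvg_subseq _ (fun n => u n w) _ _ hs (hl w w1)).
      exact: (@cvg_subseq _ (fun n => u n z) _ _ hs (hl z z1)).
    exact: (cvgCZr hL).
  by apply: (cvgr_to_le h); apply: nearW => n; exact: (hA (s n)).2.
have M0 : 0 <= M by apply: le_trans (hM 0%N 0 _); rewrite ?cmod0 //; case/andP: hr.
have K0 : 0 <= K by apply: divr_ge0; [rewrite mulr_ge0 | rewrite exprn_ge0 // ltW].
apply: (@cder_derivable _ _ _ L) => e e0.
exists (Num.min (d / 2) (e / (K + 1))) => [|w].
  by rewrite lt_min; apply/andP; split; apply: divr_gt0 => //; rewrite ltr_wpDl.
rewrite lt_min => /andP[w1 w2]; rewrite (le_trans (bnd _ (ltW w1))) // expr2 mulrA.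
rewrite ler_wpM2r // (@le_trans _ _ ((K + 1) * cmod (w - z))) //.
  by rewrite ler_wpM2r // lerDl.
by rewrite mulrC -ler_pdivlMr ?ltr_wpDl // ltW.
Qed.

Lemma loc_bounded_coef (u : nat -> C -> C) r : (forall n, holo_disk (u n)) ->
  loc_bounded u -> 0 < r < 1 -> exists2 M, 0 <= M & forall n k, cmod (tcoef (u n) k) * r ^+ k <= M.
Proof.
move=> hu bu hr; have /andP[r0 r1] := hr.
have hr' : 0 <= r < 1 by rewrite (ltW r0).
have [M hM] := bu r hr'.
have M0 : 0 <= M by apply: le_trans (hM 0%N 0 _); rewrite ?cmod0 // ltW.
exists M => // n k; have zr : cmod (0 : C) + r <= 1 by rewrite cmod0 add0r ltW.
have -> : cmod (tcoef (u n) k) * r ^+ k = cmod (tcoef (u n) k * cR r ^+ k).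
  by rewrite cmodM cmodX cmod_cR gtr0_norm.
rewrite -fourier_pos //.
have bb : cbmeas 0 1 (fun t => u n (cR r * expi t) * expi (- (k%:R * t))).
  apply: cbmeasM; first by apply: circle_cbmeas; rewrite // ltW.
  by under eq_fun do rewrite -mulNr; exact: cbmeas_expiM.
rewrite -[leRHS]mulr1 -[X in _ * X](subr0 1); apply: cmod_cint_bound => // t _.
by rewrite cmodM cmod_expi mulr1 hM // cmod_circle gtr0_norm.
Qed.

Lemma loc_bounded_subseq (u : nat -> C -> C) s : loc_bounded u ->
  loc_bounded (fun n => u (s n)).
Proof. by move=> h r /h[M hM]; exists M => n; exact: hM. Qed.

Lemma tcoef_cvg (u : nat -> C -> C) f k : (forall n, holo_disk (u n)) -> loc_bounded u ->
  (forall z, cmod z < 1 -> u n z @[n --> \oo] --> f z) ->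
  tcoef (u n) k @[n --> \oo] --> tcoef f k.
Proof.
move=> hu bu hl; rewrite /tcoef.
have h2 : 0 <= (2^-1 : R) < 1 by apply/andP; split; lra.
move: (2^-1 : R) h2 => x h2; have /andP[x0 x1] := h2.
have [M hM] := bu _ h2; pose W := (x ^+ k)^-1.
have cW t : cmod (((cR x * expi t) ^+ k)^-1) = W.
  by rewrite cmodV cmodX cmod_circle ger0_norm.
have bx : cbmeas 0 1 (fun t => ((cR x * expi t) ^+ k)^-1).
  have -> : (fun t => ((cR x * expi t) ^+ k)^-1) =
    fun t => ((cR x : C) ^+ k)^-1 * expi ((- k%:R) * t).
    by apply/funext => t; rewrite exprMn invfM mulNr expiN expiMn.
  by apply: cbmeasM; [exact: cbmeas_cst | exact: cbmeas_expiM].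
apply: (@cint_cvg _ _ _ _ _ (M * W)).
- by move=> n; exact: (cbmeasM (circle_cbmeas 0 1 (hu n) h2) bx).
- move=> n t _; rewrite cmodM cW ler_wpM2r ?invr_ge0 ?exprn_ge0 // hM //.
  by rewrite cmod_circle ger0_norm.
- move=> t _; have h : cmod (cR x * expi t) < 1 by rewrite cmod_circle ger0_norm.
  exact: (cvgCZr (hl _ h)).
Qed.

(** A diagonal extraction makes every Taylor coefficient converge. The Taylor remainders are small
    uniformly in [n], so the values form Cauchy sequences. *)
Theorem montel (u : nat -> C -> C) : (forall n, holo_disk (u n)) -> loc_bounded u ->
  exists s f, [/\ subseq_idx s, holo_disk f &
    forall z, cmod z < 1 -> u (s n) z @[n --> \oo] --> f z].
Proof.
move=> hu bu.
have [k|s [hs hc]] := @diagonal_subseq R (fun n k => tcoef (u n) k).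
  have h2 : 0 < (2^-1 : R) < 1 by apply/andP; split; lra.
  have [M _ hM] := loc_bounded_coef hu bu h2.
  exists (M / 2^-1 ^+ k) => n; rewrite ler_pdivlMr // exprn_gt0 //; lra.
have cv z : cmod z < 1 -> exists l : C, u (s n) z @[n --> \oo] --> l.
  move=> z1; apply: cauchy_cplx => e e0; pose r := (1 + cmod z) / 2.
  have z0 := cmod_ge0 z.
  have r0 : 0 < r by rewrite /r; lra.
  have zr : cmod z < r by rewrite /r; lra.
  have hr : 0 < r < 1 by rewrite r0 /r; lra.
  have [M M0 hM] := loc_bounded_coef hu bu hr.
  pose q := cmod z / r.
  have q01 : 0 <= q < 1 by rewrite /q divr_ge0 ?(ltW r0) //= ltr_pdivrMr // mul1r.
  have q0 : 0 <= q by case/andP: q01.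
  have q1 : q < 1 by case/andP: q01.
  have zq : z = cR r * (z / cR r).
    by rewrite mulrC divfK // -cmod_gt0 cmod_cR gtr0_norm.
  have qE : cmod (z / cR r) = q by rewrite cmodM cmodV cmod_cR gtr0_norm.
  (* Dilating by [r] turns the bound on [cmod (tcoef (u n) j) * r ^+ j] into a plain bound on
     coefficients, to which [taylor_rem] applies at [z / r]. *)
  have rem n k : cmod (u n z - \sum_(j < k) tcoef (u n) j * z ^+ j) <= M * q ^+ k / (1 - q).
    pose v w := u n (cR r * w).
    have hv : pser v (fun j => tcoef (u n) j * cR r ^+ j).
      move=> w w1; rewrite /v.
      have h : cmod (cR r * w) < 1.
        rewrite cmodM cmod_cR gtr0_norm // (@lt_trans _ _ r) //; last by case/andP: hr.
        by rewrite -[ltRHS]mulr1 ltr_pM2l.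
      have := taylor (hu n) h.
      have -> // : (fun N => \sum_(j < N) tcoef (u n) j * (cR r * w) ^+ j) =
          (fun N => \sum_(j < N) (tcoef (u n) j * cR r ^+ j) * w ^+ j).
      by apply/funext => N; apply: eq_bigr => j _; rewrite exprMn mulrA.
    have vM j : cmod (tcoef (u n) j * cR r ^+ j) <= M.
      by rewrite cmodM cmodX cmod_cR gtr0_norm.
    have w1 : cmod (z / cR r) < 1 by rewrite qE.
    have := taylor_rem k hv vM w1; rewrite qE /v -zq.
    rewrite (eq_bigr (fun j : 'I_k => tcoef (u n) j * z ^+ j)) // => j _.
    by rewrite -mulrA -exprMn -zq.
  have [k hk] : exists k, M * q ^+ k / (1 - q) < e / 4.
    have h : M / (1 - q) * q ^+ k @[k --> \oo] --> M / (1 - q) * 0.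
      by apply: cvgMr; apply: cvg_expr; rewrite ger0_norm.
    rewrite mulr0 in h; have e4 : 0 < e / 4 by rewrite divr_gt0.
    move/cvgrPdist_lt: h => /(_ _ e4)[k _ hk]; exists k.
    have := hk k (leqnn k); rewrite /= sub0r normrN ger0_norm; first by rewrite mulrAC.
    by rewrite mulr_ge0 ?exprn_ge0 // divr_ge0 // subr_ge0 ltW.
  have [S hS] : exists S : C, \sum_(j < k) tcoef (u (s n)) j * z ^+ j @[n --> \oo] --> S.
    elim: k {hk} => [|k [S hS]].
      by exists 0; under eq_fun do rewrite big_ord0; exact: cvg_cst.
    have [l hl] := hc k; exists (S + l * z ^+ k).
    under eq_fun do rewrite big_ord_recr /=.
    exact: (cvgCD hS (cvgCZr hl)).
  have e4 : 0 < e / 4 by rewrite divr_gt0.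
  move/cvgC_ltP: hS => /(_ _ e4)[N _ hN]; exists N => m n Nm Nn.
  have h1 := hN m Nm; have h2 := hN n Nn; rewrite /= in h1 h2.
  have h3 := rem (s m) k; have h4 := rem (s n) k.
  move: (\sum_(j < k) _) (\sum_(j < k) _) h1 h2 h3 h4 => b a h1 h2 h3 h4.
  rewrite (_ : u (s m) z - u (s n) z = ((u (s m) z - a) + (a - S)) - ((u (s n) z - b) + (b - S))); last by ring.
  have k1 := cmodB ((u (s m) z - a) + (a - S)) ((u (s n) z - b) + (b - S)).
  have k2 := cmodD (u (s m) z - a) (a - S); have k3 := cmodD (u (s n) z - b) (b - S).
  lra.
have cv' z : exists l : C, cmod z < 1 -> u (s n) z @[n --> \oo] --> l.
  by have [/cv[l hl]|h] := pselect (cmod z < 1); [exists l | exists 0].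
have [f hf] := choice cv'; exists s, f; split; [exact: hs | | exact: hf].
exact: (holo_lim (fun n => hu (s n)) (@loc_bounded_subseq u s bu) hf).
Qed.

End local_estimates.

(** * Harmonic majorants and Littlewood subordination *)

Section fatou_rint.
Context {R : realType}.
Implicit Types (a b B : R).

Lemma limn_einf_le (u : (\bar R)^nat) (l : \bar R) :
  (forall n, u n <= l)%E -> (limn_einf u <= l)%E.
Proof.
move=> h; rewrite limn_einf_lim; apply: lime_le; first exact: is_cvg_einfs.
by apply: nearW => n; apply: le_trans (h n); apply: ereal_inf_lbound; exists n => /=.
Qed.

Lemma fatou_le a b (u : nat -> R -> R) B :
  (forall n, bmeas a b (u n)) -> (forall n t, a <= t <= b -> 0 <= u n t) ->
  (forall n, rint a b (u n) <= B) ->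
  (\int[@lebesgue_measure R]_(t in `[a, b]) limn_einf (fun n => (u n t)%:E) <= B%:E)%E.
Proof.
move=> bu u0 hB; apply: le_trans (fatou _ _ _ _) _ => //.
  by move=> n; apply/measurable_EFinP; case: (bu n).
by apply: limn_einf_le => n; rewrite -EFin_rint // lee_fin.
Qed.

Lemma rint_fatou a b (u : nat -> R -> R) (f : R -> R) B :
  (forall n, bmeas a b (u n)) -> bmeas a b f ->
  (forall n t, a <= t <= b -> 0 <= u n t) ->
  (forall t, a <= t <= b -> u n t @[n --> \oo] --> f t) ->
  (forall n, rint a b (u n) <= B) -> rint a b f <= B.
Proof.
move=> bu bf u0 ul hB; rewrite -lee_fin EFin_rint //.
apply: le_trans (fatou_le bu u0 hB); rewrite le_eqVlt; apply/orP; left; apply/eqP.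
apply: eq_integral => t; rewrite inE /= in_itv /= => /ul h.
have h' : (u n t)%:E @[n --> \oo] --> (f t)%:E.
  by apply: cvg_EFin; [exact: nearW | exact: h].
by have [-> _] := cvg_limn_einf_sup h'.
Qed.

End fatou_rint.

Section majorant.
Context {R : realType}.
Local Notation C := (Cplx R).
Implicit Types (b : nat -> C) (z w : C).

Definition shift_seq {T : Type} (b : nat -> T) n := b n.+1.

Definition tpoly b N z : C := \sum_(n < N) b n * z ^+ n.

Lemma tpolyS b N z : tpoly b N.+1 z = b 0%N + z * tpoly (shift_seq b) N z.
Proof.
rewrite /tpoly big_ord_recl /= expr0 mulr1; congr (_ + _); rewrite mulr_sumr.
by apply: eq_bigr => i _; rewrite /bump /= add1n exprS /shift_seq mulrCA.
Qed.

(* Its real part is the harmonic function with boundary values |tpoly b N|^2. *)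
Fixpoint hmaj b N z : C := if N is M.+1 then
  cR (cmod (b 0%N) ^+ 2) + 2 * (cconj (b 0%N) * (z * tpoly (shift_seq b) M z))
    + hmaj (shift_seq b) M z else 0.

Lemma cmod_sqrD z w : cmod (z + w) ^+ 2 = cmod z ^+ 2 + 2 * cre (cconj z * w) + cmod w ^+ 2.
Proof. by rewrite !sqr_cmod !cE; ring. Qed.

Lemma cre_natM n z : cre (n%:R * z) = n%:R * cre z.
Proof. by rewrite -cRnat !cE mul0r subr0. Qed.

(** Expanding [|b 0 + z p|^2] produces the two explicit terms of [hmaj] and [|z|^2 |p|^2]; the
    factor [|z|^2 <= 1] is dropped before recursing on [p]. On the unit circle nothing is lost. *)
Lemma hmaj_re b N z : cmod z <= 1 -> cmod (tpoly b N z) ^+ 2 <= cre (hmaj b N z).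
Proof.
move=> z1; elim: N b => [|N IH] b; first by rewrite /tpoly big_ord0 cmod0 expr0n /= cE.
rewrite tpolyS cmod_sqrD /= 2!creD cre_natM cre_cR lerD2l (le_trans _ (IH _)) //.
by rewrite cmodM exprMn ler_piMl ?exprn_ge0 // exprn_ile1.
Qed.

Lemma hmaj_re_circle b N z : cmod z = 1 -> cre (hmaj b N z) = cmod (tpoly b N z) ^+ 2.
Proof.
move=> z1; elim: N b => [|N IH] b; first by rewrite /tpoly big_ord0 cmod0 expr0n /= cE.
by rewrite tpolyS cmod_sqrD /= 2!creD cre_natM cre_cR IH cmodM z1 mul1r.
Qed.

Lemma hmaj0 b N : hmaj b N 0 = cR (\sum_(n < N) cmod (b n) ^+ 2).
Proof.
elim: N b => [|N IH] b; first by rewrite big_ord0.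
by rewrite /= IH big_ord_recl /= cRD mul0r !mulr0 addr0; congr (_ + cR _).
Qed.

Lemma hmaj_bound b N z : cmod z < 1 ->
  cmod (hmaj b N z) <= 2 / (1 - cmod z) * \sum_(n < N) cmod (b n) ^+ 2.
Proof.
move=> z1; set r := cmod z; have r0 : 0 <= r by exact: cmod_ge0.
have r1 : 0 < 1 - r by rewrite subr_gt0.
pose s := r / (1 - r).
have s0 : 0 <= s by rewrite divr_ge0 // ltW.
have sE : s * (1 - r) = r by rewrite /s divfK // gt_eqF.
have D : 1 + 2 * s <= 2 / (1 - r).
  rewrite ler_pdivlMr // mulrDl mul1r -mulrA sE; lra.
(* Cross terms are split by [2 |b n| |b m| <= |b n|^2 + |b m|^2]. Later indices then contribute
   [r + r^2 + ... <= s] to the weight of [|b n|^2], and earlier ones [r + ... + r^n = s - s r^n].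
   This exact weight makes the induction close. *)
suff H : cmod (hmaj b N z) <= \sum_(n < N) cmod (b n) ^+ 2 * (1 + 2 * s - s * r ^+ n).
  rewrite (le_trans H) // mulr_sumr; apply: ler_sum => i _.
  rewrite mulrC ler_wpM2r ?exprn_ge0 // (le_trans _ D) // lerBlDr lerDl.
  by rewrite mulr_ge0 // exprn_ge0.
elim: N b => [|N IH] b; first by rewrite big_ord0 cmod0.
rewrite /= big_ord_recl /= expr0 mulr1.
have P : cmod (2 * (cconj (b 0%N) * (z * tpoly (shift_seq b) N z))) <=
    \sum_(n < N) (cmod (b 0%N) ^+ 2 + cmod (b n.+1) ^+ 2) * r ^+ n.+1.
  rewrite !cmodM cmod_conj -/r.
  have -> : cmod (2 : C) = 2 by rewrite -(cRnat 2) cmod_cR ger0_norm.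
  have h : cmod (tpoly (shift_seq b) N z) <= \sum_(n < N) cmod (b n.+1) * r ^+ n.
    rewrite (le_trans (cmod_sum _ _ _)) //; apply: ler_sum => i _.
    by rewrite cmodM cmodX.
  apply: (@le_trans _ _ (2 * (cmod (b 0%N) * (r * \sum_(n < N) cmod (b n.+1) * r ^+ n)))).
    by rewrite ler_wpM2l // ler_wpM2l // ler_wpM2l.
  rewrite !mulr_sumr; apply: ler_sum => i _; rewrite [r ^+ i.+1]exprS.
  have -> : 2 * (cmod (b 0%N) * (r * (cmod (b i.+1) * r ^+ i))) =
    (2 * cmod (b 0%N) * cmod (b i.+1)) * (r * r ^+ i) by ring.
  rewrite ler_wpM2r ?mulr_ge0 ?exprn_ge0 //.
  by have := sqr_ge0 (cmod (b 0%N) - cmod (b i.+1)); rewrite sqrrB; lra.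
have Q : \sum_(n < N) cmod (b 0%N) ^+ 2 * r ^+ n.+1 <= cmod (b 0%N) ^+ 2 * s.
  rewrite -mulr_sumr ler_wpM2l ?exprn_ge0 // /s.
  under eq_bigr do rewrite exprS; rewrite -mulr_sumr ler_wpM2l // geo_le //.
  by rewrite r0 /= -subr_gt0.
have {}IH := IH (shift_seq b).
rewrite (le_trans (cmodD _ _)) // (le_trans (lerD (cmodD _ _) IH)) //.
rewrite cmod_cR ger0_norm ?exprn_ge0 //.
have -> : \sum_(n < N) cmod (b (bump 0 n)) ^+ 2 * (1 + 2 * s - s * r ^+ bump 0 n) =
  \sum_(n < N) cmod (shift_seq b n) ^+ 2 * (1 + 2 * s - s * r ^+ n) +
  \sum_(n < N) cmod (b n.+1) ^+ 2 * r ^+ n.+1.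
  rewrite -big_split /=; apply: eq_bigr => i _; rewrite /bump /= add1n /shift_seq [r ^+ i.+1]exprS.
  have -> : s * (r * r ^+ i) = (s - s * (1 - r)) * r ^+ i by ring.
  by rewrite sE; ring.
move: P; under eq_bigr do rewrite mulrDl; rewrite big_split /=.
move: Q; lra.
Qed.

Lemma derivableCD (f g : C -> C) z : derivable f z 1 -> derivable g z 1 ->
  derivable (fun w => f w + g w) z 1.
Proof. by move=> hf hg; exact: (derivableD hf hg). Qed.

Lemma derivableCM (f g : C -> C) z : derivable f z 1 -> derivable g z 1 ->
  derivable (fun w => f w * g w) z 1.
Proof. by move=> hf hg; exact: (derivableM hf hg). Qed.

Lemma holo_tpoly b N z : derivable (tpoly b N) z 1.
Proof.
elim: N b => [|N IH] b.
  rewrite (_ : tpoly b 0 = fun=> 0); first exact: derivableC_cst.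
  by apply/funext => w; rewrite /tpoly big_ord0.
rewrite (_ : tpoly b N.+1 = fun w => b 0%N + w * tpoly (shift_seq b) N w).
  apply: derivableCD; first exact: derivableC_cst.
  by apply: derivableCM; [exact: derivableC_id | exact: IH].
by apply/funext => w; rewrite tpolyS.
Qed.

Lemma holo_hmaj b N z : derivable (hmaj b N) z 1.
Proof.
elim: N b => [|N IH] b; first exact: derivableC_cst.
apply: derivableCD; last exact: (IH (shift_seq b)).
apply: derivableCD; first exact: derivableC_cst.
apply: derivableCM; first exact: derivableC_cst.
apply: derivableCM; first exact: derivableC_cst.
by apply: derivableCM; [exact: derivableC_id | exact: holo_tpoly].
Qed.

End majorant.

(** * Littlewood subordination *)

Section littlewood.
Context {R : realType}.
Local Notation C := (Cplx R).
Implicit Types (f g phi : C -> C).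

Lemma holo_comp f phi : holo_disk f -> self_map phi -> holo_disk (f \o phi).
Proof.
move=> hf [hphi hd] z z1; apply: derivable_comp; first exact: hphi.
by apply: hf; exact: hd.
Qed.

(** [hmaj b N] composed with [phi] is holomorphic, so its mean over a circle is its value at 0,
    which [hmaj_bound] estimates at the point [phi 0]; its real part dominates the integrand. *)
Lemma littlewood_poly phi (b : nat -> C) N (r : R) : self_map phi -> 0 <= r < 1 ->
  mean2 (tpoly b N \o phi) r <= 2 / (1 - cmod (phi 0)) * \sum_(n < N) cmod (b n) ^+ 2.
Proof.
move=> sm hr; have [hphi hd] := sm; have /andP[r0 r1] := hr.
have hP : holo_disk (tpoly b N \o phi).
  by apply: (holo_comp _ sm) => z _; exact: holo_tpoly.
have hH : holo_disk (hmaj b N \o phi).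
  by apply: (holo_comp _ sm) => z _; exact: holo_hmaj.
have d0 : udisk (0 : C) by rewrite /udisk /= cmod0.
have p0 : cmod (phi 0) < 1 by exact: (hd 0).
apply: le_trans (hmaj_bound b N p0).
apply: (@le_trans _ _ (cre (hmaj b N (phi 0)))); last first.
  by rewrite (le_trans (ler_norm _)) // norm_cre.
rewrite -[hmaj b N (phi 0)]/((hmaj b N \o phi) 0) -(holo_mean hH hr).
have bH := circle_cbmeas 0 1 hH hr; have bP := circle_cbmeas 0 1 hP hr.
rewrite cre_cint; apply: le_rint; [exact: bmeas_sqrcmod | by case: bH |].
move=> t _ /=; apply: hmaj_re; apply: ltW; apply: hd.
by rewrite /udisk /= cmod_circle ger0_norm.
Qed.

Definition lw_const phi : R := 2 / (1 - cmod (phi 0)).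

Lemma lw_const_gt0 phi : self_map phi -> 0 < lw_const phi.
Proof.
move=> [_ hd]; rewrite divr_gt0 // subr_gt0; apply: (hd 0).
by rewrite /udisk /= cmod0.
Qed.

Theorem littlewood phi f (B : R) : self_map phi -> holo_disk f -> h2le f B ->
  h2le (f \o phi) (lw_const phi * B).
Proof.
move=> sm hf hB r hr; have [hphi hd] := sm; have /andP[r0 r1] := hr.
have bcirc N : cbmeas 0 1 (fun t => (tpoly (tcoef f) N \o phi) (cR r * expi t)).
  have hP : holo_disk (tpoly (tcoef f) N) by move=> z _; exact: holo_tpoly.
  exact: (circle_cbmeas 0 1 (holo_comp hP sm) hr).
have bf := circle_cbmeas 0 1 (holo_comp hf sm) hr.
apply: (@rint_fatou _ 0 1 (fun N t => cmod ((tpoly (tcoef f) N \o phi) (cR r * expi t)) ^+ 2)).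
- by move=> N; exact: bmeas_sqrcmod (bcirc N).
- exact: bmeas_sqrcmod bf.
- by move=> N t _; rewrite exprn_ge0.
- move=> t _; apply: cvg_sqr; apply: cvg_cmod; apply: (taylor hf).
  by apply: hd; rewrite /udisk /= cmod_circle ger0_norm.
- move=> N; apply: le_trans (littlewood_poly (tcoef f) N sm hr) _.
  rewrite -/(lw_const phi) ler_wpM2l //; first exact: ltW (lw_const_gt0 sm).
  exact: (h2le_coef (taylor hf) hB).
Qed.

End littlewood.

(** * Power series with bounded coefficients and norm estimates *)

Section power_series.
Context {R : realType}.
Local Notation C := (Cplx R).
Implicit Types (f g : C -> C) (b : nat -> C) (z w : C) (M B : R).

Lemma tpoly_bound b M N z : (forall n, cmod (b n) <= M) -> cmod z < 1 ->
  cmod (tpoly b N z) <= M / (1 - cmod z).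
Proof.
move=> hM z1; have M0 : 0 <= M by exact: le_trans (hM 0%N).
rewrite (le_trans (cmod_sum _ _ _)) //.
apply: (@le_trans _ _ (M * \sum_(n < N) cmod z ^+ n)).
  rewrite mulr_sumr; apply: ler_sum => i _; rewrite cmodM cmodX.
  by rewrite ler_wpM2r // exprn_ge0.
by rewrite ler_wpM2l // geo_le // cmod_ge0.
Qed.

Lemma tpoly_loc_bounded b M : (forall n, cmod (b n) <= M) -> loc_bounded (tpoly b).
Proof.
move=> hM r /andP[r0 r1]; have M0 : 0 <= M by exact: le_trans (hM 0%N).
exists (M / (1 - r)) => N z zr; have z1 := le_lt_trans zr r1.
rewrite (le_trans (tpoly_bound N hM z1)) // ler_wpM2l // lef_pV2 ?posrE ?subr_gt0 //.
by rewrite lerD2l lerN2.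
Qed.

Lemma pser_holo b M : (forall n, cmod (b n) <= M) -> exists2 f, holo_disk f & pser f b.
Proof.
move=> hM; have M0 : 0 <= M by exact: le_trans (hM 0%N).
have cv z : exists l : C, cmod z < 1 -> tpoly b N z @[N --> \oo] --> l.
  have [z1|h] := pselect (cmod z < 1); last by exists 0.
  suff [l hl] : exists l : C, tpoly b N z @[N --> \oo] --> l by exists l.
  apply: cauchy_cplx => e e0.
  have tail m n : (m <= n)%N -> cmod (tpoly b n z - tpoly b m z) <= M / (1 - cmod z) * cmod z ^+ m.
    move=> mn; rewrite /tpoly -(subnKC mn) big_split_ord /= addrAC subrr add0r.
    rewrite (le_trans (cmod_sum _ _ _)) //.
    apply: (@le_trans _ _ (M * cmod z ^+ m * \sum_(k < n - m) cmod z ^+ k)).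
      rewrite mulr_sumr; apply: ler_sum => i _; rewrite cmodM cmodX exprD mulrA.
      by rewrite ler_wpM2r ?exprn_ge0 // ler_wpM2r ?exprn_ge0.
    rewrite mulrAC ler_wpM2r ?exprn_ge0 // ler_wpM2l //.
    by rewrite geo_le // cmod_ge0.
  have h : M / (1 - cmod z) * cmod z ^+ k @[k --> \oo] --> M / (1 - cmod z) * 0.
    by apply: cvgMr; apply: cvg_expr; rewrite ger0_norm.
  rewrite mulr0 in h; move/cvgrPdist_lt: h => /(_ _ e0)[N _ hN]; exists N => m n Nm Nn.
  wlog mn : m n Nm Nn / (m <= n)%N.
    move=> H; have [mn|nm] := leqP m n; first exact: H.
    by rewrite cmodBC; apply: H => //; exact: ltnW.
  rewrite cmodBC (le_lt_trans (tail _ _ mn)) //; have := hN m Nm.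
  by rewrite /= sub0r normrN; apply: le_lt_trans; rewrite ler_norm.
have [f hf] := choice cv; exists f; last exact: hf.
apply: (holo_lim _ (tpoly_loc_bounded hM) hf) => N z _; exact: holo_tpoly.
Qed.

(** The division by [z ^+ m] is done on coefficients, which settles the origin and shows by
    [h2le_shift] that the quotient has no larger norm. *)
Lemma holo_shift f M m : holo_disk f -> (forall n, cmod (tcoef f n) <= M) ->
  exists2 q, holo_disk q & pser q (fun k => tcoef f (m + k)%N) /\
    forall z, cmod z < 1 -> f z = tpoly (tcoef f) m z + z ^+ m * q z.
Proof.
move=> hf hM; have [q hq sq] := @pser_holo (fun k => tcoef f (m + k)%N) M (fun k => hM _).
exists q => //; split=> // z z1.
have h1 := @cvg_ge_idx _ (fun N => tpoly (tcoef f) N z) (f z) (addn m) _ (taylor hf z1).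
have {}h1 : tpoly (tcoef f) (m + N) z @[N --> \oo] --> f z.
  by apply: h1; apply: nearW => n; exact: leq_addl.
have h2 : tpoly (tcoef f) m z + z ^+ m * tpoly (fun k => tcoef f (m + k)%N) N z @[N --> \oo] -->
    tpoly (tcoef f) m z + z ^+ m * q z.
  by apply: cvgCD; [exact: cvg_cst | apply: cvgCZl; exact: sq].
have E : (fun N => tpoly (tcoef f) (m + N) z) = (fun N => tpoly (tcoef f) m z +
    z ^+ m * tpoly (fun k => tcoef f (m + k)%N) N z).
  apply/funext => N; rewrite /tpoly big_split_ord /=; congr (_ + _).
  by rewrite mulr_sumr; apply: eq_bigr => i _; rewrite exprD mulrCA.
rewrite E in h1; exact: (cvg_unique _ h1 h2).
Qed.

Lemma h2le_coef_bound f B : holo_disk f -> h2le f B -> forall n, cmod (tcoef f n) <= Num.sqrt B.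
Proof.
move=> hf hB n; rewrite -[leLHS]ger0_norm // -sqrtr_sqr ler_sqrt ?(h2le_ge0 hB) //.
have := h2le_coef (taylor hf) hB n.+1; rewrite big_ord_recr /=; apply: le_trans.
by rewrite lerDr; apply: sumr_ge0 => j _; rewrite exprn_ge0.
Qed.

Lemma h2le_shift f B m q : holo_disk f -> h2le f B ->
  pser q (fun k => tcoef f (m + k)%N) -> h2le q B.
Proof.
move=> hf hB hq; apply: (coef_h2le hq) => N.
apply: le_trans (h2le_coef (taylor hf) hB (m + N)%N).
by rewrite big_split_ord /= lerDr; apply: sumr_ge0 => j _; rewrite exprn_ge0.
Qed.

Lemma h2le_loc_bounded (u : nat -> C -> C) B : (forall n, holo_disk (u n)) ->
  (forall n, h2le (u n) B) -> loc_bounded u.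
Proof.
move=> hu hB r /andP[r0 r1]; exists (Num.sqrt B / (1 - r)) => n z zr.
have z1 := le_lt_trans zr r1.
rewrite (le_trans (h2le_pt (taylor (hu n)) (hB n) z1)) //.
by rewrite ler_wpM2l ?sqrtr_ge0 // lef_pV2 ?posrE ?subr_gt0 // lerD2l lerN2.
Qed.

Lemma h2le_lim (u : nat -> C -> C) f B : (forall n, holo_disk (u n)) -> holo_disk f ->
  (forall n, h2le (u n) B) -> (forall z, cmod z < 1 -> u n z @[n --> \oo] --> f z) -> h2le f B.
Proof.
move=> hu hf hB hl r hr; have /andP[r0 r1] := hr.
apply: (@rint_fatou _ 0 1 (fun n t => cmod (u n (cR r * expi t)) ^+ 2)).
- by move=> n; exact: bmeas_sqrcmod (circle_cbmeas 0 1 (hu n) hr).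
- exact: bmeas_sqrcmod (circle_cbmeas 0 1 hf hr).
- by move=> n t _; rewrite exprn_ge0.
- move=> t _; apply: cvg_sqr; apply: cvg_cmod; apply: hl.
  by rewrite cmod_circle ger0_norm.
- by move=> n; exact: (hB n _ hr).
Qed.

Lemma h2le_mono f g B : holo_disk f -> holo_disk g ->
  (forall z, cmod z < 1 -> cmod (f z) <= cmod (g z)) -> h2le g B -> h2le f B.
Proof.
move=> hf hg fg hB r hr; have /andP[r0 r1] := hr; apply: le_trans (hB r hr).
apply: le_rint.
- exact: bmeas_sqrcmod (circle_cbmeas 0 1 hf hr).
- exact: bmeas_sqrcmod (circle_cbmeas 0 1 hg hr).
- by move=> t _; rewrite ler_sqr ?nnegrE // fg // cmod_circle ger0_norm.
Qed.

Lemma h2le_cst1 f : holo_disk f -> (forall z, cmod z < 1 -> cmod (f z) <= 1) -> h2le f 1.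
Proof.
move=> hf f1 r hr; have /andP[r0 r1] := hr.
rewrite -[leRHS]mulr1 -[X in _ * X](subr0 1) -rint_cst //; apply: le_rint.
- exact: bmeas_sqrcmod (circle_cbmeas 0 1 hf hr).
- exact: bmeas_cst.
- by move=> t _; rewrite exprn_ile1 // f1 // cmod_circle ger0_norm.
Qed.

Lemma holoM f g : holo_disk f -> holo_disk g -> holo_disk (fun z => f z * g z).
Proof. by move=> hf hg z z1; apply: derivableCM; [exact: hf | exact: hg]. Qed.

Lemma holoB f g : holo_disk f -> holo_disk g -> holo_disk (fun z => f z - g z).
Proof. by move=> hf hg z z1; exact: (derivableB (hf z z1) (hg z z1)). Qed.

Lemma holoX f n : holo_disk f -> holo_disk (fun z => f z ^+ n).
Proof. by move=> hf z z1; apply: derivableXn; exact: hf. Qed.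

Lemma holo_sum (I : Type) (s : seq I) (F : I -> C -> C) : (forall i, holo_disk (F i)) ->
  holo_disk (fun z => \sum_(i <- s) F i z).
Proof.
move=> hF z z1; elim: s => [|i s IH].
  under eq_fun do rewrite big_nil; exact: derivableC_cst.
under eq_fun do rewrite big_cons; exact: (derivableCD (hF i z z1) IH).
Qed.

End power_series.

(** * The weight *)

Section weight.
Context {R : realType}.
Local Notation C := (Cplx R).
Variable phi : C -> C.
Hypothesis sm : self_map phi.

Let hphi : holo_disk phi. Proof. by case: sm. Qed.
Let dphi z : cmod z < 1 -> cmod (phi z) < 1. Proof. by case: sm => _ h /h. Qed.

Lemma cvg_cre_sum (I : finType) (P : pred I) (u : nat -> I -> R) (l : I -> R) :
  (forall i, u n i @[n --> \oo] --> l i) ->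
  \sum_(i | P i) u n i @[n --> \oo] --> \sum_(i | P i) l i.
Proof. by move=> h; apply: cvg_big => [|i _]; [exact: add_continuous | exact: h]. Qed.

Lemma exists_weight : (forall e : R, 0 < e -> exists n, h2le (fun z => phi z ^+ n) e) ->
  exists2 w : C -> C, holo_disk w & [/\ forall z, cmod z < 1 -> cmod (w z) <= 1, w 0 != 0 &
    forall e : R, 0 < e -> exists N, forall z, cmod z < 1 -> cmod (w z) * cmod (phi z) ^+ N <= e].
Proof.
move=> ha.
(* Summable bounds on the squared norms keep the majorants below bounded when they are added up. *)
have hk k : exists n, h2le (fun z => phi z ^+ n) ((2^-1 : R) ^+ k).
  by apply: ha; rewrite exprn_gt0 // invr_gt0.
have [nk hnk] := choice hk.
pose b k := tcoef (fun z => phi z ^+ nk k).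
have hX k : holo_disk (fun z => phi z ^+ nk k) by exact: holoX.
(* The number of powers and the length of their truncations grow together. By [hmaj_bound] the sum
   is locally bounded, so Montel supplies the limit [h]. *)
pose H N z := \sum_(k < N) hmaj (b k) N z.
have hH N : holo_disk (H N).
  by apply: holo_sum => i z _; exact: holo_hmaj.
have bH : loc_bounded H.
  move=> r /andP[r0 r1]; exists (4 / (1 - r)) => N z zr; have z1 := le_lt_trans zr r1.
  rewrite (le_trans (cmod_sum _ _ _)) //.
  apply: (@le_trans _ _ (\sum_(k < N) 2 / (1 - cmod z) * (2^-1) ^+ k)).
    apply: ler_sum => k _; rewrite (le_trans (hmaj_bound _ _ z1)) // ler_wpM2l //.
      by rewrite divr_ge0 // subr_ge0 ltW.
    exact: (h2le_coef (taylor (hX k)) (hnk k)).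
  rewrite -mulr_sumr.
  have g2 : \sum_(k < N) (2^-1 : R) ^+ k <= 2.
    have h2 : 0 <= (2^-1 : R) < 1 by apply/andP; split; lra.
    rewrite (le_trans (geo_le N h2)) // -[leRHS]invrK lef_pV2 ?posrE ?invr_gt0 //; lra.
  apply: (@le_trans _ _ (2 / (1 - cmod z) * 2)).
    by rewrite ler_wpM2l // divr_ge0 // subr_ge0 ltW.
  rewrite mulrAC -natrM ler_wpM2l // lef_pV2 ?posrE ?subr_gt0 //.
  by rewrite lerD2l lerN2.
have [s [h [hs hh hl]]] := montel hH bH.
(* Only the first [K] majorants are kept, the others having nonnegative real part. Each kept one
   dominates a truncation that converges to [phi z ^+ nk k]. *)
have reh K z : cmod z < 1 -> \sum_(k < K) cmod (phi z) ^+ (2 * nk k) <= cre (h z).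
  move=> z1.
  have c1 : \sum_(k < K) cmod (tpoly (b k) (s n) z) ^+ 2 @[n --> \oo] -->
      \sum_(k < K) cmod (phi z ^+ nk k) ^+ 2.
    apply: cvg_cre_sum => k; apply: cvg_sqr; apply: cvg_cmod.
    exact: (@cvg_subseq _ (fun n => tpoly (b k) n z) _ _ hs (taylor (hX k) z1)).
  have c2 : cre (H (s n) z) @[n --> \oo] --> cre (h z) by apply: cvg_cre; exact: hl.
  have -> : \sum_(k < K) cmod (phi z) ^+ (2 * nk k) = \sum_(k < K) cmod (phi z ^+ nk k) ^+ 2.
    by apply: eq_bigr => k _; rewrite cmodX -exprM mulnC.
  apply: (ler_cvg_to c1 c2); exists K => // n /= Kn.
  have Ks : (K <= s n)%N by exact: leq_trans (subseq_idx_ge hs n).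
  rewrite /H cre_sum -(subnKC Ks) big_split_ord /= subnKC //.
  rewrite -[leLHS]addr0 lerD //.
    by apply: ler_sum => k _; apply: hmaj_re; exact: ltW.
  apply: sumr_ge0 => k _; apply: le_trans (hmaj_re _ _ (ltW z1)).
  by rewrite exprn_ge0.
exists (fun z => cexp (- h z)).
  move=> z z1; have [A hA] := derivable_cder (hh z z1).
  have hN : cder (fun w => - h w) z (- A).
    move=> e /hA[d d0 hd]; exists d => // w /hd.
    by rewrite -cmodN !opprD !opprK mulNr opprK.
  exact: cder_derivable (cder_comp hN (cder_cexp _)).
split.
- move=> z z1; rewrite cmod_cexp creN -expR0 ler_expR oppr_le0.
  by have := reh 0%N z z1; rewrite big_ord0.
- by rewrite -cmod_gt0 cmod_cexp expR_gt0.
move=> e e0.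
have [K hK] : exists K : nat, expR (- (K%:R / 2)) <= e.
  exists (Num.trunc (2 / e)).+1.
  rewrite expRN -[leRHS]invrK lef_pV2 ?posrE ?invr_gt0 ?expR_gt0 //.
  apply: le_trans (expR_ge1Dx _).
  have : 2 / e < (Num.trunc (2 / e)).+1%:R by apply: truncnS_gt.
  set x := (Num.trunc (2 / e)).+1%:R => hx; have h1 : e^-1 <= x / 2.
    by rewrite ler_pdivlMr // mulrC ltW.
  by rewrite (le_trans h1) // lerDr.
pose m := (\sum_(k < K) nk k)%N.
have [L hL] : exists L : nat, (2^-1 : R) ^+ L <= e.
  have h2 : `|2^-1 : R| < 1 by rewrite ger0_norm ?invr_ge0 //; lra.
  have /cvgrPdist_lt/(_ _ e0)[L _ hL] := cvg_expr h2.
  exists L; have := hL L (leqnn L).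
  by rewrite /= sub0r normrN ger0_norm ?exprn_ge0 ?invr_ge0 // => /ltW.
exists (2 * m * L)%N => z z1; have p1 := dphi z1.
have p1' : cmod (phi z) <= 1 by exact: ltW.
have r0 := reh 0%N z z1; rewrite big_ord0 in r0.
(* Dichotomy at each point. If [|phi z|^(2m) < 1/2], its [L]-th power is at most [e]. Otherwise, as
   [m] exceeds or equals each [nk k] with [k < K], the first [K] terms of the sum are at least 1/2
   and [|w z| <= exp (- K / 2) <= e]. *)
have [pm|pm] := lerP (2^-1 : R) (cmod (phi z) ^+ (2 * m)); last first.
  rewrite -[leRHS]mul1r ler_pM ?exprn_ge0 //.
    by rewrite cmod_cexp creN -expR0 ler_expR oppr_le0.
  rewrite exprM (le_trans _ hL) // lerXn2r ?nnegrE ?exprn_ge0 ?invr_ge0 //.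
  exact: ltW.
rewrite -[leRHS]mulr1 ler_pM ?exprn_ge0 ?exprn_ile1 //.
rewrite cmod_cexp creN (le_trans _ hK) // ler_expR lerN2 (le_trans _ (reh K z z1)) //.
rewrite -[K in K%:R](card_ord K) -sum1_card natr_sum mulr_suml; apply: ler_sum => k _.
rewrite mul1r (le_trans pm) // ler_wiXn2l // leq_mul2l /= /m (bigD1 k) //=.
exact: leq_addr.
Qed.

Lemma cvg_ereal0 (u : nat -> \bar R) : (forall n, 0 <= u n)%E ->
  (forall e : R, 0 < e -> \forall n \near \oo, (u n <= e%:E)%E) -> u n @[n --> \oo] --> 0%E.
Proof.
move=> u0 h; apply/fine_cvgP; split.
  apply: filterS (h 1 ltr01) => n hn.
  by rewrite ge0_fin_numE // (le_lt_trans hn) // ltry.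
apply/cvgrPdist_le => e e0; apply: filterS (h e e0) => n hn.
have fn : u n \is a fin_num by rewrite ge0_fin_numE // (le_lt_trans hn) // ltry.
rewrite /= sub0r normrN ger0_norm; last by rewrite fine_ge0.
by rewrite -lee_fin fineK.
Qed.

Lemma ereal0_cvg (u : nat -> \bar R) : u n @[n --> \oo] --> 0%E ->
  forall e : R, 0 < e -> \forall n \near \oo, (u n <= e%:E)%E.
Proof.
move=> /fine_cvgP[hf /cvgrPdist_lt h] e e0; apply: filterS2 hf (h e e0) => n fn.
rewrite /= sub0r normrN => /ltW hn; rewrite -(fineK fn) lee_fin.
exact: le_trans (ler_norm _) hn.
Qed.

Lemma H2norm2_ge0 (f : C -> C) : (0 <= H2norm2 f)%E.
Proof.
apply: (@le_trans _ _ (intmean2 f 0)).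
  by apply: integral_ge0 => t _; rewrite lee_fin exprn_ge0.
by apply: ereal_sup_ubound; exists 0 => //=; rewrite in_itv /= lexx ltr01.
Qed.

Lemma inH2_fin (f : C -> C) : inH2 f -> h2le f (fine (H2norm2 f)).
Proof.
move=> [hf h]; apply: (H2norm2_le _ hf).1.
by rewrite fineK // ge0_fin_numE // H2norm2_ge0.
Qed.

Variable w : C -> C.
Hypothesis hw : holo_disk w.
Hypothesis w1 : forall z, cmod z < 1 -> cmod (w z) <= 1.

Lemma holo_wcomp f : holo_disk f -> holo_disk (wcomp w phi f).
Proof. by move=> hf; exact: (holoM hw (holo_comp hf sm)). Qed.

Lemma h2le_wcomp f (B : R) : holo_disk f -> h2le f B -> h2le (wcomp w phi f) (lw_const phi * B).
Proof.
move=> hf hB; apply: (h2le_mono (holo_wcomp hf) (holo_comp hf sm)).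
  by move=> z z1; rewrite /wcomp cmodM ler_piMl // w1.
exact: littlewood.
Qed.

Lemma weight_bounded : bounded_on_H2 (wcomp w phi).
Proof.
exists (lw_const phi) => f h; have [hf hfin] := h; have hB := inH2_fin h.
have hT := h2le_wcomp hf hB; split.
  by apply/inH2P; split; [exact: holo_wcomp | eexists; exact: hT].
have -> : H2norm2 f = (fine (H2norm2 f))%:E.
  by rewrite fineK // ge0_fin_numE // H2norm2_ge0.
by rewrite -EFinM; exact: (H2norm2_le _ (holo_wcomp hf)).2 hT.
Qed.

(** From [(a + b)^2 <= 2 a^2 + 2 b^2]. Domination by [|f| + |g|] lets it serve both differences and
    the splitting of a function into head and tail. *)
Lemma h2leD f g (A B : R) : holo_disk f -> holo_disk g -> h2le f A -> h2le g B ->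
  forall h, holo_disk h -> (forall z, cmod z < 1 -> cmod (h z) <= cmod (f z) + cmod (g z)) ->
  h2le h (2 * A + 2 * B).
Proof.
move=> hf hg hA hB h hh hfg r hr; have /andP[r0 r1] := hr.
have bf := bmeas_sqrcmod (circle_cbmeas 0 1 hf hr).
have bg := bmeas_sqrcmod (circle_cbmeas 0 1 hg hr).
have bf2 := bmeasM (bmeas_cst 0 1 2) bf; have bg2 := bmeasM (bmeas_cst 0 1 2) bg.
apply: (@le_trans _ _ (2 * mean2 f r + 2 * mean2 g r)); last first.
  by rewrite lerD // ler_wpM2l // ?hA ?hB.
rewrite /mean2 -!rintZ // -rintD //; apply: le_rint.
- exact: bmeas_sqrcmod (circle_cbmeas 0 1 hh hr).
- exact: bmeasD.
move=> t _; set z := cR r * expi t.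
have z1 : cmod z < 1 by rewrite cmod_circle ger0_norm.
have : cmod (h z) ^+ 2 <= (cmod (f z) + cmod (g z)) ^+ 2.
  by rewrite ler_sqr ?nnegrE ?addr_ge0 // hfg.
have h1 := sqr_ge0 (cmod (f z) - cmod (g z)); rewrite sqrrB in h1.
rewrite sqrrD; lra.
Qed.

Hypothesis w2 : forall e : R, 0 < e ->
  exists N, forall z, cmod z < 1 -> cmod (w z) * cmod (phi z) ^+ N <= e.

(** Write [d n = p + z^N q] with [p] of degree below [N]. The coefficients of [p] tend to 0, so [p]
    is uniformly small. The tail becomes [w phi^N (q o phi)], where [|w phi^N| <= eta] and
    Littlewood bounds [q o phi]. *)
Lemma weight_small (d : nat -> C -> C) (B : R) : (forall n, holo_disk (d n)) ->
  (forall n, h2le (d n) B) -> (forall z, cmod z < 1 -> d n z @[n --> \oo] --> (0 : C)) ->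
  forall e : R, 0 < e -> \forall n \near \oo, h2le (wcomp w phi (d n)) e.
Proof.
move=> hd hB dl e e0; have B0 := h2le_ge0 (hB 0%N); have L0 := lw_const_gt0 sm.
pose K := lw_const phi * B; have K0 : 0 <= K by rewrite mulr_ge0 // ltW.
(* Head and tail enter [h2leD] as [2 S^2 + 2 eta^2 K]. Here [eta^2 K <= e / 4], and below
   [S < min (1, e / 4)] gives [S^2 <= e / 4]. *)
pose eta := Num.sqrt (e / (4 * (K + 1))).
have eta0 : 0 < eta by rewrite sqrtr_gt0 divr_gt0 // mulr_gt0 // ltr_wpDl.
have etaK : eta ^+ 2 * K <= e / 4.
  rewrite sqr_sqrtr; last by rewrite divr_ge0 ?(ltW e0) // mulr_ge0 // addr_ge0.
  have -> : e / (4 * (K + 1)) * K = e / 4 * (K / (K + 1)).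
    by field; rewrite gt_eqF // ltr_wpDl.
  rewrite ler_piMr ?divr_ge0 ?(ltW e0) // ler_pdivrMr ?ltr_wpDl // mul1r lerDl //.
have [N hN] := w2 eta0.
have hcoef k : cmod (tcoef (d n) k) @[n --> \oo] --> 0.
  have h := tcoef_cvg (k := k) hd (h2le_loc_bounded hd hB) dl.
  have c0 : tcoef (fun _ : C => 0) k = 0.
    apply/eqP; rewrite -cmod_eq0; apply/eqP/le_anti; rewrite cmod_ge0 andbT.
    apply: holo_bounded_coef => [z _|z _]; last by rewrite cmod0.
    exact: derivableC_cst.
  by rewrite c0 in h; rewrite -(cmod0 (R := R)); exact: cvg_cmod h.
have hS : \sum_(k < N) cmod (tcoef (d n) k) @[n --> \oo] --> 0.
  rewrite -[X in _ --> X](@big1 _ _ +%R 'I_N (index_enum 'I_N) xpredT (fun=> 0)) //.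
  by apply: cvg_cre_sum => k; exact: hcoef.
have e2 : 0 < Num.min 1 (e / 4) by rewrite lt_min ltr01 divr_gt0.
move/cvgrPdist_lt: hS => /(_ _ e2); apply: filterS => n.
rewrite sub0r normrN ger0_norm; last by apply: sumr_ge0.
set S := \sum_(k < N) _; rewrite lt_min => /andP[S1 S2].
have S0 : 0 <= S by apply: sumr_ge0.
have [q hq [pq dq]] := holo_shift N (hd n) (h2le_coef_bound (hd n) (hB n)).
have Bq : h2le q B by exact: (h2le_shift (hd n) (hB n) pq).
have hqp : holo_disk (fun z => cR eta * (q \o phi) z).
  by apply: holoM; [move=> z _; exact: derivableC_cst | exact: holo_comp].
have Lq : h2le (fun z => cR eta * (q \o phi) z) (eta ^+ 2 * K).
  move=> r hr; have := littlewood sm hq Bq hr; rewrite -/K => hK.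
  have b := bmeas_sqrcmod (circle_cbmeas 0 1 (holo_comp hq sm) hr).
  rewrite (le_trans _ (ler_wpM2l (exprn_ge0 2 (ltW eta0)) hK)) // /mean2 -rintZ //.
  rewrite le_eqVlt; apply/orP; left; apply/eqP; apply: eq_rint => t _.
  by rewrite cmodM cmod_cR gtr0_norm // exprMn.
have hS' : holo_disk (fun _ : C => cR S) by move=> z _; exact: derivableC_cst.
have LS : h2le (fun _ : C => cR S) (S ^+ 2).
  move=> r _; rewrite /mean2 rint_cst // subr0 mulr1 cmod_cR ger0_norm //.
have := h2leD hS' hqp LS Lq (holo_wcomp (hd n)).
move=> H; have {}H : h2le (wcomp w phi (d n)) (2 * S ^+ 2 + 2 * (eta ^+ 2 * K)).
  apply: H => z z1; have p1 := dphi z1.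
  rewrite /wcomp dq // mulrDr (le_trans (cmodD _ _)) // lerD //.
    rewrite cmodM cmod_cR ger0_norm // -[leRHS]mul1r ler_pM ?w1 //.
    rewrite (le_trans (cmod_sum _ _ _)) //; apply: ler_sum => i _.
    by rewrite cmodM cmodX ler_piMr // exprn_ile1 // ltW.
  by rewrite !cmodM cmod_cR gtr0_norm // cmodX mulrA ler_wpM2r // hN.
move=> r hr; apply: le_trans (H r hr) _.
have : S ^+ 2 <= S by rewrite expr2 ler_piMr // ltW.
lra.
Qed.

(** Montel plays the part of weak compactness of balls: the extracted sequence converges pointwise,
    and [weight_small] turns this into norm convergence of the images. *)
Lemma weight_compact : compact_on_H2 (wcomp w phi).
Proof.
move=> f hf [B hB].
have hol n : holo_disk (f n) by case: (hf n).
have hB' n : h2le (f n) B by exact: (H2norm2_le _ (hol n)).1 (hB n).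
have [s [g [hs hg hl]]] := montel hol (h2le_loc_bounded hol hB').
have hl' z : cmod z < 1 -> f (s n) z @[n --> \oo] --> g z by exact: hl.
have gB : h2le g B by exact: (h2le_lim (fun n => hol (s n)) hg (fun n => hB' (s n)) hl').
exists s, (wcomp w phi g); split; first exact: hs.
split; first by apply/inH2P; split; [exact: holo_wcomp | eexists; exact: h2le_wcomp hg gB].
pose d n z := f (s n) z - g z.
have hd n : holo_disk (d n) by apply: holoB; [exact: hol | exact: hg].
have dB n : h2le (d n) (2 * B + 2 * B).
  by apply: (h2leD (hol (s n)) hg (hB' _) gB (hd n)) => z _; exact: cmodB.
have dl z : cmod z < 1 -> d n z @[n --> \oo] --> (0 : C).
  by move=> z1; rewrite -(subrr (g z)); apply: cvgCB; [exact: hl' | exact: cvg_cst].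
have E n : (fun z => wcomp w phi (f (s n)) z - wcomp w phi g z) = wcomp w phi (d n).
  by apply/funext => z; rewrite /wcomp /d mulrBr.
under eq_fun do rewrite E; apply: cvg_ereal0 => [n|e e0]; first exact: H2norm2_ge0.
apply: filterS (weight_small hd dB dl e0) => n h.
exact: (H2norm2_le _ (holo_wcomp (hd n))).2 h.
Qed.

End weight.

Section backward.
Context {R : realType}.
Local Notation C := (Cplx R).

Theorem compact_weight (phi : C -> C) : self_map phi ->
  (forall e : R, 0 < e -> exists n, h2le (fun z => phi z ^+ n) e) ->
  exists w : C -> C, inH2 w /\ (exists z, udisk z /\ w z != 0) /\
    bounded_on_H2 (wcomp w phi) /\ compact_on_H2 (wcomp w phi).
Proof.
move=> sm ha; have [w hw [w1 w0 w2]] := exists_weight sm ha; exists w.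
split; first by apply/inH2P; split => //; exists 1; exact: h2le_cst1.
split; first by exists 0; split => //; rewrite /udisk /= cmod0.
by split; [exact: weight_bounded | exact: weight_compact].
Qed.

End backward.

(** * Almost everywhere finiteness of sums *)

Section summable_ae.
Context {R : realType}.
Let mu := @lebesgue_measure R.

Lemma measurable_fun_limn_einf (D : set R) (f : nat -> R -> R) : measurable D ->
  (forall n, measurable_fun D (f n)) ->
  measurable_fun D (fun x => limn_einf (fun n => (f n x)%:E)).
Proof.
move=> mD mf; rewrite (_ : (fun x => _) = (fun x => - limn_esup (fun n => (- f n x)%:E)))%E.
  apply: measurableT_comp => //; apply: (@measurable_fun_limn_esup _ _ _ _ (fun n x => (- f n x)%:E)) => n.
  by apply/measurable_EFinP; exact: measurableT_comp (mf n).
by [].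
Qed.

(** By monotone convergence the full sum has integral at most [B], hence is finite almost
    everywhere. The terms are extended reals because they will be lower limits. *)
Lemma summable_ae (a b : R) (u : nat -> R -> \bar R) (B : R) :
  (forall k, measurable_fun `[a, b] (u k)) ->
  (forall k t, a <= t <= b -> (0 <= u k t)%E) ->
  (forall N, \sum_(k < N) \int[mu]_(t in `[a, b]) u k t <= B%:E)%E ->
  mu.-negligible [set t | a <= t <= b /\
    ~ exists K : R, forall N, (\sum_(k < N) u k t <= K%:E)%E].
Proof.
move=> mf u0 hB; pose g t := (\sum_(0 <= k <oo) u k t)%E.
have u0' k t : `[a, b]%classic t -> (0 <= u k t)%E by rewrite /= in_itv /= => /u0.
have g0 t : `[a, b]%classic t -> (0 <= g t)%E by move=> ht; apply: nneseries_ge0 => n _ _; exact: u0'.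
have mg : measurable_fun `[a, b] g.
  by apply: (@ge0_emeasurable_sum _ _ _ _ u xpredT) => [k t ht _|k _]; [exact: u0' | exact: mf].
have ig : mu.-integrable `[a, b] g.
  apply/integrableP; split => //.
  have -> : (\int[mu]_(x in `[a, b]) `|g x| = \int[mu]_(x in `[a, b]) g x)%E.
    by apply: eq_integral => t; rewrite inE => /g0 h; rewrite gee0_abs.
  apply: (@le_lt_trans _ _ B%:E); last by rewrite ltry.
  rewrite integral_nneseries //; apply: lime_le.
    by apply: is_cvg_nneseries => n _ _; apply: integral_ge0 => t; exact: u0'.
  by apply: nearW => N; rewrite big_mkord; exact: hB.
apply: negligibleS (integrable_ae _ ig) => // t [ht hn] /= hf; apply: hn.
have h : `[a, b]%classic t by rewrite /= in_itv.
exists (fine (g t)) => N; rewrite fineK; last exact: hf.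
have := @nneseries_lim_ge R (u^~ t) xpredT 0 N (fun n _ _ => u0' n t h).
by rewrite big_mkord.
Qed.

End summable_ae.

(** * Compactness implies decay *)

Section forward.
Context {R : realType}.
Local Notation C := (Cplx R).
Implicit Types (f g w phi : C -> C) (r x B : R).

Lemma mean2_mono f r1 r2 : holo_disk f -> 0 <= r1 -> r1 <= r2 -> r2 < 1 ->
  mean2 f r1 <= mean2 f r2.
Proof.
move=> hf r10 r12 r21.
have h1 : 0 <= r1 < 1 by rewrite r10 (le_lt_trans r12).
have h2 : 0 <= r2 < 1 by rewrite (le_trans r10).
apply: (ler_cvg_to (parseval (taylor hf) h1) (parseval (taylor hf) h2)).
apply: nearW => N; apply: ler_sum => i _.
rewrite ler_sqr ?nnegrE ?mulr_ge0 ?exprn_ge0 // ?(le_trans r10) //.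
by rewrite ler_wpM2l // lerXn2r ?nnegrE // (le_trans r10).
Qed.

(** Convexity of the exponential from [1 + x <= exp x] alone: the tangent at [y = u L] lies below
    the graph at 0 and at [L], and the two inequalities are averaged with weights [1 - u] and
    [u]. *)
Lemma expR_chord (u L : R) : 0 <= u <= 1 -> expR (u * L) <= 1 + u * (expR L - 1).
Proof.
move=> /andP[u0 u1]; set y := u * L.
have h1 : expR y * (1 - y) <= 1.
  rewrite -[leRHS](expR0) -(subrr y) expRD ler_wpM2l ?expR_ge0 //.
  exact: expR_ge1Dx.
have h2 : expR y * (1 + (L - y)) <= expR L.
  have -> : expR L = expR y * expR (L - y) by rewrite -expRD addrC subrK.
  by rewrite ler_wpM2l ?expR_ge0 // expR_ge1Dx.
have h3 : (1 - u) * (expR y * (1 - y)) <= 1 - u by rewrite ler_piMr // subr_ge0.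
have h4 : u * (expR y * (1 + (L - y))) <= u * expR L by rewrite ler_wpM2l.
have -> : expR y = (1 - u) * (expR y * (1 - y)) + u * (expR y * (1 + (L - y))).
  by rewrite /y; ring.
lra.
Qed.

Lemma cvg_expR_comp {T : Type} (F : set_system T) {FF : Filter F} (u : T -> R) (l : R) :
  u t @[t --> F] --> l -> expR (u t) @[t --> F] --> expR l.
Proof. by move=> h; exact: (cvg_comp _ _ h (@continuous_expR R l)). Qed.

(* [|G 0|^2 <= mean2 G r] for [G = w exp (x H)], where [Re H = |g|^2] on the circle of
   radius [r]; the exponential is then bounded by its chord on [0, 1]. *)
Lemma jensen_step w g r x : holo_disk w -> holo_disk g ->
  (forall z, cmod z < 1 -> cmod (g z) <= 1) -> 0 < r < 1 -> 0 <= x ->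
  cmod (w 0) ^+ 2 * expR (2 * x * mean2 g r) <=
  mean2 w r + (expR (2 * x) - 1) * mean2 (fun z => w z * g z) r.
Proof.
move=> hw hg g1 hr x0; have /andP[r0 r1] := hr; have hr' : 0 <= r < 1 by rewrite (ltW r0).
have cr0 : cR r != 0 by rewrite -cmod_gt0 cmod_cR gtr0_norm.
(* The coefficients of the dilate of [g] by [r]: rescaling by [r^-1] in [G] brings the circle of
   radius [r] to the unit circle, where [hmaj_re_circle] is an equality. *)
pose c k := tcoef g k * cR r ^+ k.
have pE K t : tpoly c K (expi t) = tpoly (tcoef g) K (cR r * expi t).
  by apply: eq_bigr => i _; rewrite exprMn mulrA.
pose G K z := w z * cexp (cR x * hmaj c K ((cR r)^-1 * z)).
have hG K : holo_disk (G K).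
  apply: (holoM hw) => z z1.
  have [A hA] := derivable_cder (@holo_hmaj _ c K ((cR r)^-1 * z)).
  have h1 := cder_comp (derivable_cder_lin (cR r)^-1 z) hA.
  have h2 := cder_comp h1 (derivable_cder_lin (cR x) _).
  exact: cder_derivable (cder_comp h2 (cder_cexp _)).
have GE K t : cmod (G K (cR r * expi t)) ^+ 2 =
    cmod (w (cR r * expi t)) ^+ 2 * expR (2 * x * cmod (tpoly (tcoef g) K (cR r * expi t)) ^+ 2).
  rewrite /G mulKf // cmodM exprMn cmod_cexp cE cre_cR cim_cR mul0r subr0.
  rewrite hmaj_re_circle ?cmod_expi // pE -expRM_natl; congr (_ * expR _).
  by rewrite mulrA.
(* Parseval with the constant term alone. By [hmaj0] the exponent at the origin is a partial sum of
   the series for [mean2 g r], recovered as [K] grows. *)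
have G0 K : cmod (w 0) ^+ 2 * expR (2 * x * \sum_(n < K) (cmod (tcoef g n) * r ^+ n) ^+ 2) <=
    rint 0 1 (fun t => cmod (w (cR r * expi t)) ^+ 2 *
      expR (2 * x * cmod (tpoly (tcoef g) K (cR r * expi t)) ^+ 2)).
  have := parseval_ge 1 (taylor (hG K)) hr'.
  rewrite big_ord1 expr0 mulr1 (pser0 (taylor (hG K))) /mean2.
  rewrite (eq_rint (fun t _ => GE K t)); apply: le_trans.
  rewrite /G mulr0 hmaj0 cmodM exprMn cmod_cexp cE cre_cR cim_cR mul0r subr0 cre_cR.
  rewrite -expRM_natl mulrA ler_wpM2l ?exprn_ge0 // ler_expR.
  rewrite ler_wpM2l ?mulr_ge0 // le_eqVlt; apply/orP; left; apply/eqP.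
  by apply: eq_bigr => i _; rewrite /c cmodM cmodX cmod_cR gtr0_norm.
have bw := bmeas_sqrcmod (circle_cbmeas 0 1 hw hr').
have [M M0 hM] := pser_partial_bound (taylor hg) hr'.
have [W W0 hW] := cbmeas_bound (circle_cbmeas 0 1 hw hr').
have c1 : cmod (w 0) ^+ 2 * expR (2 * x * \sum_(n < K) (cmod (tcoef g n) * r ^+ n) ^+ 2) @[K --> \oo] -->
    cmod (w 0) ^+ 2 * expR (2 * x * mean2 g r).
  apply: cvgMr; apply: cvg_expR_comp; apply: cvgMr; exact: (parseval (taylor hg) hr').
have c2 : rint 0 1 (fun t => cmod (w (cR r * expi t)) ^+ 2 *
      expR (2 * x * cmod (tpoly (tcoef g) K (cR r * expi t)) ^+ 2)) @[K --> \oo] -->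
    rint 0 1 (fun t => cmod (w (cR r * expi t)) ^+ 2 *
      expR (2 * x * cmod (g (cR r * expi t)) ^+ 2)).
  apply: (@rint_cvg _ _ _ _ _ (W ^+ 2 * expR (2 * x * M ^+ 2))).
  - move=> K; have <- : (fun t => cmod (G K (cR r * expi t)) ^+ 2) = (fun t => cmod (w (cR r * expi t)) ^+ 2 *
        expR (2 * x * cmod (tpoly (tcoef g) K (cR r * expi t)) ^+ 2)).
      by apply/funext => t; exact: GE.
    by have [] := bmeas_sqrcmod (circle_cbmeas 0 1 (hG K) hr').
  - move=> K t ht; rewrite ger0_norm ?mulr_ge0 ?exprn_ge0 ?expR_ge0 //.
    rewrite ler_pM ?exprn_ge0 ?expR_ge0 //; first by rewrite ler_sqr ?nnegrE // hW.
    rewrite ler_expR ler_wpM2l ?mulr_ge0 // ler_sqr ?nnegrE //.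
    by rewrite (le_trans (cmod_poly_le _ _ _ (ltW r0))).
  - move=> t _; apply: cvgMr; apply: cvg_expR_comp; apply: cvgMr; apply: cvg_sqr.
    apply: cvg_cmod; apply: (taylor hg); by rewrite cmod_circle gtr0_norm.
apply: (@le_trans _ _ (rint 0 1 (fun t => cmod (w (cR r * expi t)) ^+ 2 *
      expR (2 * x * cmod (g (cR r * expi t)) ^+ 2)))).
  by apply: (ler_cvg_to c1 c2); apply: nearW => K; exact: G0.
have bwg := bmeas_sqrcmod (circle_cbmeas 0 1 (holoM hw hg) hr').
rewrite /mean2 -rintZ // -rintD //; last by apply: bmeasM => //; exact: bmeas_cst.
apply: le_rint.
- have bg := circle_cont hg hr'; have bw' := circle_cont hw hr'.
  apply: bmeas_cont => t _; apply: cvgM; first by apply: cvg_sqr; apply: cvg_cmod; exact: bw'.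
  apply: cvg_expR_comp; apply: cvgMr; apply: cvg_sqr; apply: cvg_cmod; exact: bg.
- by apply: bmeasD => //; apply: bmeasM => //; exact: bmeas_cst.
move=> t _; set z := cR r * expi t.
have z1 : cmod z < 1 by rewrite cmod_circle gtr0_norm.
have u01 : 0 <= cmod (g z) ^+ 2 <= 1 by rewrite exprn_ge0 //= exprn_ile1 // g1.
have := ler_wpM2l (exprn_ge0 2 (cmod_ge0 (w z))) (expR_chord (2 * x) u01).
rewrite [cmod (g z) ^+ 2 * (2 * x)]mulrC => h; apply: (le_trans h).
by rewrite cmodM exprMn; nra.
Qed.

Variable phi : C -> C.
Hypothesis sm : self_map phi.

Let hphi : holo_disk phi. Proof. by case: sm. Qed.
Let dphi z : cmod z < 1 -> cmod (phi z) < 1. Proof. by case: sm => _ h /h. Qed.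

Lemma inH2_monomial n : inH2 (fun z : C => z ^+ n) /\ h2le (fun z : C => z ^+ n) 1.
Proof.
have hz : holo_disk (fun z : C => z ^+ n) by apply: holoX => z _; exact: derivableC_id.
have h : h2le (fun z : C => z ^+ n) 1.
  by apply: h2le_cst1 => // z z1; rewrite cmodX exprn_ile1 // ltW.
by split => //; apply/inH2P; split => //; exists 1.
Qed.

Lemma compact_powers w : holo_disk w -> compact_on_H2 (wcomp w phi) ->
  exists s, subseq_idx s /\ forall e : R, 0 < e ->
    \forall n \near \oo, h2le (fun z => w z * phi z ^+ s n) e.
Proof.
move=> hw hc.
have [] := hc (fun n z => z ^+ n) (fun n => (inH2_monomial n).1).
  by exists 1 => n; apply: (H2norm2_le _ (inH2_monomial n).1.1).2; exact: (inH2_monomial n).2.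
move=> s [g [hs [[hg _] hl]]]; exists s; split => // e e0.
have hwp n : holo_disk (fun z => w z * phi z ^+ n) by exact: (holoM hw (@holoX _ phi n hphi)).
have hd n : holo_disk (fun z => w z * phi z ^+ s n - g z) by exact: (holoB (hwp (s n)) hg).
have near_le (d : R) : 0 < d ->
    \forall n \near \oo, h2le (fun z => w z * phi z ^+ s n - g z) d.
  move=> d0; apply: filterS (ereal0_cvg hl d0) => n.
  exact: (H2norm2_le _ (hd n)).1.
have g0 z : cmod z < 1 -> g z = 0.
  move=> z1; apply/eqP; rewrite -cmod_eq0; apply/eqP/le_anti; rewrite cmod_ge0 andbT.
  apply/ler_addgt0Pr => a a0; rewrite add0r.
  have z1' : 0 < 1 - cmod z by rewrite subr_gt0.
  (* Chosen so that [h2le_pt] bounds the difference at [z] by [a / 2]; the other half goes to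
     [w z * phi z ^+ s n], which tends to 0 at each point. Hence the norm limit [g] vanishes. *)
  pose d := (a / 2 * (1 - cmod z)) ^+ 2.
  have d0 : 0 < d by rewrite exprn_gt0 // mulr_gt0 // divr_gt0.
  have c0 : cmod (w z) * cmod (phi z) ^+ s n @[n --> \oo] --> cmod (w z) * 0.
    apply: cvgMr; apply: (@cvg_subseq _ (fun n => cmod (phi z) ^+ n) _ _ hs).
    by apply: cvg_expr; rewrite ger0_norm // dphi.
  rewrite mulr0 in c0; have a2 : 0 < a / 2 by rewrite divr_gt0.
  move/cvgrPdist_lt: c0 => /(_ _ a2)[N1 _ hN1].
  have [N2 _ hN2] := near_le d d0.
  have := hN1 (maxn N1 N2) (leq_maxl _ _); have := hN2 (maxn N1 N2) (leq_maxr _ _).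
  move: (maxn N1 N2) => n /= h2.
  rewrite sub0r normrN ger0_norm ?mulr_ge0 ?exprn_ge0 // => h1.
  have := h2le_pt (taylor (hd n)) h2 z1; rewrite /d sqrtr_sqr ger0_norm; last first.
    by rewrite mulr_ge0 // ltW // divr_gt0.
  rewrite mulfK ?gt_eqF // => h3.
  have := cmod_sub_ge (g z) (w z * phi z ^+ s n); rewrite cmodBC cmodM cmodX; lra.
apply: filterS (near_le e e0) => n; apply: (h2le_mono (hwp (s n)) (hd n)).
by move=> z z1; rewrite g0 // subr0.
Qed.

(** [m] is the index of the first nonzero Taylor coefficient; the Jensen step is informative only
    for a function not vanishing at 0. *)
Lemma holo_factor w B : holo_disk w -> h2le w B -> (exists z, cmod z < 1 /\ w z != 0) ->
  exists m w1, [/\ holo_disk w1, w1 0 != 0 & forall z, cmod z < 1 -> w z = z ^+ m * w1 z].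
Proof.
move=> hw hB [z [z1 wz]].
have [m cm mmin] : exists2 m, tcoef w m != 0 & forall k, (k < m)%N -> tcoef w k = 0.
  have [ex|nex] := pselect (exists m, tcoef w m != 0).
    have [m hm hmin] := ex_minnP ex; exists m => // k km.
    by apply/eqP; apply: contraTT km => /hmin; rewrite leqNgt.
  exfalso; move/eqP: wz; apply.
  have h0 n : tcoef w n = 0 by apply/eqP/negPn/negP => h; apply: nex; exists n.
  have h := taylor hw z1; have c : (0 : C) @[n --> \oo] --> (0 : C) by exact: cvg_cst.
  have E : (fun N => \sum_(n < N) tcoef w n * z ^+ n) = fun=> 0.
    by apply/funext => N; rewrite big1 // => i _; rewrite h0 mul0r.
  by rewrite E in h; exact: (cvg_unique _ h c).
have [q hq [pq wq]] := holo_shift m hw (h2le_coef_bound hw hB).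
exists m, q; split; [exact: hq | by rewrite -(pser0 pq) addn0 | move=> u u1].
by rewrite wq // /tpoly big1 ?add0r // => i _; rewrite mmin // mul0r.
Qed.

(** If no power had squared norm at most [e], the Jensen step would bound [c * exp (2 x e)] by
    [W + 1] for every [x >= 0], with [c > 0] independent of [x]. *)
Lemma compact_decay w : inH2 w -> (exists z, udisk z /\ w z != 0) ->
  compact_on_H2 (wcomp w phi) ->
  forall e : R, 0 < e -> exists n, h2le (fun z => phi z ^+ n) e.
Proof.
move=> /inH2P[hw [W hW]] wz hc e e0; apply: contrapT => hn.
have W0 := h2le_ge0 hW.
have [m [w1 [hw1 w10 wE]]] := holo_factor hw hW wz.
have [s [hs sl]] := compact_powers hw hc.
have hX n : holo_disk (fun z => phi z ^+ n) by exact: holoX.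
have X1 n z : cmod z < 1 -> cmod (phi z ^+ n) <= 1.
  by move=> z1; rewrite cmodX exprn_ile1 // ltW // dphi.
(* The radius depends on [n], but means increase with the radius, so it may be taken at least 1/2;
   then the factor from [z ^+ m] is at least [4^-m]. *)
have big n : exists2 r, 2^-1 <= r < 1 & e < mean2 (fun z => phi z ^+ n) r.
  apply: contrapT => h; apply: hn; exists n => r /andP[r0 r1].
  rewrite leNgt; apply/negP => er; apply: h; exists (Num.max r 2^-1).
    by rewrite le_max lexx orbT /= gt_max r1; lra.
  apply: lt_le_trans er _; apply: (mean2_mono (hX n) r0); first by rewrite le_max lexx.
  by rewrite gt_max r1; lra.
pose c := cmod (w1 0) ^+ 2 * (4^-1) ^+ m.
have c0 : 0 < c by rewrite mulr_gt0 ?exprn_gt0 ?cmod_gt0 // invr_gt0.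
(* [x] is fixed before [n]: a squared norm of [w * phi ^+ s n] below [exp (- 2 x)] absorbs the
   factor [exp (2 x) - 1] of the Jensen step, leaving at most 1. *)
have key (x : R) : 0 <= x -> c * expR (2 * x * e) <= W + 1.
  move=> x0; pose d := (expR (2 * x))^-1; have d0 : 0 < d by rewrite invr_gt0 expR_gt0.
  have [n _ hnn] := sl d d0; have := hnn n (leqnn n) => /= {hnn}hd.
  have [r /andP[r2 r1] er] := big (s n); have r0 : 0 < r by lra.
  have hr : 0 < r < 1 by rewrite r0.
  have hr' : 0 <= r < 1 by rewrite (ltW r0).
  have := jensen_step hw1 (hX (s n)) (X1 (s n)) hr x0.
  have rm0 : 0 <= (r ^+ m) ^+ 2 by rewrite exprn_ge0 // exprn_ge0 // ltW.
  move=> /(ler_wpM2l rm0); rewrite [X in _ <= X]mulrDr => h.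
  have E1 : (r ^+ m) ^+ 2 * mean2 w1 r = mean2 w r.
    rewrite /mean2 -rintZ; last exact: bmeas_sqrcmod (circle_cbmeas 0 1 hw1 hr').
    apply: eq_rint => t _; rewrite wE ?cmod_circle ?gtr0_norm //.
    by rewrite cmodM exprMn cmodX cmod_circle gtr0_norm.
  have E2 : (r ^+ m) ^+ 2 * mean2 (fun z => w1 z * phi z ^+ s n) r =
      mean2 (fun z => w z * phi z ^+ s n) r.
    rewrite /mean2 -rintZ; last exact: bmeas_sqrcmod (circle_cbmeas 0 1 (holoM hw1 (hX _)) hr').
    apply: eq_rint => t _; rewrite wE ?cmod_circle ?gtr0_norm //.
    by rewrite !cmodM [cmod ((cR r * expi t) ^+ m)]cmodX cmod_circle gtr0_norm // !exprMn mulrA.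
  rewrite E1 [X in _ + X]mulrCA E2 in h.
  have rm : (4^-1 : R) ^+ m <= (r ^+ m) ^+ 2.
    have -> : (4^-1 : R) = 2^-1 ^+ 2 by rewrite expr2; field.
    have -> : (2^-1 ^+ 2) ^+ m = (2^-1 ^+ m) ^+ 2 :> R by rewrite -!exprM mulnC.
    rewrite ler_sqr ?nnegrE ?exprn_ge0 ?invr_ge0 ?(ltW r0) //.
    by rewrite lerXn2r ?nnegrE ?invr_ge0 // ltW.
  apply: (@le_trans _ _ ((r ^+ m) ^+ 2 * (cmod (w1 0) ^+ 2 *
      expR (2 * x * mean2 (fun z => phi z ^+ s n) r)))).
    rewrite /c [cmod _ ^+ 2 * 4^-1 ^+ m]mulrC -[X in X <= _]mulrA ler_pM ?exprn_ge0 ?invr_ge0 ?mulr_ge0 ?expR_ge0 ?exprn_ge0 //.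
    by rewrite ler_wpM2l ?exprn_ge0 // ler_expR ler_wpM2l ?mulr_ge0 // ltW.
  apply: (le_trans h); rewrite lerD ?hW //.
  apply: (@le_trans _ _ (expR (2 * x) * d)); last by rewrite mulfV // gt_eqF // expR_gt0.
  rewrite ler_pM ?hd //.
  - by rewrite subr_ge0 -expR0 ler_expR mulr_ge0.
  - by apply: rint_ge0 => t _; rewrite exprn_ge0.
  - by rewrite gerBl.
(* At this [x] the exponent is [(W + 1) / c], and [1 + y <= exp y] makes the left side at least
   [c + W + 1]. *)
have := key ((W + 1) / (2 * e * c)).
have W1 : 0 <= W + 1 by rewrite addr_ge0.
have ec : 0 < 2 * e * c by rewrite mulr_gt0 // mulr_gt0.
move=> /(_ (divr_ge0 W1 (ltW ec))); apply/negP; rewrite -ltNge.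
have -> : 2 * ((W + 1) / (2 * e * c)) * e = (W + 1) / c by field; rewrite !gt_eqF.
apply: (@lt_le_trans _ _ (c * (1 + (W + 1) / c))); last first.
  by rewrite ler_pM2l // expR_ge1Dx.
by rewrite mulrDr mulr1 mulrCA mulfV ?gt_eqF // mulr1 ltrDr.
Qed.

Lemma radial_seq t (l : C) (rho : nat -> R) : (forall j, rho j < 1) -> rho j @[j --> \oo] --> (1 : R) ->
  phi (cR r * expi t) @[r --> at_left (1%R : R)] --> l ->
  phi (cR (rho j) * expi t) @[j --> \oo] --> l.
Proof.
move=> r1 rl hl.
have h : rho j @[j --> \oo] --> at_left (1 : R).
  move=> A hA; have h : within (fun x : R => x < 1) (nbhs (1 : R)) A by exact: hA.
  have hn : \forall j \near \oo, rho j < 1 -> A (rho j) by exact: rl _ h.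
  have hn' : \forall j \near \oo, A (rho j) by apply: filterS hn => j hj; exact: (hj (r1 j)).
  exact: hn'.
exact: (cvg_comp _ _ h hl).
Qed.

(* On [unimod_set phi] every liminf of [|phi ^+ N_k|^2] along the radii is [1], while these
   liminfs have summable integrals. *)
Lemma decay_negligible : (forall e : R, 0 < e -> exists n, h2le (fun z => phi z ^+ n) e) ->
  (@lebesgue_measure R).-negligible (unimod_set phi).
Proof.
move=> hdec.
have /choice[N hN] k : exists n, h2le (fun z => phi z ^+ n) (2^-1 ^+ k).
  by apply: hdec; rewrite exprn_gt0 // invr_gt0.
pose rho j : R := 1 - j.+2%:R^-1.
pose v k j t := cmod (phi (cR (rho j) * expi t) ^+ N k) ^+ 2.
have bv k j : bmeas 0 1 (v k j).
  exact: bmeas_sqrcmod (circle_cbmeas 0 1 (@holoX _ phi (N k) hphi) (one_minus_itv j)).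
have v0 k j t : 0 <= v k j t by rewrite exprn_ge0.
pose u k t := limn_einf (fun j => (v k j t)%:E).
have h := @summable_ae _ 0 1 u 2.
apply: negligibleS (h _ _ _).
- move=> t [t01 [l [hl l1]]]; split.
    by move: t01; rewrite in_itv /= => /andP[-> /ltW].
  have uE k : u k t = 1%E.
    have r1 j : rho j < 1 by have /andP[] := one_minus_itv (R := R) j.
    have hc : cmod (phi (cR (rho j) * expi t)) @[j --> \oo] --> cmod l.
      by apply: cvg_cmod; exact: (radial_seq r1 cvg_one_minus hl).
    have hv : v k j t @[j --> \oo] --> (1 : R).
      rewrite -(expr1n _ 2) -(expr1n _ (N k)) -l1 /v; under eq_fun do rewrite cmodX.
      by apply: cvg_sqr; exact: (cvg_comp _ _ hc (@exprn_continuous R (N k) (cmod l))).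
    have c : (v k j t)%:E @[j --> \oo] --> (1 : R)%:E.
      by apply: cvg_EFin; [exact: nearW | exact: hv].
    by rewrite /u; have [-> _] := cvg_limn_einf_sup c.
  move=> [K hK].
  have [n hn] : exists n : nat, K < n%:R.
    exists (Num.truncn `|K|).+1; apply: (le_lt_trans (ler_norm _)); exact: truncnS_gt.
  have := hK n; under eq_bigr do rewrite uE.
  by rewrite sumEFin lee_fin sumr_const card_ord leNgt hn.
- by move=> k; apply: measurable_fun_limn_einf => // j; case: (bv k j).
- move=> k t _; rewrite /u limn_einf_lim; apply: lime_ge; first exact: is_cvg_einfs.
  by apply: nearW => n; apply: le_ereal_inf_tmp => _ [j _ <-]; rewrite lee_fin.
move=> M; apply: (@le_trans _ _ (\sum_(k < M) (2^-1 ^+ k)%:E)%E).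
  apply: lee_sum => k _; apply: fatou_le => // j.
  exact: (hN k _ (one_minus_itv j)).
rewrite sumEFin lee_fin; have h2 : 0 <= (2^-1 : R) < 1 by lra.
by apply: (le_trans (geo_le M h2)); have -> : (1 - 2^-1 : R)^-1 = 2 by field.
Qed.

End forward.

(** * Poisson integrals *)

Section poisson.
Context {R : realType}.
Local Notation C := (Cplx R).
Implicit Types (f : C -> C) (r t u s : R) (q : C).

Lemma cvg_geoC q : cmod q < 1 -> \sum_(n < N) q ^+ n @[N --> \oo] --> (1 - q)^-1.
Proof.
move=> q1; have q0 : 1 - q != 0.
  by rewrite subr_eq0; apply: contraTneq q1 => <-; rewrite cmod1 ltxx.
have E N : \sum_(n < N) q ^+ n - (1 - q)^-1 = - ((1 - q)^-1 * q ^+ N).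
  have h : (1 - q) * (\sum_(n < N) q ^+ n) = 1 - q ^+ N.
    by rewrite -opprB mulNr -subrX1 opprB.
  apply: (mulfI q0); rewrite mulrBr h mulfV // mulrN mulVKf //.
  by rewrite addrAC subrr add0r.
apply/cvgC_ltP => e e0.
have c : cmod (1 - q)^-1 * cmod q ^+ N @[N --> \oo] --> cmod (1 - q)^-1 * 0.
  by apply: cvgMr; apply: cvg_expr; rewrite ger0_norm.
rewrite mulr0 in c; move/cvgrPdist_lt: c => /(_ _ e0); apply: filterS => N.
by rewrite sub0r normrN ger0_norm ?mulr_ge0 ?exprn_ge0 // E cmodN cmodM cmodX.
Qed.

Definition poisson r u : R := (1 - r ^+ 2) / cmod (1 - cR r * expi u) ^+ 2.

Lemma circle_neq1 r u : 0 <= r < 1 -> 1 - cR r * expi u != 0.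
Proof.
move=> /andP[r0 r1]; rewrite subr_eq0; apply: contraTneq r1 => h.
by rewrite -(ger0_norm r0) -(cmod_circle r u) -h cmod1 ltxx.
Qed.

(** The kernel splits into two geometric series, carrying the nonnegative and the negative
    frequencies. *)
Lemma poissonE r u : 0 <= r < 1 -> let q := cR r * expi u in
  cR (poisson r u) = (1 - q)^-1 + cconj q * (1 - cconj q)^-1.
Proof.
move=> hr q; have q0 : 1 - q != 0 by exact: circle_neq1.
have cc : cconj (1 - q) = 1 - cconj q by apply: cplxP; rewrite !cE; ring.
have q0' : 1 - cconj q != 0 by rewrite -cc -cmod_gt0 cmod_conj cmod_gt0.
rewrite /poisson cRM cRV -mul_conj cRB cR1 cc.
have -> : cR (r ^+ 2) = q * cconj q.
  by rewrite mul_conj cmod_circle ger0_norm //; case/andP: hr.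
by rewrite -/q; field; rewrite q0 q0'.
Qed.

Lemma poisson_cont r t : 0 <= r < 1 -> continuous (fun s => poisson r (t - s)).
Proof.
move=> hr s.
have c1 : t - x @[x --> s] --> t - s by apply: cvgB; [exact: cvg_cst | exact: cvg_id].
have c2 : expi (t - x) @[x --> s] --> expi (t - s) by exact: (cvg_comp _ _ c1 (@continuous_expi R _)).
have c3 : cR r * expi (t - x) @[x --> s] --> cR r * expi (t - s) by exact: (cvgCZl c2).
have c4 : 1 - cR r * expi (t - x) @[x --> s] --> 1 - cR r * expi (t - s).
  exact: (cvgCB (cvg_cst _) c3).
apply: cvgMr; apply: cvgV; first by rewrite expf_neq0 // gt_eqF // cmod_gt0 circle_neq1.
by apply: cvg_sqr; apply: cvg_cmod; exact: c4.
Qed.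

Lemma poisson_bmeas a b r t : 0 <= r < 1 -> bmeas a b (fun s => poisson r (t - s)).
Proof. by move=> hr; apply: bmeas_cont => s _; exact: poisson_cont. Qed.

Lemma poisson_ge0 r u : 0 <= r < 1 -> 0 <= poisson r u.
Proof.
move=> /andP[r0 r1]; rewrite divr_ge0 ?exprn_ge0 // subr_ge0 exprn_ile1 //; exact: ltW.
Qed.

Lemma poisson_le1 r u : 0 <= r < 1 -> poisson r u <= 2 / (1 - r).
Proof.
move=> hr; have /andP[r0 r1] := hr; have d0 : 0 < 1 - r by rewrite subr_gt0.
have h : 1 - r <= cmod (1 - cR r * expi u).
  by have := cmod_sub_ge 1 (cR r * expi u); rewrite cmod1 cmod_circle ger0_norm.
have h2 : (1 - r) ^+ 2 <= cmod (1 - cR r * expi u) ^+ 2 by rewrite ler_sqr ?nnegrE // ltW.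
rewrite /poisson ler_pdivrMr; last by rewrite exprn_gt0 // cmod_gt0 circle_neq1.
rewrite mulrAC ler_pdivlMr //; move: h2; set m := cmod _ ^+ 2 => h2.
have -> : (1 - r ^+ 2) * (1 - r) = (1 + r) * (1 - r) ^+ 2 by ring.
by apply: (le_trans _ (ler_wpM2l (ler0n _ 2) h2)); rewrite ler_wpM2r ?exprn_ge0 ?(ltW d0) //; lra.
Qed.

(** With [m = |1 - r expi u|], the chord [|1 - expi u|] is at most [m + (1 - r) <= 2 m]; together
    with [1 - r^2 <= 2 (1 - r)] this gives the 8. *)
Lemma poisson_le2 r u (c : R) : 0 <= r < 1 -> 0 < c -> u != 0 ->
  c * `|u| <= cmod (1 - expi u) -> poisson r u <= 8 / c ^+ 2 * (1 - r) / u ^+ 2.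
Proof.
move=> hr c0 u0 hc; have /andP[r0 r1] := hr; have d0 : 0 < 1 - r by rewrite subr_gt0.
set m := cmod (1 - cR r * expi u).
have h : 1 - r <= m.
  by have := cmod_sub_ge 1 (cR r * expi u); rewrite cmod1 cmod_circle ger0_norm.
have h1 : c * `|u| <= 2 * m.
  have E : 1 - expi u = (1 - cR r * expi u) - cR (1 - r) * expi u by rewrite cRB cR1; ring.
  have := cmodB (1 - cR r * expi u) (cR (1 - r) * expi u).
  by rewrite -E cmod_circle gtr0_norm // -/m; lra.
have m0 : 0 < m by rewrite cmod_gt0 circle_neq1.
have un0 : 0 < `|u| by rewrite normr_gt0.
have h2 : (c * `|u|) ^+ 2 <= (2 * m) ^+ 2 by rewrite ler_sqr ?nnegrE ?mulr_ge0 // ltW.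
rewrite -(real_normK (num_real u)) /poisson -/m ler_pdivrMr ?exprn_gt0 //.
have -> : 8 / c ^+ 2 * (1 - r) / `|u| ^+ 2 * m ^+ 2 = (1 - r) * 2 * ((2 * m) ^+ 2 / (c * `|u|) ^+ 2).
  by field; rewrite !gt_eqF.
have h3 : 1 <= (2 * m) ^+ 2 / (c * `|u|) ^+ 2 by rewrite ler_pdivlMr ?mul1r // exprn_gt0 // mulr_gt0.
nra.
Qed.

(** Against the series of the kernel, one family of frequencies reproduces the Taylor terms by
    [fourier_pos] and the other is killed by [fourier_neg]. *)
Lemma poisson_rep f (rho : R) r t : holo_disk f -> 0 < rho < 1 -> 0 <= r < 1 ->
  cint 0 1 (fun s => f (cR rho * expi s) * cR (poisson r (t - s))) =
  f (cR rho * (cR r * expi t)).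
Proof.
move=> hf hrho hr; have /andP[r0 r1] := hr; have /andP[p0 p1] := hrho.
have hrho' : 0 <= rho < 1 by rewrite ltW.
pose q s := cR r * expi (t - s).
have q1 s : cmod (q s) = r by rewrite cmod_circle ger0_norm.
have bq : cbmeas 0 1 q.
  have := cbmeasM (cbmeas_cst 0 1 (cR r * expi t)) (cbmeas_conj (cbmeas_expiM 0 1 (1 : R))).
  by under eq_fun do rewrite expi_conj mul1r -mulrA -expiD.
have bX (g : R -> C) n : cbmeas 0 1 g -> cbmeas 0 1 (fun s => g s ^+ n).
  move=> bg; elim: n => [|n IH]; first by under eq_fun do rewrite expr0; exact: cbmeas_cst.
  by under eq_fun do rewrite exprS; exact: cbmeasM.
have bqc := cbmeas_conj bq.
have bf := circle_cbmeas 0 1 hf hrho'.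
have [M M0 hM] := cbmeas_bound bf.
(* Truncated kernels, bounded by [2 / (1 - r)] uniformly in [N], so the integrals converge by
   domination. *)
pose Q N s := \sum_(n < N) q s ^+ n + cconj (q s) * \sum_(n < N) cconj (q s) ^+ n.
have bQ N : cbmeas 0 1 (Q N).
  apply: cbmeasD; first by apply: cbmeas_sum => n; exact: bX.
  by apply: cbmeasM => //; apply: cbmeas_sum => n; exact: bX.
have c1 : cint 0 1 (fun s => f (cR rho * expi s) * Q N s) @[N --> \oo] -->
    cint 0 1 (fun s => f (cR rho * expi s) * cR (poisson r (t - s))).
  apply: (@cint_cvg _ _ _ _ _ (M * (2 / (1 - r)))).
  - by move=> N; exact: (cbmeasM bf (bQ N)).
  - move=> N s hs; rewrite cmodM ler_pM // ?hM //.
    have g1 (z : C) : cmod z = r -> cmod (\sum_(n < N) z ^+ n) <= (1 - r)^-1.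
      move=> zr; apply: (le_trans (cmod_sum _ _ _)).
      by under eq_bigr do rewrite cmodX zr; exact: geo_le.
    rewrite (le_trans (cmodD _ _)) // cmodM cmod_conj q1.
    have h1 := g1 _ (q1 s).
    have h2 := g1 (cconj (q s)); rewrite cmod_conj in h2; have {}h2 := h2 (q1 s).
    have := cmod_ge0 (\sum_(n < N) cconj (q s) ^+ n); nra.
  - move=> s _; rewrite poissonE //; apply: cvgCZl.
    have a1 : cmod (q s) < 1 by rewrite q1.
    have a2 : cmod (cconj (q s)) < 1 by rewrite cmod_conj q1.
    exact: (cvgCD (cvg_geoC a1) (cvgCZl (cvg_geoC a2))).
have z1 : cmod (cR rho * (cR r * expi t)) < 1.
  by rewrite cmodM cmod_cR cmod_circle !ger0_norm ?(ltW p0) //; nra.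
have EQ N : cint 0 1 (fun s => f (cR rho * expi s) * Q N s) =
    \sum_(n < N) tcoef f n * (cR rho * (cR r * expi t)) ^+ n.
  rewrite (@eq_cint _ _ _ _ (fun s => \sum_(n < N) ((cR r * expi t) ^+ n *
      (f (cR rho * expi s) * expi (- (n%:R * s))) + (cR r * expi (- t)) ^+ n.+1 *
      (f (cR rho * expi s) * expi (n.+1%:R * s))))); last first.
    move=> s _; rewrite /Q mulrDr !mulr_sumr -big_split; apply: eq_bigr => n _ /=.
    rewrite /q cconjM expi_conj opprB.
    have -> : cconj (cR r) = cR r by apply: cplxP; rewrite !cE ?oppr0.
    have -> : expi (s - t) = expi s * expi (- t) by rewrite expiD.
    rewrite -exprS !exprMn !expiD !exprMn expiMn -mulrN expiMn.
    by ring.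
  have bp n : cbmeas 0 1 (fun s => f (cR rho * expi s) * expi (- (n%:R * s))).
    by under eq_fun do rewrite -mulNr; exact: (cbmeasM bf (cbmeas_expiM _ _ _)).
  have bn n : cbmeas 0 1 (fun s => f (cR rho * expi s) * expi (n.+1%:R * s)).
    exact: (cbmeasM bf (cbmeas_expiM _ _ _)).
  rewrite cint_sum; last first.
    move=> n; apply: cbmeasD; apply: cbmeasM; [exact: cbmeas_cst | exact: bp | exact: cbmeas_cst | exact: bn].
  apply: eq_bigr => n _; rewrite cintD; last first.
  - by apply: cbmeasM; [exact: cbmeas_cst | exact: bn].
  - by apply: cbmeasM; [exact: cbmeas_cst | exact: bp].
  rewrite !cintM; [ | exact: bn | exact: bp].
  rewrite fourier_pos // fourier_neg // mulr0 addr0 [in RHS]exprMn.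
  by ring.
have c2 : cint 0 1 (fun s => f (cR rho * expi s) * Q N s) @[N --> \oo] --> f (cR rho * (cR r * expi t)).
  by under eq_fun do rewrite EQ; exact: (taylor hf z1).
exact: (cvg_unique _ c1 c2).
Qed.

End poisson.

(** * Approximate identities at Lebesgue points *)

Section kernel_estimates.
Context {R : realType}.
Local Notation C := (Cplx R).
Implicit Types (a b c d t u s x : R) (g P : R -> R).

Lemma cmod_chord u : cmod (1 - expi u) = 2 * `|sin (pi * u)|.
Proof.
apply/eqP; rewrite -(@eqrXn2 _ 2) ?mulr_ge0 //; apply/eqP.
rewrite sqr_cmod !cE exprMn real_normK ?num_real //.
have -> : 2 * pi * u = pi * u + pi * u by ring.
rewrite cosD sinD; have := cos2Dsin2 (pi * u); set C := cos _; set S := sin _ => h.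
have -> : (1 - (C * C - S * S)) ^+ 2 + (0 - (S * C + C * S)) ^+ 2 =
  (1 - C * C + S * S) ^+ 2 + 4 * S ^+ 2 * C ^+ 2 by ring.
have -> : C ^+ 2 = 1 - S ^+ 2 by rewrite -h; ring.
have -> : C * C = 1 - S ^+ 2 by rewrite -h; ring.
ring.
Qed.

(** [T < 1] excludes the zero of the chord at [|u| = 1]. Near 0 the derivative of the sine gives the
    bound; on the rest of the interval [sin (pi u)] has a positive minimum. *)
Lemma expi_chord (T : R) : 0 < T < 1 ->
  exists2 c : R, 0 < c & forall u, `|u| <= T -> c * `|u| <= cmod (1 - expi u :> C).
Proof.
move=> /andP[T0 T1]; have p2 := pi_ge2 R.
have h := real_der_bound (is_derive_sin (0 : R)).
have [d /= d0 hd] := h 2^-1 ltac:(by rewrite invr_gt0).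
have hs y : `|y| < d -> `|y| / 2 <= `|sin y|.
  move=> yd; have := hd y; rewrite /ball_ /= sub0r normrN => /(_ yd).
  rewrite addr0 sin0 cos0 subr0 mul1r => hy.
  have := lerB_dist y (sin y); rewrite distrC; lra.
have cs : continuous (fun u : R => sin (pi * u)).
  move=> u; have c1 : pi * x @[x --> u] --> pi * u by apply: cvgMr; exact: cvg_id.
  exact: (cvg_comp _ _ c1 (@continuous_sin R _)).
pose e := Num.min (d / (2 * pi)) T.
have e0 : 0 < e by rewrite lt_min T0 divr_gt0 // mulr_gt0 // pi_gt0.
have eT : e <= T by rewrite ge_min lexx orbT.
have [x] := EVT_min eT (continuous_subspaceT cs).
rewrite in_itv /= => /andP[ex xT] hx.
have sx : 0 < sin (pi * x).
  have x0 : 0 < x by apply: lt_le_trans ex.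
  apply: sin_gt0_pi; rewrite mulr_gt0 ?pi_gt0 //=.
  by rewrite gtr_pMr ?pi_gt0 // (le_lt_trans xT).
exists (Num.min 1 (2 * sin (pi * x))); first by rewrite lt_min ltr01 mulr_gt0.
have main u : 0 <= u <= T -> Num.min 1 (2 * sin (pi * x)) * `|u| <= cmod (1 - expi u :> C).
  move=> /andP[u0 uT]; rewrite cmod_chord ger0_norm //.
  have [ue|eu] := ltP u e.
    have up : `|pi * u| < d.
      rewrite ger0_norm ?mulr_ge0 ?pi_ge0 //.
      have : u < d / (2 * pi) by apply: lt_le_trans ue _; rewrite ge_min lexx.
      rewrite ltr_pdivlMr ?mulr_gt0 ?pi_gt0 // => hu.
      have : 0 <= u * pi by rewrite mulr_ge0 ?pi_ge0.
      lra.
    have := hs _ up; rewrite ger0_norm ?mulr_ge0 ?pi_ge0 // => hb.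
    have h1 : Num.min 1 (2 * sin (pi * x)) * u <= u by rewrite ler_piMl // ge_min lexx.
    have h2 : 2 * u <= pi * u by rewrite ler_wpM2r.
    lra.
  have hu : sin (pi * x) <= sin (pi * u) by apply: hx; rewrite in_itv /= eu.
  have h1 : Num.min 1 (2 * sin (pi * x)) <= 2 * sin (pi * x) by rewrite ge_min lexx orbT.
  have h2 : Num.min 1 (2 * sin (pi * x)) * u <= 2 * sin (pi * x) * 1.
    by apply: ler_pM => //; [rewrite le_min ler01 mulr_ge0 // ltW | rewrite (le_trans uT) // ltW].
  have := ler_norm (sin (pi * u)); lra.
move=> u uT; have [u0|u0] := leP 0 u; first by apply: main; rewrite u0 -(ger0_norm u0).
have := main (- u); rewrite normrN => hm.
have -> : cmod (1 - expi u) = cmod (1 - expi (- u)) by rewrite !cmod_chord mulrN sinN normrN.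
by apply: hm; rewrite oppr_ge0 ltW //= -(ltr0_norm u0).
Qed.

Lemma rint_annulus a b c d g P (m : R) : a <= b -> b <= c -> c <= d ->
  bmeas a d g -> bmeas a d P -> (forall s, a <= s <= d -> 0 <= g s) -> 0 <= m ->
  (forall s, a <= s <= b -> P s <= m) -> (forall s, c <= s <= d -> P s <= m) ->
  rint a d (fun s => g s * P s) <= rint b c (fun s => g s * P s) + m * rint a d g.
Proof.
move=> ab bc cd bg bP g0 m0 P1 P2.
have bd := le_trans bc cd; have ac := le_trans ab bc.
have bF := bmeasM bg bP.
have bS e f F : a <= e -> f <= d -> bmeas a d F -> bmeas e f F by move=> h1 h2; exact: bmeasS.
have bm e f : a <= e -> f <= d -> bmeas e f (fun s => m * g s).
  by move=> h1 h2; apply: bmeasM; [exact: bmeas_cst | exact: bS].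
rewrite (rint_split ab bd) // (rint_split bc cd); last exact: bS.
rewrite (rint_split ab bd bg) (rint_split bc cd); last exact: bS.
have s1 : rint a b (fun s => g s * P s) <= m * rint a b g.
  rewrite -rintZ; last exact: bS.
  apply: le_rint; [exact: bS | exact: bm | move=> s /andP[as_ sb]].
  by rewrite mulrC ler_wpM2r ?P1 ?as_ // g0 // as_ (le_trans sb).
have s2 : rint c d (fun s => g s * P s) <= m * rint c d g.
  rewrite -rintZ; last exact: bS.
  apply: le_rint; [exact: bS | exact: bm | move=> s /andP[cs sd]].
  by rewrite mulrC ler_wpM2r ?P2 ?cs // g0 // sd (le_trans ac).
have s3 : 0 <= m * rint b c g.
  rewrite mulr_ge0 //; apply: rint_ge0 => s /andP[bs sc].
  by rewrite g0 // (le_trans ab) //= (le_trans sc).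
rewrite !mulrDr; lra.
Qed.

Lemma sqrV_le (y v : R) : 0 < y -> y <= `|v| -> (v ^+ 2)^-1 <= (y ^+ 2)^-1.
Proof.
move=> y0 yv; rewrite -(real_normK (num_real v)) lef_pV2 ?posrE ?exprn_gt0 ?(lt_le_trans y0 yv) //.
by rewrite ler_sqr ?nnegrE // ltW.
Qed.

(* The kernel is summed over the annuli [2^k del <= |s - t| <= 2^(k+1) del]. *)
Lemma rint_dyadic t (del eps A : R) g P : 0 < del -> 0 <= eps -> 0 <= A ->
  bmeas 0 1 g -> bmeas 0 1 P -> (forall s, 0 <= s <= 1 -> 0 <= g s) ->
  (forall s, 0 <= s <= 1 -> P s <= A / del) ->
  (forall s, 0 <= s <= 1 -> s != t -> P s <= A * del / (s - t) ^+ 2) ->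
  forall k, 0 <= t - 2 ^+ k * del -> t + 2 ^+ k * del <= 1 ->
  (forall h, 0 < h <= 2 ^+ k * del -> rint (t - h) (t + h) g <= 2 * h * eps) ->
  rint (t - 2 ^+ k * del) (t + 2 ^+ k * del) (fun s => g s * P s) <= 10 * A * eps - 8 * A * eps / 2 ^+ k.
Proof.
(* The interval of radius [del] costs [2 A eps = (10 - 8) A eps]. The annulus from [2^k del] to
   [2^(k+1) del] adds [4 A eps / 2^k], exactly the growth of [- 8 A eps / 2^k] when [k] increases by
   one. *)
move=> del0 eps0 A0 bg bP g0 P1 P2; elim=> [|k IH].
  rewrite expr0 mul1r divr1 => h1 h2 hg.
  have dl : t - del <= t + del by lra.
  apply: (@le_trans _ _ (A / del * rint (t - del) (t + del) g)).
    rewrite -rintZ; last exact: (bmeasS h1 h2).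
    apply: le_rint.
    - exact: (bmeasS h1 h2 (bmeasM bg bP)).
    - by apply: bmeasM; [exact: bmeas_cst | exact: (bmeasS h1 h2)].
    move=> s /andP[s1 s2]; have hs : 0 <= s <= 1 by rewrite (le_trans h1) // (le_trans s2).
    by rewrite mulrC ler_wpM2r ?g0 ?P1.
  have Ad : 0 <= A / del by rewrite divr_ge0 // ltW.
  apply: (le_trans (ler_wpM2l Ad (hg del _))); first by rewrite del0 lexx.
  rewrite le_eqVlt; apply/orP; left; apply/eqP; field; by rewrite gt_eqF.
rewrite exprS; set y := 2 ^+ k * del => h1 h2 hg.
have y0 : 0 < y by rewrite mulr_gt0 // exprn_gt0.
have E : 2 * 2 ^+ k * del = 2 * y by rewrite /y mulrA.
rewrite E in h1 h2 hg *.
have {}IH := IH _ _ _.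
have bg' := bmeasS h1 h2 bg; have bP' := bmeasS h1 h2 bP.
have m0 : 0 <= A * del / y ^+ 2 by rewrite divr_ge0 ?mulr_ge0 ?exprn_ge0 // ltW.
have in01 s : t - 2 * y <= s <= t + 2 * y -> 0 <= s <= 1.
  by move=> /andP[s1 s2]; rewrite (le_trans h1) // (le_trans s2).
have Pm s : 0 <= s <= 1 -> y <= `|s - t| -> P s <= A * del / y ^+ 2.
  move=> hs ys; have st : s != t by rewrite -subr_eq0 -normr_gt0 (lt_le_trans y0).
  apply: (le_trans (P2 _ hs st)); rewrite ler_wpM2l ?mulr_ge0 ?(ltW del0) //.
  exact: sqrV_le.
apply: le_trans (@rint_annulus (t - 2 * y) (t - y) (t + y) (t + 2 * y) g P (A * del / y ^+ 2)
   _ _ _ bg' bP' _ m0 _ _) _; try lra.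
- by move=> s /in01/g0.
- move=> s /andP[s1 s2]; apply: Pm; first by apply: in01; lra.
  rewrite ler0_norm; lra.
- move=> s /andP[s1 s2]; apply: Pm; first by apply: in01; lra.
  rewrite ger0_norm; lra.
have q1 : rint (t - y) (t + y) (fun s => g s * P s) <= 10 * A * eps - 8 * A * eps / 2 ^+ k.
  apply: IH; rewrite -/y; [lra | lra | move=> h /andP[hh0 hy]].
  by apply: hg; rewrite hh0 (le_trans hy) //; lra.
have q2 : A * del / y ^+ 2 * rint (t - 2 * y) (t + 2 * y) g <= A * del / y ^+ 2 * (2 * (2 * y) * eps).
  by rewrite ler_wpM2l // hg // lexx andbT mulr_gt0.
have k0 : (2 : R) ^+ k != 0 by rewrite gt_eqF // exprn_gt0.
have E3 : A * del / y ^+ 2 * (2 * (2 * y) * eps) = 4 * A * eps / 2 ^+ k.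
  by rewrite /y; field; rewrite k0 gt_eqF.
have E4 : 8 * A * eps / (2 * 2 ^+ k) = 4 * A * eps / 2 ^+ k by field.
have E5 : 8 * A * eps / 2 ^+ k = 2 * (4 * A * eps / 2 ^+ k) by field.
rewrite E3 in q2; rewrite E4; rewrite E5 in q1; lra.
Qed.

Lemma dyadic_scale (del h : R) : 0 < del <= h ->
  exists k : nat, 2 ^+ k * del <= h /\ h < 2 ^+ k.+1 * del.
Proof.
move=> /andP[d0 dh].
have ex : exists n : nat, h < 2 ^+ n * del.
  exists (Num.truncn (h / del)).+1; rewrite -ltr_pdivrMr //.
  apply: (lt_le_trans (truncnS_gt _)); rewrite -natrX ler_nat; exact: ltnW (ltn_expl _ _).
have [[|n] hn hmin] := ex_minnP ex; first by move: hn; rewrite expr0 mul1r ltNge dh.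
exists n; split => //; rewrite leNgt; apply/negP => /hmin; by rewrite ltnn.
Qed.

(* The last hypothesis says that [t] is a Lebesgue point when [g s = |psi s - psi t|]. *)
Lemma approx_identity t (A : R) g (P : R -> R -> R) : 0 < t < 1 -> 0 <= A ->
  bmeas 0 1 g -> (forall s, 0 <= s <= 1 -> 0 <= g s <= 2) ->
  (forall r, 0 <= r < 1 -> bmeas 0 1 (P r)) ->
  (forall r s, 0 <= r < 1 -> 0 <= s <= 1 -> P r s <= A / (1 - r)) ->
  (forall r s, 0 <= r < 1 -> 0 <= s <= 1 -> s != t -> P r s <= A * (1 - r) / (s - t) ^+ 2) ->
  (forall eps, 0 < eps -> exists2 h0, 0 < h0 &
     forall h, 0 < h <= h0 -> rint (t - h) (t + h) g <= 2 * h * eps) ->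
  forall e, 0 < e -> exists2 d, 0 < d &
    forall r, 0 <= r < 1 -> 1 - r < d -> rint 0 1 (fun s => g s * P r s) < e.
Proof.
move=> /andP[t0 t1] A0 bg g2 bP P1 P2 hL e e0.
have A1 : 0 < 10 * A + 1 by lra.
(* Makes the dyadic part, at most [10 A eps], smaller than [e / 2]. *)
pose eps := e / 2 / (10 * A + 1).
have eps0 : 0 < eps by rewrite !divr_gt0.
have [h1 h10 hh1] := hL _ eps0.
pose h0 := Num.min h1 (Num.min t (1 - t)).
have h00 : 0 < h0 by rewrite !lt_min h10 t0 subr_gt0.
have h0t : h0 <= t by rewrite /h0 !ge_min lexx !orbT.
have h0t' : h0 <= 1 - t by rewrite /h0 !ge_min lexx !orbT.
have h01 : h0 <= h1 by rewrite /h0 !ge_min lexx.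
have B0 : 0 < 16 * (A + 1) by lra.
(* The dyadic radius [y] satisfies [h0 / 2 < y <= h0]. Outside it the kernel is at most
   [A del / y^2] and the integral of [g] at most 2, so the second bound makes the far part less than
   [e / 2]. *)
exists (Num.min h0 (e * h0 ^+ 2 / (16 * (A + 1)))).
  by rewrite lt_min h00 divr_gt0 // mulr_gt0 // exprn_gt0.
move=> r hr; have /andP[r0 r1] := hr; rewrite lt_min; set del := 1 - r => /andP[dh de].
have del0 : 0 < del by rewrite subr_gt0.
have [k [k1 k2]] := dyadic_scale (introT andP (conj del0 (ltW dh))).
set y := 2 ^+ k * del in k1; have y0 : 0 < y by rewrite mulr_gt0 // exprn_gt0.
have hy : h0 < 2 * y by move: k2; rewrite exprS -mulrA.
have ty0 : 0 <= t - y by lra.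
have ty1 : t + y <= 1 by lra.
have g0 s : 0 <= s <= 1 -> 0 <= g s by move=> /g2/andP[].
have hd : rint (t - y) (t + y) (fun s => g s * P r s) <= 10 * A * eps - 8 * A * eps / 2 ^+ k.
  apply: (rint_dyadic del0 (ltW eps0) A0 bg (bP _ hr) g0) => //.
  - by move=> s hs; exact: P1.
  - by move=> s hs st; exact: P2.
  move=> h /andP[hp hy']; apply: hh1; rewrite hp (le_trans hy') //; exact: le_trans k1 h01.
have m0 : 0 <= A * del / y ^+ 2 by rewrite divr_ge0 ?mulr_ge0 ?exprn_ge0 // ltW.
have Pm s : 0 <= s <= 1 -> y <= `|s - t| -> P r s <= A * del / y ^+ 2.
  move=> hs ys; have st : s != t by rewrite -subr_eq0 -normr_gt0 (lt_le_trans y0).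
  apply: (le_trans (P2 _ _ hr hs st)); rewrite ler_wpM2l ?mulr_ge0 ?(ltW del0) //.
  exact: sqrV_le.
apply: le_lt_trans (@rint_annulus 0 (t - y) (t + y) 1 g (P r) (A * del / y ^+ 2)
   _ _ _ bg (bP _ hr) g0 m0 _ _) _; try lra.
- move=> s /andP[s1 s2]; apply: Pm; first by lra.
  rewrite ler0_norm; lra.
- move=> s /andP[s1 s2]; apply: Pm; first by lra.
  rewrite ger0_norm; lra.
have rg : rint 0 1 g <= 2.
  have := @rint_cst R 0 1 2 ler01; rewrite subr0 mulr1 => <-.
  by apply: le_rint => //; [exact: bmeas_cst | move=> s /g2/andP[]].
have q1 : A * del / y ^+ 2 * rint 0 1 g <= A * del / y ^+ 2 * 2 by rewrite ler_wpM2l.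
have q2 : A * del / y ^+ 2 * 2 < e / 2.
  have y2 : h0 ^+ 2 < (2 * y) ^+ 2 by rewrite ltr_sqr ?nnegrE // ?ltW // mulr_gt0.
  rewrite mulrAC ltr_pdivrMr ?exprn_gt0 //.
  move: de; rewrite ltr_pdivlMr // => de.
  have : 0 <= A * del by rewrite mulr_ge0 // ltW.
  move: y2; rewrite exprMn => y2.
  have : e * h0 ^+ 2 < e * (2 ^+ 2 * y ^+ 2) by rewrite ltr_pM2l.
  move: de; set H := h0 ^+ 2; set Y := y ^+ 2; lra.
have q3 : 0 <= 8 * A * eps / 2 ^+ k by rewrite !mulr_ge0 ?invr_ge0 ?exprn_ge0 // ltW.
have q4 : 10 * A * eps < e / 2.
  by rewrite /eps mulrCA gtr_pMr ?divr_gt0 // ltr_pdivrMr // mul1r; lra.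
lra.
Qed.

End kernel_estimates.

(** * Limits of integrals and almost everywhere convergence *)

Section ae_convergence.
Context {R : realType}.
Local Notation C := (Cplx R).
Let mu := @lebesgue_measure R.

Lemma rint_cvg_ae (a b : R) (u : nat -> R -> R) (f : R -> R) (M : R) :
  (forall n, bmeas a b (u n)) -> bmeas a b f ->
  (forall n t, a <= t <= b -> `|u n t| <= M) ->
  mu.-negligible [set t | a <= t <= b /\ ~ (u n t @[n --> \oo] --> f t)] ->
  rint a b (u n) @[n --> \oo] --> rint a b f.
Proof.
move=> bu bf hM hN.
apply: (@fine_cvg _ _ _ _ (fun n => (rint a b (u n))%:E)).
have -> : (fun n => (rint a b (u n))%:E) = (fun n => \int[mu]_(t in `[a, b]) (u n t)%:E)%E.
  by apply/funext => n /=; rewrite EFin_rint.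
rewrite (EFin_rint bf).
have [] := @dominated_convergence _ _ _ mu `[a, b] (measurable_itv _)
  (fun n t => (u n t)%:E) (fun t => (f t)%:E) (fun=> M%:E).
- by move=> n; apply/measurable_EFinP; case: (bu n).
- by apply/measurable_EFinP; case: bf.
- apply: negligibleS hN => t /= /not_implyP[ht hc]; split; first by move: ht; rewrite in_itv.
  by apply: contra_not hc => hc; apply: cvg_EFin; [exact: nearW | exact: hc].
- by apply: (@bmeas_integrable _ a b (fun=> M)); exact: bmeas_cst.
- by apply: aeW => t n; rewrite /= in_itv /= => ht; rewrite lee_fin hM.
by [].
Qed.

Lemma cint_cvg_ae (a b : R) (u : nat -> R -> C) (f : R -> C) (M : R) :
  (forall n, cbmeas a b (u n)) -> cbmeas a b f ->
  (forall n t, a <= t <= b -> cmod (u n t) <= M) ->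
  mu.-negligible [set t | a <= t <= b /\ ~ (u n t @[n --> \oo] --> f t)] ->
  cint a b (u n) @[n --> \oo] --> cint a b f.
Proof.
move=> bu [bf1 bf2] hM hN; apply: cvg_cpair; apply: (rint_cvg_ae (M := M)).
- by move=> n; case: (bu n).
- exact: bf1.
- by move=> n t ht; rewrite (le_trans (norm_cre _)) // hM.
- apply: negligibleS hN => t [ht hc]; split => //; apply: contra_not hc; exact: cvg_cre.
- by move=> n; case: (bu n).
- exact: bf2.
- by move=> n t ht; rewrite (le_trans (norm_cim _)) // hM.
- apply: negligibleS hN => t [ht hc]; split => //; apply: contra_not hc; exact: cvg_cim.
Qed.

(** From [2 x <= 2^k x^2 + 2^-k]: weighted square summability of the increments makes them
    absolutely summable. *)
Lemma summable_cvgC (z : nat -> C) (K : R) :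
  (forall N, \sum_(k < N) 2 ^+ k * cmod (z k.+1 - z k) ^+ 2 <= K) ->
  exists l : C, z n @[n --> \oo] --> l.
Proof.
move=> hK; pose s N := \sum_(k < N) cmod (z k.+1 - z k).
have snd : nondecreasing_seq s.
  by apply/nondecreasing_seqP => n; rewrite /s big_ord_recr /= lerDl.
have sb N : s N <= K + 2.
  apply: (@le_trans _ _ (\sum_(k < N) (2 ^+ k * cmod (z k.+1 - z k) ^+ 2 + 2^-1 ^+ k))).
    apply: ler_sum => k _; have k0 : (0 : R) < 2 ^+ k by rewrite exprn_gt0.
    rewrite exprVn; set x := cmod _.
    have h : 0 <= (2 ^+ k * x - 1) ^+ 2 / 2 ^+ k by rewrite divr_ge0 ?sqr_ge0 // ltW.
    have E : (2 ^+ k * x - 1) ^+ 2 / 2 ^+ k = 2 ^+ k * x ^+ 2 - 2 * x + (2 ^+ k)^-1.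
      by field; rewrite gt_eqF.
    have x0 : 0 <= x by exact: cmod_ge0.
    lra.
  rewrite big_split /=; apply: lerD; first exact: hK.
  have h2 : 0 <= (2^-1 : R) < 1 by lra.
  by apply: (le_trans (geo_le N h2)); have -> : (1 - 2^-1 : R)^-1 = 2 by field.
have cs : cvgn s.
  by apply: nondecreasing_is_cvgn => //; exists (K + 2) => _ [n _ <-]; exact: sb.
have step m n : (m <= n)%N -> cmod (z n - z m) <= s n - s m.
  move=> mn; rewrite -(subnK mn); elim: (n - m)%N => [|k IH].
    by rewrite add0n !subrr cmod0.
  rewrite addSn /s big_ord_recr /= -/(s _).
  have -> : z (k + m).+1 - z m = (z (k + m).+1 - z (k + m)%N) + (z (k + m)%N - z m) by ring.
  by rewrite (le_trans (cmodD _ _)) //; move: IH; rewrite /s; lra.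
apply: cauchy_cplx => e e0; have e2 : 0 < e / 2 by rewrite divr_gt0.
move/cvgrPdist_lt: cs => /(_ _ e2)[N _ hN]; exists N => m n Nm Nn.
have := hN _ Nm; have := hN _ Nn; rewrite /= !ltr_norml => /andP[a1 a2] /andP[a3 a4].
by case: (leqP m n) => [/step|/ltnW/step]; rewrite ?[cmod (z n - z m)]cmodBC; lra.
Qed.

End ae_convergence.

(** * Boundary values *)

Section boundary.
Context {R : realType}.
Local Notation C := (Cplx R).
Let mu := @lebesgue_measure R.
Variable f : C -> C.
Hypotheses (hf : holo_disk f) (f1 : forall z, cmod z < 1 -> cmod (f z) <= 1).

(* Parseval, with [(x - y)^2 <= x^2 - y^2] for [0 <= y <= x]. *)
Lemma mean2_diff (r1 r2 : R) : 0 <= r1 -> r1 <= r2 -> 0 < r2 -> r2 < 1 ->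
  rint 0 1 (fun t => cmod (f (cR r2 * expi t) - f (cR r1 * expi t)) ^+ 2) <=
  mean2 f r2 - mean2 f r1.
Proof.
move=> r10 r12 r20 r21; pose q := r1 / r2.
have q0 : 0 <= q by rewrite divr_ge0 // ltW.
have q1 : q <= 1 by rewrite ler_pdivrMr // mul1r.
have qr : q * r2 = r1 by rewrite divfK // gt_eqF.
pose g z := f z - f (cR q * z); pose b := tcoef f.
have hg : pser g (fun n => b n * cR (1 - q ^+ n)).
  move=> z z1; have qz : cmod (cR q * z) < 1.
    by rewrite cmodM cmod_cR ger0_norm // (le_lt_trans _ z1) // ler_piMl.
  have -> : (fun N => \sum_(n < N) b n * cR (1 - q ^+ n) * z ^+ n) =
      (fun N => \sum_(n < N) b n * z ^+ n - \sum_(n < N) b n * (cR q * z) ^+ n).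
    apply/funext => N; rewrite -sumrB; apply: eq_bigr => n _.
    by rewrite cRB cR1 cRX exprMn; ring.
  exact: (cvgCB (taylor hf z1) (taylor hf qz)).
have h2 : 0 <= r2 < 1 by rewrite ltW.
have h1 : 0 <= r1 < 1 by rewrite r10 (le_lt_trans r12).
have -> : rint 0 1 (fun t => cmod (f (cR r2 * expi t) - f (cR r1 * expi t)) ^+ 2) = mean2 g r2.
  by apply: eq_rint => t _; rewrite /g mulrA -cRM qr.
have c : \sum_(n < N) (cmod (b n) * r2 ^+ n) ^+ 2 - \sum_(n < N) (cmod (b n) * r1 ^+ n) ^+ 2
    @[N --> \oo] --> mean2 f r2 - mean2 f r1.
  by apply: cvgB; [exact: (parseval (taylor hf) h2) | exact: (parseval (taylor hf) h1)].
apply: (ler_cvg_to (parseval hg h2) c).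
apply: nearW => N; rewrite -sumrB; apply: ler_sum => n _.
have qn : q ^+ n <= 1 by rewrite exprn_ile1.
have -> : r1 ^+ n = q ^+ n * r2 ^+ n by rewrite -exprMn qr.
rewrite cmodM cmod_cR ger0_norm ?subr_ge0 //.
set m := cmod _; set x := r2 ^+ n; set y := q ^+ n.
have y0 : 0 <= y by rewrite exprn_ge0.
have -> : (m * x) ^+ 2 - (m * (y * x)) ^+ 2 = (m * (1 - y) * x) ^+ 2 + 2 * (y * (1 - y)) * (m * x) ^+ 2 by ring.
by rewrite lerDl mulr_ge0 ?sqr_ge0 // mulr_ge0 // mulr_ge0 // subr_ge0.
Qed.

Lemma mean2_diff_abs (r1 r2 : R) : 0 < r1 < 1 -> 0 < r2 < 1 ->
  rint 0 1 (fun t => cmod (f (cR r2 * expi t) - f (cR r1 * expi t)) ^+ 2) <=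
  `|mean2 f r2 - mean2 f r1|.
Proof.
move=> /andP[r10 r11] /andP[r20 r21]; have [r12|/ltW r12] := leP r1 r2.
  exact: le_trans (mean2_diff (ltW r10) r12 r20 r21) (ler_norm _).
under eq_rint do rewrite cmodBC.
by rewrite distrC; exact: le_trans (mean2_diff (ltW r20) r12 r10 r11) (ler_norm _).
Qed.

(** The means increase to a finite limit, so radii can be chosen along which they are within [4^-k]
    of it. Against the weight [2^k] of [summable_cvgC] this leaves the summable [2^-k]. *)
Lemma fast_radii : exists rho : nat -> R, [/\ forall k, 0 < rho k < 1,
  rho k @[k --> \oo] --> (1 : R) &
  forall k, `|mean2 f (rho k.+1) - mean2 f (rho k)| <= 4^-1 ^+ k].
Proof.
pose m j := mean2 f (1 - j.+2%:R^-1).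
have m_nd : nondecreasing_seq m.
  apply/nondecreasing_seqP => n; have /andP[a1 a2] := one_minus_itv (R := R) n.
  have /andP[a3 a4] := one_minus_itv (R := R) n.+1.
  apply: mean2_mono => //; rewrite lerD2l lerN2 lef_pV2 ?posrE ?ltr0n // ler_nat //.
have m1 j : m j <= 1 by apply: (h2le_cst1 hf f1); exact: one_minus_itv.
have cm : cvgn m by apply: nondecreasing_is_cvgn => //; exists 1 => _ [j _ <-].
pose S := limn m; have mS j : m j <= S by exact: nondecreasing_cvgn_le.
have /choice[N hN] k : exists N, forall j, (N <= j)%N -> S - 4^-1 ^+ k <= m j.
  have k0 : (0 : R) < 4^-1 ^+ k by rewrite exprn_gt0 // invr_gt0.
  move/cvgrPdist_lt: (cm) => /(_ _ k0)[n _ hn]; exists n => j /hn /=.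
  by rewrite ltr_norml => /andP[_]; rewrite -/S; lra.
(* The maximum with [k] forces the radii to 1. They are not arranged to increase, whence the
   absolute value in the conclusion. *)
pose p k := maxn (N k) k; exists (fun k => 1 - (p k).+2%:R^-1); split.
- move=> k; have /andP[a1 ->] := one_minus_itv (R := R) (p k); rewrite andbT.
  by rewrite subr_gt0 invf_lt1 ?ltr0n // ltr1n.
- apply: (@cvg_ge_idx _ (fun n => 1 - n.+2%:R^-1 : R) 1 p); last exact: cvg_one_minus.
  by apply: nearW => n; exact: leq_maxr.
move=> k; rewrite -/(m _) -/(m (p k)).
have b1 := hN k (p k) (leq_maxl _ _); have b2 := hN k.+1 (p k.+1) (leq_maxl _ _).
have b3 : (4^-1 : R) ^+ k.+1 <= 4^-1 ^+ k.
  by rewrite exprS ler_piMl ?exprn_ge0 ?invr_ge0 //; lra.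
have := mS (p k); have := mS (p k.+1); rewrite ler_norml; lra.
Qed.

Lemma boundary_fun : exists (rho : nat -> R) (psi : R -> C),
  [/\ forall k, 0 < rho k < 1, rho k @[k --> \oo] --> (1 : R), cbmeas 0 1 psi,
   forall t, 0 <= t <= 1 -> cmod (psi t) <= 1 &
   mu.-negligible [set t | 0 <= t <= 1 /\
     ~ (f (cR (rho k) * expi t) @[k --> \oo] --> psi t)]].
Proof.
have [rho [r01 rl hr]] := fast_radii.
have r01' k : 0 <= rho k < 1 by have /andP[/ltW -> ->] := r01 k.
have bf k := circle_cbmeas 0 1 hf (r01' k).
pose v k t := 2 ^+ k * cmod (f (cR (rho k.+1) * expi t) - f (cR (rho k) * expi t)) ^+ 2.
have bs k : bmeas 0 1 (fun t => cmod (f (cR (rho k.+1) * expi t) - f (cR (rho k) * expi t)) ^+ 2).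
  exact: bmeas_sqrcmod (cbmeasB (bf _) (bf _)).
have bv k : bmeas 0 1 (v k) by apply: bmeasM => //; exact: bmeas_cst.
have [N [mN N0 hN]] : mu.-negligible [set t | 0 <= t <= 1 /\
    ~ exists K : R, forall M, (\sum_(k < M) (v k t)%:E <= K%:E)%E].
  apply: (@summable_ae _ 0 1 (fun k t => (v k t)%:E) 2).
  - by move=> k; apply/measurable_EFinP; case: (bv k).
  - by move=> k t _; rewrite lee_fin mulr_ge0 // exprn_ge0.
  move=> M; apply: (@le_trans _ _ (\sum_(k < M) (2^-1 ^+ k)%:E)%E).
    apply: lee_sum => k _; rewrite -EFin_rint // lee_fin rintZ //.
    apply: (@le_trans _ _ (2 ^+ k * 4^-1 ^+ k)).
      by rewrite ler_wpM2l ?exprn_ge0 // (le_trans (mean2_diff_abs (r01 _) (r01 _))).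
    by rewrite -exprMn; have -> : 2 * 4^-1 = 2^-1 :> R by field.
  rewrite sumEFin lee_fin; have h2 : 0 <= (2^-1 : R) < 1 by lra.
  by apply: (le_trans (geo_le M h2)); have -> : (1 - 2^-1 : R)^-1 = 2 by field.
have good t : 0 <= t <= 1 -> ~ N t -> exists l : C, f (cR (rho k) * expi t) @[k --> \oo] --> l.
  move=> ht nt; have [K hK] : exists K : R, forall M, (\sum_(k < M) (v k t)%:E <= K%:E)%E.
    by apply: contrapT => h; apply: nt; apply: hN.
  by apply: (@summable_cvgC _ _ K) => M; rewrite -lee_fin -sumEFin; exact: hK.
(* Cutting off on a measurable null set makes the sequence converge at every point of [0, 1], so
   that [psi] is measurable as a pointwise limit. *)
pose w k t := f (cR (rho k) * expi t) * cR (\1_(~` N) t).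
have wN k t : ~ N t -> w k t = f (cR (rho k) * expi t).
  by move=> nt; rewrite /w indicE mem_set // cR1 mulr1.
have wN0 k t : N t -> w k t = 0.
  by move=> nt; rewrite /w indicE memNset ?cR0 ?mulr0 //=; exact.
have bw k : cbmeas 0 1 (w k).
  apply: (cbmeasM (bf k)); apply: cbmeas_cR; split.
    by apply: measurable_indic; exact: measurableC.
  by exists 1 => t _; rewrite indicE; case: (_ \in _); rewrite /= ?normr0 ?normr1.
have /choice[psi hpsi] t : exists l : C, 0 <= t <= 1 -> w k t @[k --> \oo] --> l.
  have [nt|nt] := pselect (N t).
    by exists 0 => _; under eq_fun do rewrite wN0 //; exact: cvg_cst.
  have [ht|ht] := pselect (0 <= t <= 1); last by exists 0.
  have [l hl] := good t ht nt; exists l => _.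
  by under eq_fun do rewrite wN //; exact: hl.
have w1 k t : cmod (w k t) <= 1.
  have [nt|nt] := pselect (N t); first by rewrite wN0 // cmod0.
  have /andP[a1 a2] := r01' k.
  by rewrite wN // f1 // cmod_circle ger0_norm.
exists rho, psi; split => //.
- by apply: (@cbmeas_lim _ _ _ w _ 1).
- move=> t /hpsi/cvg_cmod h; apply: (cvgr_to_le h); exact: nearW.
exists N; split => // t [ht hn]; apply: contrapT => nt; apply: hn.
by have := hpsi t ht; under eq_fun do rewrite wN //.
Qed.

End boundary.

(** * Fatou's theorem on radial limits *)

Section radial_limits.
Context {R : realType}.
Local Notation C := (Cplx R).
Let mu := @lebesgue_measure R.

(** [davg] averages over an open ball; the ball of radius [2 h] contains the closed interval of
    radius [h] and has measure [4 h], so a mean of at most [eps / 2] yields [2 h eps]. Bounding [h]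
    by [t] and [1 - t] keeps the interval inside [0, 1]. *)
Lemma lebesgue_pt_rint (p : R -> R) (t : R) : bmeas 0 1 p -> 0 < t < 1 ->
  lebesgue_pt (p \_ `[0, 1]) t -> forall eps : R, 0 < eps -> exists2 h0, 0 < h0 &
    forall h, 0 < h <= h0 -> rint (t - h) (t + h) (fun s => `|p s - p t|) <= 2 * h * eps.
Proof.
move=> bp /andP[t0 t1]; set q := p \_ _ => /fine_cvgP[hfin /cvgrPdist_lt hc] eps eps0.
have e2 : 0 < eps / 2 by rewrite divr_gt0.
have mq : measurable_fun setT q.
  by have [] := integrable_locally_restrict (measurable_itv `[0, 1]) (bmeas_integrable bp).
have hn : \forall h \near (0 : R)^'+, (davg q t h <= (eps / 2)%:E)%E.
  apply: filterS2 hfin (hc _ e2) => h fh; rewrite /= sub0r normrN => hh.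
  by rewrite -(fineK fh) lee_fin; exact: le_trans (ler_norm _) (ltW hh).
have [d d0 hd] : exists2 d : R, 0 < d & forall h, 0 < h < d -> (davg q t h <= (eps / 2)%:E)%E.
  have hn' : within (fun u : R => 0 < u) (nbhs (0 : R)) (fun h => (davg q t h <= (eps / 2)%:E)%E).
    exact: hn.
  move: hn' => /nbhs_ballP[d /= d0 hd]; exists d => // h /andP[h0 hd'].
  by apply: hd => //; rewrite /ball /= sub0r normrN gtr0_norm.
exists (Num.min (d / 4) (Num.min t (1 - t))).
  by rewrite !lt_min t0 subr_gt0 t1 divr_gt0.
move=> h /andP[h0]; rewrite !le_min => /and3P[hd4 ht ht1].
have hh : 0 < 2 * h < d by apply/andP; split; lra.
have := hd _ hh; have h2 : 0 < 2 * h by lra.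
have h4 : 0 < 2 * h *+ 2 by rewrite mulr2n; lra.
rewrite /davg /iavg (lebesgue_measure_ball _ (ltW h2)) inver gt_eqF // lee_pdivrMl // => hi.
have in01 s : t - h <= s <= t + h -> 0 <= s <= 1 by move=> /andP[a1 a2]; apply/andP; split; lra.
have qE s : 0 <= s <= 1 -> q s = p s by move=> hs; rewrite /q patchE mem_set //= in_itv.
have bF : bmeas (t - h) (t + h) (fun s => `|p s - p t|).
  have bp' : bmeas (t - h) (t + h) p by apply: (bmeasS _ _ bp); lra.
  have [m1 [M hM]] := bmeasB bp' (bmeas_cst _ _ (p t)); split; first exact: measurableT_comp.
  by exists M => s hs; rewrite normr_id hM.
rewrite -lee_fin EFin_rint //.
apply: (@le_trans _ _ (\int[mu]_(y in ball t (2 * h)) `|((center (q t) \o q) y)%:E|)%E).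
  rewrite (@eq_integral _ _ _ mu _ (fun y => `|((center (q t) \o q) y)%:E|)%E); last first.
    move=> s; rewrite inE /= in_itv /= => /in01 hs; rewrite qE // qE //.
    by apply/andP; split; lra.
  apply: ge0_subset_integral => //; first exact: measurable_ball.
    apply: measurable_funTS; apply: measurableT_comp => //; apply/measurable_EFinP.
    by apply: measurable_funD.
  move=> s /=; rewrite in_itv /= => /andP[a1 a2]; rewrite /ball /= ltr_norml; apply/andP; split; lra.
by apply: (le_trans hi); rewrite -EFinM lee_fin mulr2n le_eqVlt; apply/orP; left; apply/eqP; field.
Qed.

Variable f : C -> C.
Hypotheses (hf : holo_disk f) (f1 : forall z, cmod z < 1 -> cmod (f z) <= 1).
Variables (rho : nat -> R) (psi : R -> C).
Hypotheses (r01 : forall k, 0 < rho k < 1) (rl : rho k @[k --> \oo] --> (1 : R)).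
Hypotheses (bpsi : cbmeas 0 1 psi) (psi1 : forall t, 0 <= t <= 1 -> cmod (psi t) <= 1).
Hypothesis hpsi : mu.-negligible [set t | 0 <= t <= 1 /\
     ~ (f (cR (rho k) * expi t) @[k --> \oo] --> psi t)].

Let r01' k : 0 <= rho k < 1. Proof. by have /andP[/ltW -> ->] := r01 k. Qed.

(** The representation on the circle of radius [rho k] passes to the limit: dominated convergence on
    the integral, continuity of [f] inside the disk on the value. *)
Lemma poisson_boundary (r t : R) : 0 <= r < 1 ->
  cint 0 1 (fun s => psi s * cR (poisson r (t - s))) = f (cR r * expi t).
Proof.
move=> hr; have /andP[r0 r1] := hr.
have bP := cbmeas_cR (poisson_bmeas 0 1 t hr).
have bf k := circle_cbmeas 0 1 hf (r01' k).
have c1 : cint 0 1 (fun s => f (cR (rho k) * expi s) * cR (poisson r (t - s))) @[k --> \oo] -->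
    cint 0 1 (fun s => psi s * cR (poisson r (t - s))).
  apply: (@cint_cvg_ae _ _ _ _ _ (2 / (1 - r))).
  - by move=> k; exact: (cbmeasM (bf k) bP).
  - exact: (cbmeasM bpsi bP).
  - move=> k s _; rewrite cmodM cmod_cR (ger0_norm (poisson_ge0 _ hr)).
    rewrite -[X in _ <= X]mul1r ler_pM ?poisson_ge0 ?poisson_le1 //.
    by have /andP[a1 a2] := r01' k; rewrite f1 // cmod_circle ger0_norm.
  apply: negligibleS hpsi => s [hs hn]; split; first exact: hs.
  by apply: contra_not hn => hn; exact: (cvgCZr hn).
have c2 : f (cR (rho k) * (cR r * expi t)) @[k --> \oo] --> f (cR r * expi t).
  have a1 : cR (rho k) * (cR r * expi t) @[k --> \oo] --> cR 1 * (cR r * expi t).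
    exact: (cvgCZr (cvg_cR rl)).
  rewrite cR1 mul1r in a1.
  have z1 : cmod (cR r * expi t) < 1 by rewrite cmod_circle ger0_norm.
  exact: (cvg_comp _ _ a1 (holo_cont hf z1)).
have E k : cint 0 1 (fun s => f (cR (rho k) * expi s) * cR (poisson r (t - s))) =
    f (cR (rho k) * (cR r * expi t)) by exact: poisson_rep.
have c1' : f (cR (rho k) * (cR r * expi t)) @[k --> \oo] -->
    cint 0 1 (fun s => psi s * cR (poisson r (t - s))).
  by under eq_fun do rewrite -E; exact: c1.
exact: (cvg_unique _ c1' c2).
Qed.

Lemma poisson_total (r t : R) : 0 <= r < 1 -> cint 0 1 (fun s => cR (poisson r (t - s))) = 1 :> C.
Proof.
move=> hr; have h1 : holo_disk (fun _ : C => 1 : C) by move=> z _; exact: derivableC_cst.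
have h2 : 0 < (2^-1 : R) < 1 by apply/andP; split; lra.
have := poisson_rep t h1 h2 hr; rewrite /= => <-.
by apply: eq_cint => s _; rewrite mul1r.
Qed.

Lemma radial_limit t : 0 < t < 1 ->
  lebesgue_pt ((fun s => cre (psi s)) \_ `[0, 1]) t ->
  lebesgue_pt ((fun s => cim (psi s)) \_ `[0, 1]) t ->
  f (cR r * expi t) @[r --> at_left (1 : R)] --> psi t.
Proof.
move=> ht l1 l2; have /andP[t0 t1] := ht.
have t01 : 0 <= t <= 1 by rewrite !ltW.
pose g s := cmod (psi s - psi t).
have bg : bmeas 0 1 g by exact: bmeas_cmod (cbmeasB bpsi (cbmeas_cst _ _ _)).
have g2 s : 0 <= s <= 1 -> 0 <= g s <= 2.
  move=> hs; rewrite cmod_ge0 /=; apply: (le_trans (cmodB _ _)).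
  by have := psi1 hs; have := psi1 t01; lra.
(* For [s] in [0, 1] the distance [|t - s|] is at most [T < 1], which keeps the periodic kernel away
   from its second peak; hence the endpoints are excluded. *)
pose T := Num.max t (1 - t).
have hT : 0 < T < 1 by rewrite lt_max t0 gt_max t1 /=; lra.
have [c c0 hc] := expi_chord hT.
(* One constant covering both [poisson_le1] and [poisson_le2]. *)
pose A := 8 / c ^+ 2 + 2.
have A0 : 0 <= A by rewrite addr_ge0 // divr_ge0 // exprn_ge0 // ltW.
have cA : 0 <= 8 / c ^+ 2 by rewrite divr_ge0 // exprn_ge0 // ltW.
have approx := @approx_identity _ t A g (fun r s => poisson r (t - s)) ht A0 bg g2.
have {}approx : forall e : R, 0 < e -> exists2 d, 0 < d &
    forall r, 0 <= r < 1 -> 1 - r < d -> rint 0 1 (fun s => g s * poisson r (t - s)) < e.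
  apply: approx.
  - by move=> r hr; exact: poisson_bmeas.
  - move=> r s hr _; apply: (le_trans (poisson_le1 _ hr)); rewrite ler_wpM2r ?invr_ge0 ?subr_ge0 //.
      by case/andP: hr => _ /ltW.
    by rewrite lerDr.
  - move=> r s hr hs st; have /andP[s0 s1] := hs.
    have ts : t - s != 0 by rewrite subr_eq0 eq_sym.
    have tsT : `|t - s| <= T.
      by rewrite /T le_max !ler_norml; case: (leP s t) => h; apply/orP; [left|right]; apply/andP; split; lra.
    apply: (le_trans (poisson_le2 hr c0 ts (hc _ tsT))).
    rewrite -(sqrrN (t - s)) opprB ler_wpM2r ?invr_ge0 ?sqr_ge0 // ler_wpM2r ?lerDl //.
    by rewrite subr_ge0; case/andP: hr => _ /ltW.
  move=> eps eps0; have e2 : 0 < eps / 2 by rewrite divr_gt0.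
  have [h1 h10 hh1] := lebesgue_pt_rint bpsi.1 ht l1 e2.
  have [h2 h20 hh2] := lebesgue_pt_rint bpsi.2 ht l2 e2.
  exists (Num.min (Num.min h1 h2) (Num.min t (1 - t))).
    by rewrite !lt_min h10 h20 t0 subr_gt0.
  move=> h /andP[h0]; rewrite !le_min => /andP[/andP[b1 b2] /andP[b3 b4]].
  have i1 := hh1 h (introT andP (conj h0 b1)); have i2 := hh2 h (introT andP (conj h0 b2)).
  have th0 : 0 <= t - h by lra.
  have th1 : t + h <= 1 by lra.
  have bn (u : R -> R) x : bmeas 0 1 u -> bmeas (t - h) (t + h) (fun s => `|u s - x|).
    move=> /(bmeasS th0 th1) bu; have [m1 [M hM]] := bmeasB bu (bmeas_cst _ _ x).
    by split; [exact: measurableT_comp | exists M => s hs; rewrite normr_id hM].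
  apply: (@le_trans _ _ (rint (t - h) (t + h) (fun s =>
      `|cre (psi s) - cre (psi t)| + `|cim (psi s) - cim (psi t)|))).
    apply: le_rint; first exact: (bmeasS th0 th1 bg).
      by apply: bmeasD; apply: bn; [exact: bpsi.1 | exact: bpsi.2].
    by move=> s _; rewrite /g (le_trans (cmod_le_reim _)) // !cE.
  rewrite rintD; [| exact: (bn _ _ bpsi.1) | exact: (bn _ _ bpsi.2)].
  have : 2 * h * eps = 2 * h * (eps / 2) + 2 * h * (eps / 2) by field.
  lra.
apply/cvgC_ltP => e e0; have [d d0 hd] := approx e e0.
near=> r.
have r1 : r < 1 by near: r; exact: nbhs_left_lt.
have r0 : 0 < r by near: r; apply: nbhs_left_gt; exact: ltr01.
have rd : 1 - r < d by near: r; exact: nbhs_left_ltBl.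
have hr : 0 <= r < 1 by rewrite (ltW r0).
apply: le_lt_trans (hd r hr rd).
have bP := cbmeas_cR (poisson_bmeas 0 1 t hr).
have -> : f (cR r * expi t) - psi t = cint 0 1 (fun s => (psi s - psi t) * cR (poisson r (t - s))).
  rewrite -(poisson_boundary _ hr) -[X in _ - X]mulr1 -(poisson_total t hr) -cintM //.
  rewrite -cintB; [| exact: (cbmeasM bpsi bP) | exact: (cbmeasM (cbmeas_cst _ _ _) bP)].
  by apply: eq_cint => s _; rewrite mulrBl.
apply: (le_trans (cmod_cint_le (cbmeasM (cbmeasB bpsi (cbmeas_cst _ _ _)) bP))).
rewrite le_eqVlt; apply/orP; left; apply/eqP; apply: eq_rint => s _.
by rewrite cmodM cmod_cR (ger0_norm (poisson_ge0 _ hr)).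
Unshelve. all: by end_near.
Qed.

Lemma radial_limit_ae : mu.-negligible [set t | 0 <= t <= 1 /\
  ~ (f (cR r * expi t) @[r --> at_left (1 : R)] --> psi t)].
Proof.
have L1 := lebesgue_differentiation (integrable_locally_restrict (measurable_itv _) (bmeas_integrable bpsi.1)).
have L2 := lebesgue_differentiation (integrable_locally_restrict (measurable_itv _) (bmeas_integrable bpsi.2)).
have neg1 (x : R) : mu.-negligible [set x].
  by apply/negligibleP => //; exact: lebesgue_measure_set1.
apply: negligibleS (negligibleU (negligibleU (neg1 0) (neg1 1)) (negligibleU L1 L2)) => t [t01 hn].
have [->|n0] := eqVneq t 0; first by left; left.
have [->|n1] := eqVneq t 1; first by left; right.
have ht : 0 < t < 1 by have /andP[a1 a2] := t01; rewrite !lt_neqAle eq_sym n0 a1 n1 a2.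
apply: contrapT => h; apply: hn; apply: radial_limit ht _ _.
  by apply: contrapT => h'; apply: h; right; left.
by apply: contrapT => h'; apply: h; right; right.
Qed.

End radial_limits.

(** * From a null unimodular set to decay *)

Section negligible_decay.
Context {R : realType}.
Local Notation C := (Cplx R).
Variable phi : C -> C.
Hypothesis sm : self_map phi.

Lemma negligible_decay : (@lebesgue_measure R).-negligible (unimod_set phi) ->
  forall e : R, 0 < e -> exists n, h2le (fun z => phi z ^+ n) e.
Proof.
move=> hneg e e0; have hphi : holo_disk phi by case: sm.
have phi1 z : cmod z < 1 -> cmod (phi z) <= 1 by move=> z1; apply: ltW; case: sm => _; exact.
have [rho [psi [r01 rl bpsi psi1 hpsi]]] := boundary_fun hphi phi1.
have hrad := radial_limit_ae hphi phi1 r01 rl bpsi psi1 hpsi.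
have r01' k : 0 <= rho k < 1 by have /andP[/ltW -> ->] := r01 k.
pose F n t := (cmod (psi t) ^+ n) ^+ 2.
have bF n : bmeas 0 1 (F n).
  have bX : bmeas 0 1 (fun t => cmod (psi t) ^+ n).
    elim: n => [|n IH]; first by under eq_fun do rewrite expr0; exact: bmeas_cst.
    by under eq_fun do rewrite exprS; apply: bmeasM => //; exact: bmeas_cmod.
  by rewrite /F; under eq_fun do rewrite expr2; exact: bmeasM.
have F1 n t : 0 <= t <= 1 -> `|F n t| <= 1.
  by move=> ht; rewrite ger0_norm ?exprn_ge0 // exprn_ile1 ?exprn_ge0 // exprn_ile1 // psi1.
(* Off null sets the radial limit exists and equals [psi], and it is not unimodular, so [|psi| < 1]
   and its powers tend to 0. *)
have c0 : rint 0 1 (F n) @[n --> \oo] --> rint 0 1 (fun=> 0).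
  apply: (rint_cvg_ae (M := 1)) => //; first exact: bmeas_cst.
  have neg1 : (@lebesgue_measure R).-negligible [set 1 : R].
    by apply/negligibleP => //; exact: lebesgue_measure_set1.
  apply: negligibleS (negligibleU neg1 (negligibleU hneg hrad)) => t [ht hn].
  (* The integral runs over the closed interval, [unimod_set] over the half-open one. *)
  have [->|n1] := eqVneq t 1; first by left.
  right; apply: contrapT => h; have /andP[t0 t1] := ht.
  have hl : phi (cR r * expi t) @[r --> at_left (1 : R)] --> psi t.
    by apply: contrapT => h'; apply: h; right.
  have m1 : cmod (psi t) < 1.
    rewrite lt_neqAle psi1 // andbT; apply/negP => /eqP m1; apply: h; left.
    by split; [rewrite in_itv /= t0 lt_neqAle n1 t1 | exists (psi t)].
  have c : cmod (psi t) ^+ n @[n --> \oo] --> (0 : R) by apply: cvg_expr; rewrite ger0_norm.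
  have c2 : F n t @[n --> \oo] --> (0 : R) ^+ 2 by rewrite /F; apply: cvg_sqr; exact: c.
  by rewrite expr0n in c2; exact: (hn c2).
rewrite rint_cst // mul0r in c0.
move/cvgrPdist_lt: c0 => /(_ _ e0)[n _ hn]; have := hn n (leqnn n).
rewrite /= sub0r normrN ger0_norm; last by apply: rint_ge0 => t _; rewrite exprn_ge0 // exprn_ge0.
move=> Fe; exists n => r /andP[r0 r1]; apply: le_trans (ltW Fe).
have hX : holo_disk (fun z => phi z ^+ n) by exact: (@holoX _ phi n hphi).
have c1 : mean2 (fun z => phi z ^+ n) (rho k) @[k --> \oo] --> rint 0 1 (F n).
  apply: (rint_cvg_ae (M := 1)) => //.
  - by move=> k; exact: bmeas_sqrcmod (circle_cbmeas 0 1 hX (r01' k)).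
  - move=> k t _; have /andP[a1 a2] := r01' k; rewrite ger0_norm ?exprn_ge0 //.
    by rewrite cmodX exprn_ile1 ?exprn_ge0 // exprn_ile1 // phi1 // cmod_circle ger0_norm.
  apply: negligibleS hpsi => t [ht hc]; split; first exact: ht.
  apply: contra_not hc => hc.
  under eq_fun do rewrite cmodX; apply: cvg_sqr.
  have hc' : cmod (phi (cR (rho k) * expi t)) @[k --> \oo] --> cmod (psi t) by exact: (cvg_cmod hc).
  exact: (cvg_comp _ _ hc' (@exprn_continuous R n (cmod (psi t)))).
(* Means increase with the radius and [rho k] eventually exceeds [r], so the mean at [r] is at most
   the limit along [rho k], the integral of [F n]. *)
apply: (cvgr_to_ge c1).
have d0 : 0 < 1 - r by rewrite subr_gt0.
move/cvgrPdist_lt: rl => /(_ _ d0); apply: filterS => k; rewrite ltr_norml => /andP[_ hk].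
have /andP[a1 a2] := r01' k; apply: (mean2_mono hX) => //; lra.
Qed.

End negligible_decay.

Theorem theorem3p1 (R : realType) (phi : Cplx R -> Cplx R) :
  self_map phi ->
  ((exists w : Cplx R -> Cplx R,
      inH2 w /\ (exists z, udisk z /\ w z != 0) /\
      bounded_on_H2 (wcomp w phi) /\ compact_on_H2 (wcomp w phi))
   <-> (@lebesgue_measure R).-negligible (unimod_set phi)).
Proof.
move=> sm; split=> [[w [hw [wz [_ hc]]]]|hneg].
  exact: decay_negligible sm (compact_decay sm hw wz hc).
exact: compact_weight sm (negligible_decay sm hneg).
Qed.
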